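(* Let $E\to X$ be a holomorphic vector bundle of finite rank over a compact complex manifold $X$. Let $\mathcal H_E$ be the set of positive definite inner products on $\mathcal O(E)$, and let $b:\mathcal H_E\to C^\infty(E\otimes\overline E)$ be the map that sends $\langle\,,\rangle\in\mathcal H_E$ to its Bergman section $k(x)=\sum_{j=1}^d s_j(x)\otimes s_j(x)$, $x\in X$, where $s_1,\dots,s_d$ is any orthonormal basis of $(\mathcal O(E),\langle\,,\rangle)$. Then $b(\mathcal H_E)\subset C^\infty(E\otimes\overline E)$ is a submanifold, and $b$ is a diffeomorphism between $\mathcal H_E$ and its image.
   Context: $\mathcal O(E)$ is the finite dimensional complex vector space of holomorphic sections of $E$. An inner product means a hermitian symmetric sesquilinear form, not necessarily definite; $\mathcal H_E$ is an open cone in the finite dimensional real vector space of all inner products on $\mathcal O(E)$, hence a manifold. $\overline E\to X$ is the conjugate bundle: the same real vector bundle as $E$, but multiplication by $\lambda\in\mathbb C$ in the fibers of $\overline E$ is multiplication by $\overline\lambda$ in $E$; it is a smooth complex vector bundle. $E\otimes\overline E\to X$ is the tensor product over $\mathbb C$, and in $s_j(x)\otimes s_j(x)$ the second factor is viewed as an element of $\overline E_x$. $C^\infty(E\otimes\overline E)$ is the Fréchet space of smooth sections of $E\otimes\overline E$. Smoothness: a map $f:U\to G$ from an open subset $U$ of a real Fréchet space $F$ to a Fréchet space $G$ is $C^1$ if the directional derivatives $df(x,\xi)=\lim_{t\to0}(f(x+t\xi)-f(x))/t$ exist for all $x\in U,\xi\in F$ and $df:U\times F\to G$ is continuous; it is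 $C^{k+1}$ if $df$ is $C^k$, and smooth if $C^k$ for all $k$. Fréchet manifolds are Hausdorff spaces glued from open subsets of Fréchet spaces by smooth diffeomorphisms. Submanifold: a subset $N$ of a Fréchet manifold $M$ is a submanifold if every $x\in N$ has a neighborhood $U\subset M$ for which there are a Fréchet space $F$, a closed subspace $G\subset F$, and a diffeomorphism $\Phi$ of $U$ onto a neighborhood $V$ of $0\in F$ with $\Phi(U\cap N)=V\cap G$; the restrictions of such $\Phi$ to $N$ define the manifold structure of $N$. A submanifold is not required to be a closed subset.
   Formalization: The compact complex manifold X is assumed connected; without this the claim fails (for X two points and E the trivial line bundle, the Bergman section forgets the off-diagonal entries, so b is not injective). *)

(* Defs.v *)
From HB Require Import structures.
From mathcomp Require Import all_boot all_order all_algebra.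
From mathcomp Require Import complex.
From mathcomp Require Import all_classical all_reals all_analysis.

Set Implicit Arguments.
Unset Strict Implicit.
Unset Printing Implicit Defensive.

Import Order.TTheory GRing.Theory Num.Theory.
Import numFieldNormedType.Exports.

Local Open Scope classical_set_scope.
Local Open Scope complex_scope.
Local Open Scope ring_scope.

(* The library only attaches the topology of a numFieldType to abstract
   types; this copies it to the concrete field of complex numbers. *)
HB.instance Definition _ (R : realType) := PseudoPointedMetric.copy R[i] R[i]^o.
HB.instance Definition _ (R : realType) := GRing.ComAlgebra.copy R[i] R[i]^o.
HB.instance Definition _ (R : realType) := Vector.copy R[i] R[i]^o.
HB.instance Definition _ (R : realType) := NormedModule.copy R[i] R[i]^o.

(* A complex vector space seen as a real one, with norm complex.Re `|v|. *)
Definition realify (R : realType) (V : Type) : Type := V.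

Section RealifyLmodule.
Variables (R : realType) (V : lmodType R[i]).
Local Notation W := (realify R V).

HB.instance Definition _ := GRing.Zmodule.on W.

Definition realify_scale (a : R) (v : W) : W := (a%:C *: (v : V)).

Fact realify_scaleA a b (v : W) :
  realify_scale a (realify_scale b v) = realify_scale (a * b) v.
Proof. by rewrite /realify_scale scalerA rmorphM. Qed.

Fact realify_scale1 : left_id 1 realify_scale.
Proof. by move=> v; rewrite /realify_scale rmorph1 scale1r. Qed.

Fact realify_scaleDr : right_distributive realify_scale +%R.
Proof. by move=> a u v; rewrite /realify_scale scalerDr. Qed.

Fact realify_scaleDl (v : W) : {morph realify_scale^~ v : a b / a + b}.
Proof. by move=> a b; rewrite /realify_scale rmorphD scalerDl. Qed.

HB.instance Definition _ := GRing.Zmodule_isLmodule.Build R W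
  realify_scaleA realify_scale1 realify_scaleDr realify_scaleDl.

End RealifyLmodule.

Section RealifyNormed.
Variables (R : realType) (V : normedModType R[i]).
Local Notation W := (realify R V).

Definition realify_norm (v : W) : R := complex.Re `|v : V|.

Fact realify_normE (v : W) : (realify_norm v)%:C = `|v : V|.
Proof.
by rewrite /realify_norm; have /ger0_Im := normr_ge0 (v : V); case: `|_| => a b /= ->.
Qed.

Fact realify_normD (u v : W) :
  realify_norm (u + v) <= realify_norm u + realify_norm v.
Proof. by rewrite -lecR rmorphD/= !realify_normE ler_normD. Qed.

Fact realify_normZ (a : R) (v : W) :
  realify_norm (a *: v) = `|a| * realify_norm v.
Proof.
apply: complexI; rewrite rmorphM/= !realify_normE.
rewrite -[a *: v]/(a%:C *: (v : V)) normrZ; congr (_ * _).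
by rewrite normc_def/= expr0n addr0 sqrtr_sqr.
Qed.

Fact realify_norm_eq0 (v : W) : realify_norm v = 0 -> v = 0.
Proof.
move=> v0; apply/eqP; rewrite -(@normr_eq0 _ V); apply/eqP.
by rewrite -realify_normE v0.
Qed.

HB.instance Definition _ := Lmodule_isNormed.Build R W
  realify_normD realify_normZ realify_norm_eq0.

End RealifyNormed.

(* A vector space with the locally convex topology generated by an explicit
   family of seminorms. *)
HB.factory Record Lmodule_isSeminormed (R : realType) V & GRing.Lmodule R V := {
  snorm_index : Type;
  snorm : snorm_index -> V -> R;
  ler_snormD : forall i x y, snorm i (x + y) <= snorm i x + snorm i y;
  snormZ : forall i (a : R) x, snorm i (a *: x) = `|a| * snorm i x
}.

HB.builders Context R V & Lmodule_isSeminormed R V.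

Definition fsnorm (s : seq snorm_index) (x : V) : R := \sum_(i <- s) snorm i x.

Lemma fsnormD s x y : fsnorm s (x + y) <= fsnorm s x + fsnorm s y.
Proof. by rewrite /fsnorm -big_split/=; apply: ler_sum => i _; exact: ler_snormD. Qed.

Lemma fsnormZ s a x : fsnorm s (a *: x) = `|a| * fsnorm s x.
Proof. by rewrite /fsnorm mulr_sumr; apply: eq_bigr => i _; exact: snormZ. Qed.

Lemma fsnorm0 s : fsnorm s 0 = 0.
Proof. by rewrite -(scale0r 0) fsnormZ normr0 mul0r. Qed.

Lemma fsnormN s x : fsnorm s (- x) = fsnorm s x.
Proof. by rewrite -scaleN1r fsnormZ normrN1 mul1r. Qed.

Lemma fsnorm_ge0 s x : 0 <= fsnorm s x.
Proof.
have := fsnormD s x (- x); rewrite subrr fsnorm0 fsnormN -mulr2n.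
by rewrite pmulrn_lge0.
Qed.

Lemma fsnorm_cat s t x : fsnorm (s ++ t) x = fsnorm s x + fsnorm t x.
Proof. by rewrite /fsnorm big_cat. Qed.

Definition fball (s : seq snorm_index) (e : R) (x : V) : set V :=
  [set y | fsnorm s (y - x) < e].

Definition fnbhs (x : V) : set_system V :=
  filter_from [set se : seq snorm_index * R | 0 < se.2]
              (fun se => fball se.1 se.2 x).

HB.instance Definition _ := hasNbhs.Build V fnbhs.

Lemma fballxx s e x : 0 < e -> fball s e x x.
Proof. by move=> e0; rewrite /fball/= subrr fsnorm0. Qed.

Lemma fnbhs_filter x : ProperFilter (fnbhs x).
Proof.
apply: filter_from_proper; last by move=> [s e] /= e0; exists x; exact: fballxx.
apply: filter_from_filter; first by exists ([::], 1) => /=.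
move=> [s e] [t d] /= e0 d0; exists (s ++ t, Num.min e d) => /=.
  by rewrite lt_min e0.
move=> y; rewrite /fball/= fsnorm_cat lt_min => /andP[ye yd]; split.
  by apply: le_lt_trans ye; rewrite lerDl fsnorm_ge0.
by apply: le_lt_trans yd; rewrite lerDr fsnorm_ge0.
Qed.

Lemma fnbhs_singleton x (A : set V) : fnbhs x A -> A x.
Proof. by move=> [[s e] /= e0]; apply; exact: fballxx. Qed.

Lemma fball_sub s e x y : fball s e x y ->
  fball s (e - fsnorm s (y - x)) y `<=` fball s e x.
Proof.
rewrite /fball/= => xy z /=; rewrite ltrBrDr => yz.
have -> : z - x = (z - y) + (y - x) by rewrite addrA subrK.
exact: le_lt_trans (fsnormD _ _ _) yz.
Qed.

Lemma fnbhs_nbhs x (A : set V) : fnbhs x A -> fnbhs x (fnbhs^~ A).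
Proof.
move=> [[s e] /= e0 sA]; exists (s, e) => //= y xy.
exists (s, e - fsnorm s (y - x)) => /=; first by rewrite subr_gt0.
exact: subset_trans (fball_sub xy) sA.
Qed.

HB.instance Definition _ :=
  Nbhs_isNbhsTopological.Build V fnbhs_filter fnbhs_singleton fnbhs_nbhs.

Lemma fsnorm_add_continuous : continuous (fun x : V * V => x.1 + x.2).
Proof.
move=> [x y] A /= [[s e] /= e0 sA].
exists (fball s (e / 2) x, fball s (e / 2) y) => /=.
  by split; exists (s, e / 2) => //=; rewrite divr_gt0.
move=> [u v] /= [xu yv]; apply: sA; rewrite /fball/=.
rewrite opprD addrACA [ltRHS]splitr.
by apply: le_lt_trans (fsnormD _ _ _) _; exact: ltrD.
Qed.

Lemma fsnorm_scale_continuous : continuous (fun z : R^o * V => z.1 *: z.2).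
Proof.
move=> [a x] A /= [[s e] /= e0 sA].
have x1 : 0 < fsnorm s x + 1 by rewrite ltr_wpDl ?fsnorm_ge0.
have a1 : 0 < `|a| + 1 by rewrite ltr_wpDl.
pose d := Num.min 1 (e / 2 / (fsnorm s x + 1)).
have d0 : 0 < d by rewrite lt_min ltr01 !divr_gt0.
exists (ball (a : R^o) d, fball s (e / 2 / (`|a| + 1)) x) => /=.
  by split; [exact: nbhsx_ballx|exists (s, e / 2 / (`|a| + 1)); rewrite //= !divr_gt0].
move=> [b y] /= [ab xy]; apply: sA; rewrite /fball/=.
have -> : b *: y - a *: x = b *: (y - x) + (b - a) *: x.
  by rewrite scalerBr scalerBl addrA subrK.
have {}ab : `|b - a| < d by rewrite distrC.
apply: le_lt_trans (fsnormD _ _ _) _; rewrite !fsnormZ [ltRHS]splitr.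
apply: ltr_leD.
  have ba : `|b| <= `|a| + 1.
    have -> : b = a + (b - a) by rewrite addrC subrK.
    apply: le_trans (ler_normD _ _) _; rewrite lerD2l ltW//.
    by apply: lt_le_trans ab _; rewrite ge_min lexx.
  apply: le_lt_trans (ler_wpM2r (fsnorm_ge0 _ _) ba) _.
  by rewrite mulrC -ltr_pdivlMr.
apply: (@le_trans _ _ (d * (fsnorm s x + 1))).
  by rewrite ler_pM ?fsnorm_ge0// ?lerDl// ltW.
by rewrite -ler_pdivlMr// ge_min lexx orbT.
Qed.

Lemma fsnorm_locally_convex : exists2 B : set_system V,
  (forall b, b \in B -> convex_set b) & basis B.
Proof.
exists [set b | exists s e x, b = fball s e x].
  move=> _ /set_mem[s [e [x ->]]]; apply/convex_setW => u v /set_mem/= xu /set_mem/= xv k.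
  move=> k0 k1; apply/mem_set; rewrite /fball/= in xu xv *.
  set c := k%:num in k0 k1 *.
  have -> : (conv k (u : convex_lmodType V) (v : convex_lmodType V) : V) - x =
            c *: (u - x) + (1 - c) *: (v - x).
    rewrite -[conv _ _ _]/(c *: u + (1 - c) *: v).
    rewrite !scalerBr addrACA; congr (_ + _).
    by rewrite -opprD -scalerDl addrC subrK scale1r.
  apply: le_lt_trans (fsnormD _ _ _) _; rewrite !fsnormZ.
  rewrite (gtr0_norm k0) gtr0_norm ?subr_gt0//.
  have -> : e = c * e + (1 - c) * e by rewrite -mulrDl addrC subrK mul1r.
  by rewrite ltrD// ltr_pM2l// subr_gt0.
split.
  move=> _ [s [e [x ->]]]; rewrite openE => y xy.
  exists (s, e - fsnorm s (y - x)) => /=; first by rewrite subr_gt0.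
  exact: fball_sub.
move=> x A [[s e] /= e0 sA]; exists (fball s e x) => //.
by split; [exists s, e, x|exact: fballxx].
Qed.

HB.instance Definition _ := PreTopologicalLmod_isTvs.Build R V
  fsnorm_add_continuous fsnorm_scale_continuous fsnorm_locally_convex.
HB.instance Definition _ := PreTopologicalNmodule_isTopologicalNmodule.Build V
  fsnorm_add_continuous.
HB.instance Definition _ := TopologicalNmodule_isTopologicalLmodule.Build R V
  fsnorm_scale_continuous.
HB.instance Definition _ := Uniform_isTvs.Build R V fsnorm_locally_convex.

HB.end.

Notation Cn R n := (realify R 'rV[R[i]]_n).

Section ChartCalculus.
Variables (R : realType).

Definition iter_derive (V W : normedModType R) (vs : seq V) (f : V -> W) :
  V -> W := foldr (fun v g => 'D_v g) f vs.

(* On an open subset of a finite dimensional space, existence and continuity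
   of all iterated directional derivatives amounts to being of class C^oo. *)
Definition smooth_in (V W : normedModType R) (D : set V) (f : V -> W) :=
  forall vs x, D x -> {for x, continuous (iter_derive vs f)} /\
    forall v, derivable (iter_derive vs f) x v.

(* As in Griffiths-Harris or Huybrechts, a holomorphic function of several
   variables is a smooth one whose differential is complex linear. *)
Definition holomorphic_in (n : nat) (D : set (Cn R n)) (f : Cn R n -> R[i]) :=
  smooth_in D (f : Cn R n -> realify R R[i]) /\
  forall x, D x -> differentiable (f : 'rV[R[i]]_n -> R[i]) (x : 'rV[R[i]]_n).

Lemma iter_deriveD (V W : normedModType R) (D : set V) (f g : V -> W) :
  open D -> smooth_in D f -> smooth_in D g ->
  forall vs x, D x ->
    iter_derive vs (f + g) x = iter_derive vs f x + iter_derive vs g x.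
Proof.
move=> oD sf sg; elim=> [//|v vs IH] x Dx /=.
have [_ df] := sf vs x Dx; have [_ dg] := sg vs x Dx.
rewrite -deriveD//; apply: near_eq_derive.
by near=> y; apply: IH; near: y; exact: open_nbhs_nbhs.
Unshelve. all: by end_near. Qed.

Lemma smooth_inD (V W : normedModType R) (D : set V) (f g : V -> W) :
  open D -> smooth_in D f -> smooth_in D g -> smooth_in D (f + g).
Proof.
move=> oD sf sg vs x Dx.
have [cf df] := sf vs x Dx; have [cg dg] := sg vs x Dx.
have E : {near x, iter_derive vs f + iter_derive vs g =1 iter_derive vs (f + g)}.
  near=> y; rewrite (iter_deriveD oD)//; near: y; exact: open_nbhs_nbhs.
split=> [|v].
  rewrite /prop_for /continuous_at -(nbhs_singleton E).
  apply: cvg_trans; first exact: near_eq_cvg E.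
  exact: cvgD.
by apply: near_eq_derivable E _; exact: derivableD.
Unshelve. all: by end_near. Qed.

Lemma smooth_in_cst (V W : normedModType R) (D : set V) (c : W) :
  smooth_in D (cst c).
Proof.
have E (vs : seq V) : exists c' : W, iter_derive vs (cst c) = cst c'.
  elim: vs => [|v vs [c' /= ->]]; first by exists c.
  by exists 0; apply/funext => x; rewrite derive_cst.
move=> vs x _; have [c' ->] := E vs.
by split=> [|v]; [exact: cst_continuous|exact: derivable_cst].
Qed.

Lemma scaled_isometry_continuous (W : normedModType R) (f : W -> W) (k : R) :
  0 <= k -> (forall x y, `|f x - f y| = k * `|x - y|) -> continuous f.
Proof.
move=> k0 fk z; apply/cvgrPdist_lt => e e0; near=> y.
rewrite fk; apply: (@le_lt_trans _ _ ((k + 1) * `|z - y|)).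
  by rewrite ler_wpM2r ?lerDl.
rewrite mulrC -ltr_pdivlMr ?ltr_wpDl//; near: y.
by apply: cvgr_dist_lt; rewrite ?divr_gt0 ?ltr_wpDl//; exact: cvg_id.
Unshelve. all: by end_near. Qed.

Lemma mulC_continuous (a : R[i]) :
  continuous ((fun z => a * z) : realify R R[i] -> realify R R[i]).
Proof.
apply: (@scaled_isometry_continuous _ _ (realify_norm (a : realify R R[i]))).
  exact: (@normr_ge0 _ (realify R R[i])).
move=> x y; rewrite -[LHS]/(realify_norm (a * x - a * y : realify R R[i])).
rewrite -[in RHS]/(realify_norm (x - y : realify R R[i])).
by apply: complexI; rewrite rmorphM/= !realify_normE -normrM mulrBr.
Qed.

Lemma is_deriveMC (V : normedModType R) (a : R[i]) (f : V -> realify R R[i])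
    x v : derivable f x v ->
  is_derive x v ((fun y => a * f y) : V -> realify R R[i])
    (a * 'D_v f x : realify R R[i]).
Proof.
move=> df.
have H : (fun h : R => h^-1 *: ((((fun y => a * f y) : V -> realify R R[i])
      \o shift x) (h *: v) - (a * f x : realify R R[i]))) @ 0^' -->
    (a * 'D_v f x : realify R R[i]).
  rewrite (_ : (fun h : R => _) = (fun z : realify R R[i] => (a * z : realify R R[i]))
    \o (fun h : R => h^-1 *: ((f \o shift x) (h *: v) - f x))); last first.
    apply/funext => h /=.
    rewrite -[LHS]/((h^-1)%:C * (a * f (h *: v + x) - a * f x)).
    rewrite -[RHS]/(a * ((h^-1)%:C * (f (h *: v + x) - f x))).
    by rewrite -mulrBr mulrCA.
  by apply: (@cvg_comp _ _ _ _ _ _ (nbhs ('D_v f x))); [exact: df|exact: mulC_continuous].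
split; first by apply/cvg_ex; eexists; exact: H.
exact: cvg_lim H.
Qed.

Lemma iter_deriveMC (V : normedModType R) (D : set V) (a : R[i])
    (f : V -> realify R R[i]) : open D -> smooth_in D f ->
  forall vs x, D x ->
    iter_derive vs ((fun y => a * f y) : V -> realify R R[i]) x =
    a * iter_derive vs f x.
Proof.
move=> oD sf; elim=> [//|v vs IH] x Dx /=.
have [_ df] := sf vs x Dx.
have [_ <-] := is_deriveMC a (df v); apply: near_eq_derive.
by near=> y; apply: IH; near: y; exact: open_nbhs_nbhs.
Unshelve. all: by end_near. Qed.

Lemma smooth_inMC (V : normedModType R) (D : set V) (a : R[i])
    (f : V -> realify R R[i]) : open D -> smooth_in D f ->
  smooth_in D ((fun y => a * f y) : V -> realify R R[i]).
Proof.
move=> oD sf vs x Dx; have [cf df] := sf vs x Dx.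
have E : {near x, (fun y => a * iter_derive vs f y : realify R R[i]) =1
    iter_derive vs ((fun y => a * f y) : V -> realify R R[i])}.
  near=> y; rewrite (iter_deriveMC _ oD)//; near: y; exact: open_nbhs_nbhs.
split=> [|v].
  rewrite /prop_for /continuous_at -(nbhs_singleton E).
  apply: cvg_trans; first exact: near_eq_cvg E.
  by apply: (@cvg_comp _ _ _ _ _ _ (nbhs (iter_derive vs f x))); [exact: cf|exact: mulC_continuous].
by apply: near_eq_derivable E _; have [] := is_deriveMC a (df v).
Unshelve. all: by end_near. Qed.

Lemma holomorphic_in_submod n (D : set (Cn R n)) (a : R[i])
    (f g : Cn R n -> R[i]) : open D -> holomorphic_in D f ->
  holomorphic_in D g -> holomorphic_in D (fun y => a * f y + g y).
Proof.
move=> oD [sf df] [sg dg]; split.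
  exact: (smooth_inD oD (smooth_inMC a oD sf) sg).
move=> x Dx; apply: (@differentiableD _ 'rV[R[i]]_n R[i] (a *: f) g); last exact: dg.
by apply: differentiableZ; exact: df.
Qed.

End ChartCalculus.

Section Manifold.
Variables (R : realType).

Record chart (X : topologicalType) (n : nat) := Chart {
  chart_dom : set X;
  chart_target : set (Cn R n);
  chart_map : X -> Cn R n;
  chart_inv : Cn R n -> X;
  chart_dom_open : open chart_dom;
  chart_target_open : open chart_target;
  chart_mapP : forall x, chart_dom x -> chart_target (chart_map x);
  chart_invP : forall y, chart_target y -> chart_dom (chart_inv y);
  chart_mapK : forall x, chart_dom x -> chart_inv (chart_map x) = x;
  chart_invK : forall y, chart_target y -> chart_map (chart_inv y) = y;
  chart_map_continuous : {within chart_dom, continuous chart_map};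
  chart_inv_continuous : {within chart_target, continuous chart_inv}
}.

(* The image under c of W `&` chart_dom c. *)
Definition chart_image (X : topologicalType) n (c : chart X n) (W : set X) :
  set (Cn R n) := [set y | chart_target c y /\ W (chart_inv c y)].

Lemma chart_image_open (X : topologicalType) n (c : chart X n) (W : set X) :
  open W -> open (chart_image c W).
Proof.
move=> oW; have /continuousP/(_ W oW) := @chart_inv_continuous _ _ c.
move=> /open_subspaceP[U oU UE].
suff -> : chart_image c W = U `&` chart_target c.
  by apply: openI => //; exact: chart_target_open.
by rewrite UE setIC.
Qed.

Record complexManifold (n : nat) := ComplexManifold {
  space :> topologicalType;
  atlas : set (chart space n);
  space_hausdorff : hausdorff_space space;
  atlas_cover : forall x : space, exists2 c, atlas c & chart_dom c x;
  atlas_holomorphic : forall c1 c2, atlas c1 -> atlas c2 -> forall i : 'I_n,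
    holomorphic_in (chart_image c1 (chart_dom c2))
      (fun y => (chart_map c2 (chart_inv c1 y) : 'rV[R[i]]_n) 0 i)
}.

Variables (n : nat) (X : complexManifold n).

Definition holomorphic_on (W : set X) (f : X -> R[i]) :=
  forall c : chart X n, atlas c ->
    holomorphic_in (chart_image c W) (f \o chart_inv c).

Definition smooth_on (W : set X) (f : X -> R[i]) :=
  forall c : chart X n, atlas c ->
    smooth_in (chart_image c W)
      (f \o chart_inv c : Cn R n -> realify R R[i]).

Lemma holomorphic_on_submod (W : set X) (a : R[i]) (f g : X -> R[i]) :
  open W -> holomorphic_on W f -> holomorphic_on W g ->
  holomorphic_on W (fun x => a * f x + g x).
Proof.
move=> oW hf hg c Ac; apply: holomorphic_in_submod.
- exact: chart_image_open.
- exact: hf.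
- exact: hg.
Qed.

Lemma smooth_on_submod (W : set X) (a : R[i]) (f g : X -> R[i]) :
  open W -> smooth_on W f -> smooth_on W g ->
  smooth_on W (fun x => a * f x + g x).
Proof.
move=> oW hf hg c Ac; have oD : open (chart_image c W) by exact: chart_image_open.
exact: (smooth_inD oD (smooth_inMC a oD (hf c Ac)) (hg c Ac)).
Qed.

End Manifold.
Arguments atlas {R n} _.

Section Bundle.
Variables (R : realType).

Record trivialization (X : topologicalType) (E : X -> vectType R[i])
    (r : nat) := Trivialization {
  triv_dom : set X;
  triv_map : forall x, {linear E x -> 'rV[R[i]]_r};
  triv_dom_open : open triv_dom
}.

(* The total space is given by its fibres; the trivializations, once they
   satisfy [is_bundle] below, determine its topology and its smooth or complex
   structure. *)
Record bundle_data (X : topologicalType) := BundleData {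
  fiber : X -> vectType R[i];
  rank : nat;
  trivs : set (trivialization fiber rank)
}.
Arguments trivs {X} _.

(* [regular W f] is the regularity (smooth, holomorphic) on the open set W
   demanded of the entries of the transition matrices. *)
Definition is_bundle (X : topologicalType)
    (regular : set X -> (X -> R[i]) -> Prop) (B : bundle_data X) :=
  [/\ forall x, exists2 t, trivs B t & triv_dom t x,
      forall t, trivs B t -> forall x, triv_dom t x -> bijective (triv_map t x)
    & forall t1 t2, trivs B t1 -> trivs B t2 ->
      exists g : X -> 'M[R[i]]_(rank B),
        (forall i j, regular (triv_dom t1 `&` triv_dom t2)
                             (fun x => g x i j)) /\
        forall x, triv_dom t1 x -> triv_dom t2 x ->
          forall e : fiber B x, triv_map t1 x e = triv_map t2 x e *m g x].

Record holomorphicBundle (n : nat) (X : complexManifold R n) :=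
  HolomorphicBundle {
    bundle :> bundle_data X;
    bundleP : is_bundle (@holomorphic_on R n X) bundle
  }.

End Bundle.
Arguments trivs {R X} _.

Section SectionModule.
Variables (R : realType) (X : topologicalType) (B : bundle_data R X).

Definition section : Type := forall x, fiber B x.

HB.instance Definition _ := gen_eqMixin section.
HB.instance Definition _ := gen_choiceMixin section.

Definition section_zero : section := fun=> 0.
Definition section_opp (s : section) : section := fun x => - s x.
Definition section_add (s t : section) : section := fun x => s x + t x.
Definition section_scale (a : R[i]) (s : section) : section :=
  fun x => a *: s x.

Fact section_addA : associative section_add.
Proof. by move=> s t u; apply: functional_extensionality_dep => x; exact: addrA. Qed.
Fact section_addC : commutative section_add.
Proof. by move=> s t; apply: functional_extensionality_dep => x; exact: addrC. Qed.
Fact section_add0 : left_id section_zero section_add.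
Proof. by move=> s; apply: functional_extensionality_dep => x; exact: add0r. Qed.
Fact section_addN : left_inverse section_zero section_opp section_add.
Proof. by move=> s; apply: functional_extensionality_dep => x; exact: addNr. Qed.

HB.instance Definition _ := GRing.isZmodule.Build section
  section_addA section_addC section_add0 section_addN.

Fact section_scaleA a b (s : section) :
  section_scale a (section_scale b s) = section_scale (a * b) s.
Proof. by apply: functional_extensionality_dep => x; exact: scalerA. Qed.
Fact section_scale1 : left_id 1 section_scale.
Proof. by move=> s; apply: functional_extensionality_dep => x; exact: scale1r. Qed.
Fact section_scaleDr : right_distributive section_scale +%R.
Proof. by move=> a s t; apply: functional_extensionality_dep => x; exact: scalerDr. Qed.
Fact section_scaleDl (s : section) : {morph section_scale^~ s : a b / a + b}.
Proof. by move=> a b; apply: functional_extensionality_dep => x; exact: scalerDl. Qed.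

HB.instance Definition _ := GRing.Zmodule_isLmodule.Build R[i] section
  section_scaleA section_scale1 section_scaleDr section_scaleDl.

End SectionModule.

Section RegularSections.
Variables (R : realType) (n : nat) (X : complexManifold R n).
Variable (B : bundle_data R X).

Definition section_coord (t : trivialization (fiber B) (rank B))
    (j : 'I_(rank B)) (s : section B) (x : X) : R[i] := triv_map t x (s x) 0 j.

Definition is_holomorphic (s : section B) := forall t, trivs B t ->
  forall j, holomorphic_on (triv_dom t) (section_coord t j s).

Definition is_smooth (s : section B) := forall t, trivs B t ->
  forall j, smooth_on (triv_dom t) (section_coord t j s).

Fact section_coord_linear t j a (s u : section B) :
  section_coord t j (a *: s + u) =
  (fun x => a * section_coord t j s x + section_coord t j u x).
Proof. by apply/funext => x; rewrite /section_coord linearP !mxE. Qed.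

Fact section_coord0 t j : section_coord t j 0 = (fun=> 0).
Proof. by apply/funext => x; rewrite /section_coord linear0 mxE. Qed.

Definition holomorphic_pred : {pred section B} := fun s => `[< is_holomorphic s >].
Definition smooth_pred : {pred section B} := fun s => `[< is_smooth s >].

Fact holomorphic_pred_submod : submod_closed holomorphic_pred.
Proof.
split.
  apply/asboolP => t _ j; rewrite section_coord0 => c _; split.
    exact: (@smooth_in_cst _ _ (realify R R[i])).
  by move=> x _; exact: (@differentiable_cst _ 'rV[R[i]]_n R[i]).
move=> a s u /asboolP hs /asboolP hu; apply/asboolP => t Bt j.
rewrite section_coord_linear; apply: holomorphic_on_submod.
- exact: triv_dom_open.
- exact: hs.
- exact: hu.
Qed.

Fact smooth_pred_submod : submod_closed smooth_pred.
Proof.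
split.
  apply/asboolP => t _ j; rewrite section_coord0 => c _.
  exact: (@smooth_in_cst _ _ (realify R R[i])).
move=> a s u /asboolP hs /asboolP hu; apply/asboolP => t Bt j.
rewrite section_coord_linear; apply: smooth_on_submod.
- exact: triv_dom_open.
- exact: hs.
- exact: hu.
Qed.

HB.instance Definition _ :=
  GRing.isSubmodClosed.Build R[i] (section B) holomorphic_pred
    holomorphic_pred_submod.
HB.instance Definition _ :=
  GRing.isSubmodClosed.Build R[i] (section B) smooth_pred smooth_pred_submod.

Record holomorphic_section := HolomorphicSection {
  holomorphic_section_val :> section B;
  _ : holomorphic_section_val \in holomorphic_pred
}.
HB.instance Definition _ := [isSub for holomorphic_section_val].
HB.instance Definition _ := [Choice of holomorphic_section by <:].
HB.instance Definition _ :=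
  [SubChoice_isSubLmodule of holomorphic_section by <:].

Record smooth_section := SmoothSection {
  smooth_section_val :> section B;
  _ : smooth_section_val \in smooth_pred
}.
HB.instance Definition _ := [isSub for smooth_section_val].
HB.instance Definition _ := [Choice of smooth_section by <:].
HB.instance Definition _ := [SubChoice_isSubLmodule of smooth_section by <:].

End RegularSections.

(* The complex vector space V with scalars acting through conjugation. *)
Definition conjugate (V : Type) : Type := V.

Section ConjugateLmodule.
Variables (R : realType) (V : lmodType R[i]).
Local Notation W := (conjugate V).

HB.instance Definition _ := GRing.Zmodule.on W.

Definition conjugate_scale (a : R[i]) (v : W) : W := (a^* : R[i]) *: (v : V).

Fact conjugate_scaleA a b (v : W) :
  conjugate_scale a (conjugate_scale b v) = conjugate_scale (a * b) v.
Proof. by rewrite /conjugate_scale scalerA rmorphM. Qed.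
Fact conjugate_scale1 : left_id 1 conjugate_scale.
Proof. by move=> v; rewrite /conjugate_scale rmorph1 scale1r. Qed.
Fact conjugate_scaleDr : right_distributive conjugate_scale +%R.
Proof. by move=> a u v; rewrite /conjugate_scale scalerDr. Qed.
Fact conjugate_scaleDl (v : W) : {morph conjugate_scale^~ v : a b / a + b}.
Proof. by move=> a b; rewrite /conjugate_scale rmorphD scalerDl. Qed.

HB.instance Definition _ := GRing.Zmodule_isLmodule.Build R[i] W
  conjugate_scaleA conjugate_scale1 conjugate_scaleDr conjugate_scaleDl.

End ConjugateLmodule.

Definition conj_coord (R : realType) (V : lmodType R[i]) (m : nat)
  (f : V -> 'rV[R[i]]_m) (v : conjugate V) : 'rV[R[i]]_m :=
  map_mx Num.conj (f v).

Section ConjugateCoord.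
Variables (R : realType) (V : lmodType R[i]) (m : nat).
Variable (f : {linear V -> 'rV[R[i]]_m}).

Fact conj_coord_linear : linear (conj_coord f).
Proof.
move=> a u v; apply/rowP => j; rewrite !mxE.
rewrite -[a *: u + v]/((a^* : R[i]) *: (u : V) + (v : V)).
by rewrite linearP !mxE rmorphD rmorphM/= conjCK.
Qed.

HB.instance Definition _ := GRing.isLinear.Build R[i] (conjugate V) 'rV[R[i]]_m
  _ (conj_coord f) conj_coord_linear.

End ConjugateCoord.

Section ConjugateVector.
Import VectorInternalTheory.
Variables (R : realType) (V : vectType R[i]).

Fact conjugate_vect_iso : Vector.axiom (dim V) (conjugate V).
Proof.
exists (conj_coord (@v2r R[i] V)); first exact: (@conj_coord_linear R V _ (@v2r R[i] V)).
exists (fun r => r2v (map_mx Num.conj r) : V) => [v|r].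
  rewrite /conj_coord -[RHS](v2rK (v : V)); congr r2v.
  by apply/rowP => j; rewrite !mxE conjCK.
by rewrite /conj_coord r2vK; apply/rowP => j; rewrite !mxE conjCK.
Qed.

HB.instance Definition _ :=
  Lmodule_hasFinDim.Build R[i] (conjugate V) conjugate_vect_iso.

End ConjugateVector.

(* The tensor product of finite dimensional spaces, realized as the dual of the
   space of bilinear forms; [tens v w] is evaluation at (v, w). *)
Definition tensor (R : realType) (V W : vectType R[i]) : vectType R[i] :=
  'Hom('Hom(V, 'Hom(W, R[i]^o)), R[i]^o).

Definition tens (R : realType) (V W : vectType R[i]) (v : V) (w : W) :
  tensor V W := linfun (fun b : 'Hom(V, 'Hom(W, R[i]^o)) => b v w).

Section TensorCoord.
Variables (R : realType) (V W : vectType R[i]) (p q : nat).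
Variables (f : V -> 'rV[R[i]]_p) (g : W -> 'rV[R[i]]_q).

Definition coord_form (i : 'I_p) (j : 'I_q) : 'Hom(V, 'Hom(W, R[i]^o)) :=
  linfun (fun v => linfun (fun w => f v 0 i * g w 0 j : R[i]^o)).

(* [tens v w] has coordinates f_i(v) * g_j(w). *)
Definition tensor_coord (z : tensor V W) : 'rV[R[i]]_(p * q) :=
  mxvec (\matrix_(i, j) (z (coord_form i j) : R[i])).

Fact tensor_coord_linear : linear tensor_coord.
Proof.
move=> a u v; rewrite /tensor_coord -linearP; congr mxvec.
by apply/matrixP => i j; rewrite !mxE add_lfunE scale_lfunE.
Qed.

HB.instance Definition _ := GRing.isLinear.Build R[i] (tensor V W)
  'rV[R[i]]_(p * q) _ tensor_coord tensor_coord_linear.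

End TensorCoord.

Section BundleOperations.
Variables (R : realType) (X : topologicalType).

Definition conj_fiber (E : X -> vectType R[i]) (x : X) : vectType R[i] :=
  conjugate (E x).

Definition conj_triv (E : X -> vectType R[i]) r (t : trivialization E r) :
  trivialization (conj_fiber E) r :=
  @Trivialization R X (conj_fiber E) r (triv_dom t)
    (fun x => conj_coord (triv_map t x) : {linear conjugate (E x) -> _})
    (triv_dom_open t).

Definition conj_bundle (B : bundle_data R X) : bundle_data R X :=
  BundleData [set conj_triv t | t in trivs B].

Definition tensor_fiber (E F : X -> vectType R[i]) (x : X) : vectType R[i] :=
  tensor (E x) (F x).

Definition tensor_triv (E F : X -> vectType R[i]) p q
    (t : trivialization E p) (u : trivialization F q) :
  trivialization (tensor_fiber E F) (p * q) :=
  @Trivialization R X (tensor_fiber E F) (p * q)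
    (triv_dom t `&` triv_dom u)
    (fun x => tensor_coord (triv_map t x) (triv_map u x)
              : {linear tensor (E x) (F x) -> _})
    (openI (triv_dom_open t) (triv_dom_open u)).

Definition tensor_bundle (B1 B2 : bundle_data R X) : bundle_data R X :=
  BundleData [set tensor_triv t u | t in trivs B1 & u in trivs B2].

End BundleOperations.

Section SmoothSectionSpace.
Variables (R : realType) (n : nat) (X : complexManifold R n).
Variable (B : bundle_data R X).

Definition Cinfty : Type := realify R (smooth_section B).
HB.instance Definition _ :=
  GRing.Lmodule.copy Cinfty (realify R (smooth_section B)).

Definition local_coord (c : chart R X n)
    (t : trivialization (fiber B) (rank B)) (j : 'I_(rank B)) (s : section B) :
  Cn R n -> realify R R[i] := section_coord t j s \o chart_inv c.

Record Cinfty_index := CinftyIndex {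
  ci_chart : chart R X n;
  ci_triv : trivialization (fiber B) (rank B);
  ci_set : set (Cn R n);
  ci_dirs : seq (Cn R n);
  ci_coord : 'I_(rank B);
  ci_chartP : atlas X ci_chart;
  ci_trivP : trivs B ci_triv;
  ci_compact : compact ci_set;
  ci_sub : ci_set `<=` chart_image ci_chart (triv_dom ci_triv)
}.

Definition ci_local (k : Cinfty_index) (s : Cinfty) :
  Cn R n -> realify R R[i] :=
  local_coord (ci_chart k) (ci_triv k) (ci_coord k) (s : smooth_section B).

Definition ci_values (k : Cinfty_index) (s : Cinfty) : set R :=
  [set `|iter_derive (ci_dirs k) (ci_local k s) y| | y in ci_set k].

(* These seminorms define uniform convergence of all derivatives, in charts and
   trivializations, on compact sets. *)
Definition Cinfty_norm (k : Cinfty_index) (s : Cinfty) : R :=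
  sup (ci_values k s).

Fact ci_dom_open k : open (chart_image (ci_chart k) (triv_dom (ci_triv k))).
Proof. by apply: chart_image_open; exact: triv_dom_open. Qed.

Fact ci_local_smooth k (s : Cinfty) :
  smooth_in (chart_image (ci_chart k) (triv_dom (ci_triv k))) (ci_local k s).
Proof.
have /asboolP := valP (s : smooth_section B).
by move=> /(_ _ (ci_trivP k) (ci_coord k) _ (ci_chartP k)).
Qed.

Fact ci_localD k (s t : Cinfty) : ci_local k (s + t) = ci_local k s + ci_local k t.
Proof.
apply/funext => z.
transitivity (triv_map (ci_triv k) (chart_inv (ci_chart k) z)
  (smooth_section_val s _ + smooth_section_val t _) 0 (ci_coord k)) => //.
by rewrite linearD mxE.
Qed.

Fact ci_localZ k a (s : Cinfty) :
  ci_local k (a *: s) = (fun z => a%:C * ci_local k s z).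
Proof.
apply/funext => z.
transitivity (triv_map (ci_triv k) (chart_inv (ci_chart k) z)
  (a%:C *: smooth_section_val s _) 0 (ci_coord k)) => //.
by rewrite linearZ mxE.
Qed.

Fact ci_iterD k s t y : ci_set k y ->
  `|iter_derive (ci_dirs k) (ci_local k (s + t)) y| <=
  `|iter_derive (ci_dirs k) (ci_local k s) y| +
  `|iter_derive (ci_dirs k) (ci_local k t) y|.
Proof.
move=> Ky; rewrite ci_localD.
rewrite (iter_deriveD (ci_dom_open (k := k)) (ci_local_smooth s)
  (ci_local_smooth t) _ (ci_sub Ky)).
exact: ler_normD.
Qed.

Fact ci_iterZ k a s y : ci_set k y ->
  `|iter_derive (ci_dirs k) (ci_local k (a *: s)) y| =
  `|a| * `|iter_derive (ci_dirs k) (ci_local k s) y|.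
Proof.
move=> Ky; rewrite ci_localZ.
rewrite (iter_deriveMC _ (ci_dom_open (k := k)) (ci_local_smooth s) _
  (ci_sub Ky)).
exact: (normrZ a (iter_derive (ci_dirs k) (ci_local k s) y : realify R R[i])).
Qed.

Fact ci_values_bounded k s : has_ubound (ci_values k s).
Proof.
have cf : {within ci_set k, continuous (iter_derive (ci_dirs k) (ci_local k s))}.
  apply: continuous_in_subspaceT => y /set_mem Ky.
  by have [] := ci_local_smooth s (ci_dirs k) (ci_sub Ky).
have /compact_bounded[M [_ Mf]] := continuous_compact cf (@ci_compact k).
exists (M + 1) => _ [y Ky <-]; apply: (Mf (M + 1)); first by rewrite ltrDl.
by exists y.
Qed.

Fact Cinfty_norm_ub k s y : ci_set k y ->
  `|iter_derive (ci_dirs k) (ci_local k s) y| <= Cinfty_norm k s.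
Proof. by move=> Ky; apply: (ub_le_sup (ci_values_bounded k s)); exists y. Qed.

Fact Cinfty_norm_lub k s (M : R) : 0 <= M ->
  (forall y, ci_set k y -> `|iter_derive (ci_dirs k) (ci_local k s) y| <= M) ->
  Cinfty_norm k s <= M.
Proof.
move=> M0 kM; have [K0|K0] := pselect (ci_values k s !=set0).
  by apply: ge_sup => // _ [y Ky <-]; exact: kM.
by rewrite /Cinfty_norm sup_out// => -[].
Qed.

Fact Cinfty_norm_ge0 k s : 0 <= Cinfty_norm k s.
Proof.
have [[y Ky]|K0] := pselect (ci_set k !=set0).
  by apply: le_trans (Cinfty_norm_ub s Ky).
rewrite /Cinfty_norm sup_out// => -[[_ [y Ky _]] _].
by apply: K0; exists y.
Qed.

Fact Cinfty_normD k s t :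
  Cinfty_norm k (s + t) <= Cinfty_norm k s + Cinfty_norm k t.
Proof.
apply: Cinfty_norm_lub; first by rewrite addr_ge0 ?Cinfty_norm_ge0.
move=> y Ky; apply: le_trans (ci_iterD s t Ky) _.
by apply: lerD; exact: Cinfty_norm_ub.
Qed.

Fact Cinfty_normZ k a s : Cinfty_norm k (a *: s) = `|a| * Cinfty_norm k s.
Proof.
have le_Z b u : Cinfty_norm k (b *: u) <= `|b| * Cinfty_norm k u.
  apply: Cinfty_norm_lub; first by rewrite mulr_ge0 ?Cinfty_norm_ge0.
  by move=> y Ky; rewrite ci_iterZ// ler_wpM2l//; exact: Cinfty_norm_ub.
apply/eqP; rewrite eq_le le_Z/=.
have [->|a0] := eqVneq a 0; first by rewrite normr0 mul0r Cinfty_norm_ge0.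
rewrite mulrC -ler_pdivlMr ?normr_gt0// mulrC -normfV.
by apply: le_trans (le_Z _ _); rewrite scalerA mulVf// scale1r.
Qed.

HB.instance Definition _ :=
  Lmodule_isSeminormed.Build R Cinfty Cinfty_normD Cinfty_normZ.

End SmoothSectionSpace.


Section InnerProducts.
Variables (R : realType) (V : lmodType R[i]).

Definition pairing : Type := V -> V -> R[i].
HB.instance Definition _ := GRing.Zmodule.copy pairing (V -> V -> R[i]).

Definition pairing_scale (a : R) (h : pairing) : pairing :=
  fun u v => a%:C * h u v.

Fact pairing_scaleA a b h :
  pairing_scale a (pairing_scale b h) = pairing_scale (a * b) h.
Proof.
by apply/funext => u; apply/funext => v; rewrite /pairing_scale mulrA rmorphM.
Qed.
Fact pairing_scale1 : left_id 1 pairing_scale.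
Proof.
by move=> h; apply/funext => u; apply/funext => v; rewrite /pairing_scale mul1r.
Qed.
Fact pairing_scaleDr : right_distributive pairing_scale +%R.
Proof. by move=> a h k; apply/funext => u; apply/funext => v; exact: mulrDr. Qed.
Fact pairing_scaleDl h : {morph pairing_scale^~ h : a b / a + b}.
Proof.
move=> a b; apply/funext => u; apply/funext => v.
by rewrite /pairing_scale rmorphD mulrDl.
Qed.

HB.instance Definition _ := GRing.Zmodule_isLmodule.Build R pairing
  pairing_scaleA pairing_scale1 pairing_scaleDr pairing_scaleDl.

Definition is_inner_product (h : pairing) :=
  (forall v a u1 u2, h (a *: u1 + u2) v = a * h u1 v + h u2 v) /\
  (forall u v, h v u = (h u v)^*).

Definition inner_product_pred : {pred pairing} :=
  fun h => `[< is_inner_product h >].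

Fact inner_product_submod : submod_closed inner_product_pred.
Proof.
split.
  by apply/asboolP; split=> [v a u1 u2|u v]; rewrite ?mulr0 ?addr0// rmorph0.
move=> a h k /asboolP[hl hs] /asboolP[kl ks]; apply/asboolP; split.
  move=> v b u1 u2.
  rewrite -[LHS]/(a%:C * h (b *: u1 + u2) v + k (b *: u1 + u2) v).
  rewrite -[RHS]/(b * (a%:C * h u1 v + k u1 v) + (a%:C * h u2 v + k u2 v)).
  by rewrite hl kl !mulrDr addrACA mulrCA.
move=> u v; rewrite -[LHS]/(a%:C * h v u + k v u).
rewrite -[in RHS]/(a%:C * h u v + k u v) hs ks rmorphD rmorphM/=.
by congr (_ * _ + _); apply/esym/CrealP; rewrite complex_real.
Qed.

HB.instance Definition _ := GRing.isSubmodClosed.Build R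
  pairing inner_product_pred inner_product_submod.

Record inner_product := InnerProduct {
  inner_product_val :> pairing;
  _ : inner_product_val \in inner_product_pred
}.
HB.instance Definition _ := [isSub for inner_product_val].
HB.instance Definition _ := [Choice of inner_product by <:].
HB.instance Definition _ := [SubChoice_isSubLmodule of inner_product by <:].

(* When V is finite dimensional this induces the usual topology of a finite
   dimensional real vector space. *)
Definition inner_product_norm (uv : V * V) (h : inner_product) : R :=
  `|inner_product_val h uv.1 uv.2 : realify R R[i]|.

Fact inner_product_normD uv h k :
  inner_product_norm uv (h + k) <=
  inner_product_norm uv h + inner_product_norm uv k.
Proof. exact: ler_normD. Qed.

Fact inner_product_normZ uv a h :
  inner_product_norm uv (a *: h) = `|a| * inner_product_norm uv h.
Proof. exact: normrZ. Qed.

HB.instance Definition _ := Lmodule_isSeminormed.Build R inner_product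
  inner_product_normD inner_product_normZ.

Definition positive_definite : set inner_product :=
  [set h | forall v, v != 0 -> 0 < inner_product_val h v v].

Definition orthonormal_basis (h : inner_product) (d : nat) (s : 'I_d -> V) :=
  (forall i j, inner_product_val h (s i) (s j) = (i == j)%:R) /\
  forall v, exists a : 'I_d -> R[i], v = \sum_i a i *: s i.

End InnerProducts.


Section FrechetCalculus.
Variable R : realType.

(* tvsType is the structure of locally convex spaces.  Its uniformity is only
   required to induce the topology, hence the direct formulations of
   metrizability and of completeness from the neighborhoods of 0. *)
Definition is_frechet (F : tvsType R) :=
  [/\ hausdorff_space F,
      exists2 B : nat -> set F, (forall i, nbhs (0 : F) (B i)) &
        forall A, nbhs (0 : F) A -> exists i, B i `<=` A &
      forall U : set_system F, ProperFilter U ->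
        (forall A, nbhs (0 : F) A ->
          exists2 B, U B & forall x y, B x -> B y -> A (x - y)) ->
        exists x : F, U --> x].

(* C^k regularity in the sense of directional derivatives df(x, v) jointly
   continuous in (x, v), for f on a relatively open subset A of a subspace S:
   base points range over A, directions over S, and df lives on A `*` S.  Maps
   on open subsets of F correspond to S = setT. *)
Fixpoint Ck (k : nat) :
    forall F G : tvsType R, set F -> set F -> (F -> G) -> Prop :=
  match k with
  | 0 => fun F G S A f => {within A, continuous f}
  | k'.+1 => fun F G S A f => exists df : (F * F)%type -> G,
      (forall x v, A x -> S v ->
        (fun t : R => t^-1 *: (f (x + t *: v) - f x)) @ 0^' --> df (x, v)) /\
      Ck k' (S `*` S) (A `*` S) df
  end.

Definition smooth_map (F G : tvsType R) (S A : set F) (f : F -> G) :=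
  (exists2 O, open O & A = O `&` S) /\ forall k, Ck k S A f.

Definition closed_subspace (F : tvsType R) (S : set F) :=
  [/\ closed S, S 0 & forall a u v, S u -> S v -> S (a *: u + v)].

(* sc_map flattens N inside sc_dom onto the closed subspace sc_sub. *)
Record slice_chart (M : tvsType R) (N : set M) := SliceChart {
  sc_model : tvsType R;
  sc_sub : set sc_model;
  sc_dom : set M;
  sc_target : set sc_model;
  sc_map : M -> sc_model;
  sc_inv : sc_model -> M;
  sc_frechet : is_frechet sc_model;
  sc_sub_closed : closed_subspace sc_sub;
  sc_target0 : sc_target 0;
  sc_mapP : forall x, sc_dom x -> sc_target (sc_map x);
  sc_invP : forall y, sc_target y -> sc_dom (sc_inv y);
  sc_mapK : forall x, sc_dom x -> sc_inv (sc_map x) = x;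
  sc_invK : forall y, sc_target y -> sc_map (sc_inv y) = y;
  sc_map_smooth : smooth_map setT sc_dom sc_map;
  sc_inv_smooth : smooth_map setT sc_target sc_inv;
  sc_slice : sc_map @` (sc_dom `&` N) = sc_target `&` sc_sub
}.

Arguments sc_sub {M N} _ _.
Arguments sc_target {M N} _ _.
Arguments sc_map {M N} _ _.
Arguments sc_inv {M N} _ _.

Definition submanifold (M : tvsType R) (N : set M) :=
  forall x, N x -> exists c : slice_chart N, sc_dom c x.

(* f restricts to a diffeomorphism of the open set A onto N, where the manifold
   structure of N is given by the restrictions to N of all slice charts, with
   values in their closed subspaces.  A map into a closed subspace is smooth if
   and only if it is smooth as a map into the ambient space. *)
Definition diffeomorphism_onto (H M : tvsType R) (A : set H) (N : set M)
    (f : H -> M) :=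
  f @` A = N /\
  exists g : M -> H,
    [/\ forall h, A h -> g (f h) = h,
        forall c : slice_chart N,
          smooth_map setT (A `&` f @^-1` sc_dom c) (sc_map c \o f) &
        forall c : slice_chart N,
          smooth_map (sc_sub c) (sc_target c `&` sc_sub c) (g \o sc_inv c)].

End FrechetCalculus.

Section Bergman.
Variables (R : realType) (n : nat) (X : complexManifold R n).
Variable (E : holomorphicBundle X).

Definition E_Ebar : bundle_data R X := tensor_bundle E (conj_bundle E).

Definition bergman_sum d (s : 'I_d -> holomorphic_section E) : section E_Ebar :=
  fun x => \sum_j tens (holomorphic_section_val (s j) x)
    (holomorphic_section_val (s j) x : conjugate (fiber E x)).

(* All orthonormal bases give the same sum, so any one may be chosen. *)
Definition bergman (h : inner_product (holomorphic_section E)) :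
  Cinfty E_Ebar :=
  xget 0 [set k : Cinfty E_Ebar | exists d (s : 'I_d -> holomorphic_section E),
    orthonormal_basis h s /\
    smooth_section_val (k : smooth_section E_Ebar) = bergman_sum s].

End Bergman.

(* Main.v *)
From HB Require Import structures.
Require Import Defs.
From mathcomp Require Import all_boot all_order all_algebra.
From mathcomp Require Import complex ring lra.
From mathcomp Require Import all_classical all_reals all_analysis.

Set Implicit Arguments.
Unset Strict Implicit.
Unset Printing Implicit Defensive.

Import Order.TTheory GRing.Theory Num.Theory.
Import numFieldNormedType.Exports.

Local Open Scope classical_set_scope.
Local Open Scope complex_scope.
Local Open Scope ring_scope.

(** Fix a basis [e_1, ..., e_d] of the space of holomorphic sections, and let
    [G] be the Gram matrix of an inner product [h].  If [s_j = sum_i T_ji e_i]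
    is an orthonormal basis for [h], then [T G T'] is the identity, where [T']
    is the conjugate transpose of [T]; hence [T' T] is the inverse of [G], and
    the Bergman section of [h] is [kernel_of e (invmx G)], the sum of the
    [(invmx G)_li e_i (x) conj e_l] ([bergman_sum_kernel]).  It does not depend
    on the orthonormal basis, and the Bergman map is a composite of three maps:
    [h |-> G], which is linear; inversion, which is smooth on invertible
    matrices and preserves positive definite Hermitian ones
    ([positive_definite_inv]); and the restriction to Hermitian matrices of the
    linear map [kernel_of].

    Everything follows once [kernel_of] is injective and has a continuous
    linear left inverse [P].  The kernels of Hermitian matrices then form a
    closed subspace [S]; those which come from positive definite matrices are
    the points of [S] inside the open set [slice_dom] of the [k] for which the
    Hermitian part of [P k] is positive definite ([bergman_imageE]); so
    translations are slice charts.  On [slice_dom] the map that sends [k] to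
    the form whose Gram matrix is the inverse of the Hermitian part of [P k] is
    smooth, and it inverts the Bergman map.  A left inverse [P] exists as soon
    as [kernel_of] is injective, because finitely many evaluations of sections
    at points already separate a finite dimensional space
    ([linear_left_inverse]).

    Three facts are needed about sections.

    The space of holomorphic sections is finite dimensional
    ([holomorphic_section_finite]).  Its norms over two finite families of
    concentric coordinate balls, both covering [X], are equivalent by
    compactness.  By the Schwarz lemma a section that vanishes at all points of
    a fine enough finite net is much smaller on the inner balls than on the
    outer ones, hence it is zero.

    If [sum_ij A_ij e_i (x) conj e_j] vanishes at every point then
    [A = 0] ([tensor_independence]).  Holomorphic differentiation does not
    see the factors [conj e_j], so at each point [x] all derivatives at [x] of
    the holomorphic section [sum_i (sum_j A_ij conj e_j(x)) e_i] vanish.  As [X]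
    is connected this section is zero, so that [sum_j A_ij conj e_j(x) = 0] for
    all [i] and [x]; conjugate, and use the independence of the [e_j] again.

    The space of smooth sections of a smooth bundle over [X] is a Frechet space
    ([Cinfty_frechet]).  The chain rule bounds every seminorm by finitely many
    seminorms of a countable family, and derivatives converge locally uniformly
    along a Cauchy filter.

    The function theory uses no integration.  The maximum principle holds
    because [|F|^2 + eps |z|^2] is strictly subharmonic ([no_interior_max]); it
    gives a Schwarz lemma in one variable ([schwarz_power]), and restriction to
    complex lines gives the Schwarz lemma and the identity theorem in several
    variables. *)

(** * Calculus in locally convex spaces *)

Section MeanValue.
Variable R : realType.

Definition convex_subset (V : lmodType R) (C : set V) :=
  forall u v (a : R), 0 <= a -> a <= 1 -> C u -> C v -> C (a *: u + (1 - a) *: v).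

Lemma convex_nbhs (V : tvsType R) (x : V) (A : set V) : nbhs x A ->
  exists C : set V, [/\ nbhs x C, C `<=` A & convex_subset C].
Proof.
move=> xA; have [B Bconv [Bo Bb]] := @locally_convex R V.
have [C [BC Cx] CA] := Bb x A xA.
exists C; split=> //; first by apply: open_nbhs_nbhs; split => //; exact: Bo.
have /convex_setW Cc : convex_set C by apply: Bconv; exact/mem_set.
move=> u v a a0 a1 Cu Cv.
have [->|an0] := eqVneq a 0; first by rewrite scale0r subr0 scale1r add0r.
have [->|an1] := eqVneq a 1; first by rewrite subrr scale0r addr0 scale1r.
have a0' : 0 <= a <= 1 by rewrite a0.
have ap : 0 < a by rewrite lt_def an0.
have al1 : a < 1 by rewrite lt_def eq_sym an1.
pose l : {i01 R} := Itv01 a0 a1.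
by have /set_mem := Cc u v (mem_set Cu) (mem_set Cv) l ap al1.
Qed.

(** In a locally convex space, convex neighborhoods take the place of norms: the
    difference quotient over an interval is a convex combination of those over
    two adjacent subintervals, so quotients in [C] propagate from the short
    intervals on which [df] controls them to the whole of [0, 1]. *)
Lemma mean_value_convex (V : tvsType R) (f : R -> V) (df : R -> V) (C : set V) :
  convex_subset C ->
  (forall s : R, 0 <= s -> s <= 1 ->
     (fun t : R => t^-1 *: (f (s + t) - f s)) @ 0^' --> df s) ->
  (forall s : R, 0 <= s -> s <= 1 -> nbhs (df s) C) ->
  C (f 1 - f 0).
Proof.
move=> Cc dfE dfC.
pose Q a b := C ((b - a)^-1 *: (f b - f a)).
have Qcat a b c : a < b -> b < c -> Q a b -> Q b c -> Q a c.
  move=> ab bc Qab Qbc; rewrite /Q.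
  have ac : 0 < c - a by rewrite subr_gt0 (lt_trans ab).
  have ba0 : b - a != 0 by rewrite subr_eq0 gt_eqF.
  have cb0 : c - b != 0 by rewrite subr_eq0 gt_eqF.
  have -> : (c - a)^-1 *: (f c - f a) =
    ((b - a) / (c - a)) *: ((b - a)^-1 *: (f b - f a)) +
    (1 - (b - a) / (c - a)) *: ((c - b)^-1 *: (f c - f b)).
    rewrite !scalerA mulrAC mulfV// mul1r.
    have -> : (1 - (b - a) / (c - a)) / (c - b) = (c - a)^-1.
      by field; rewrite cb0 lt0r_neq0.
    by rewrite -scalerDr; congr (_ *: _); rewrite [RHS]addrC subrKA.
  apply: Cc => //; first by apply: divr_ge0; lra.
  by rewrite ler_pdivrMr// mul1r; lra.
have Qloc s : 0 <= s -> s <= 1 -> exists2 d, 0 < d &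
    forall a b, s - d < a -> a <= s -> s <= b -> b < s + d -> a < b -> Q a b.
  move=> s0 s1; have := dfE s s0 s1 _ (dfC s s0 s1).
  rewrite /= => -[/= d d0 dC]; exists d => // a b sda as_ sb bsd ab.
  have QL : a < s -> Q a s.
    move=> als; have := dC (a - s).
    rewrite /= sub0r normrN ler0_norm ?subr_le0// opprB ltrBlDr addrC -ltrBlDr sda.
    move=> /(_ erefl); rewrite subr_eq0 lt_eqF// => /(_ erefl).
    by rewrite /= subrKC /Q -(opprB s a) invrN scaleNr -scalerN opprB.
  have QR : s < b -> Q s b.
    move=> slb; have := dC (b - s).
    rewrite /= sub0r normrN ger0_norm ?subr_ge0// ltrBlDl bsd.
    move=> /(_ erefl); rewrite subr_eq0 gt_eqF// => /(_ erefl).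
    by rewrite /= subrKC.
  move: as_; rewrite le_eqVlt => /predU1P[ase|als].
    by rewrite ase; apply: QR; rewrite -ase.
  move: sb; rewrite le_eqVlt => /predU1P[sbe|slb].
    by rewrite -sbe; apply: QL.
  exact: Qcat (QL als) (QR slb).
suff : Q 0 1 by rewrite /Q subr0 invr1 scale1r.
(* The supremum of the s with Q 0 s is attained, and is 1: otherwise Qloc would
   move past it. *)
pose P := [set s | 0 < s /\ s <= 1 /\ Q 0 s].
have [d0 d0p Qd0] := Qloc 0 (lexx _) ler01.
have P0 : P (Num.min (d0 / 2) 1).
  have m0 : 0 < Num.min (d0 / 2) 1 by rewrite lt_min divr_gt0//=.
  split=> //; split; first by rewrite ge_min lexx orbT.
  apply: Qd0 => //; rewrite ?sub0r ?oppr_lt0 ?add0r// ?ltW//.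
  by rewrite gt_min; apply/orP; left; lra.
have Pub : has_ubound P by exists 1 => s [_ []].
have Psup : has_sup P by split => //; exists (Num.min (d0 / 2) 1).
set s := sup P.
have s1 : s <= 1 by apply: ge_sup; [exists (Num.min (d0 / 2) 1)|move=> u [_ []]].
have s0 : 0 < s by apply: lt_le_trans (ub_le_sup Pub P0); exact: P0.1.
have [d dp Qd] := Qloc s (ltW s0) s1.
have [a Pa sa] := sup_adherent dp Psup.
have als : a <= s by exact: ub_le_sup.
case: Pa => a0 [a1 Q0a].
have Q0 b : s <= b -> b < s + d -> Q 0 b.
  move=> sb bd; have := le_trans als sb; rewrite le_eqVlt => /predU1P[<-//|ab].
  exact: Qcat a0 ab Q0a (Qd _ _ sa als sb bd ab).
move: s1; rewrite le_eqVlt => /predU1P[s1|s1].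
  by apply: Q0; rewrite ?s1// -s1 ltrDl.
have [d1|d1] := ltP 1 (s + d); first by apply: Q0 => //; exact: ltW.
have hd : s < s + d / 2 by lra.
have : P (s + d / 2).
  split; first exact: lt_trans hd; split.
    by apply: le_trans d1; lra.
  apply: Q0; first exact: ltW.
  by lra.
by move=> /(ub_le_sup Pub); rewrite leNgt hd.
Qed.

End MeanValue.

Section TvsLimits.
Variable R : realType.

Lemma within_continuousP (T U : topologicalType) (A : set T) (f : T -> U) :
  {within A, continuous f} <->
  forall x, A x -> forall B, nbhs (f x) B -> nbhs x (fun y => A y -> B (f y)).
Proof.
split=> [/subspace_continuousP cf x Ax B fB|cf]; first exact: cf x Ax B fB.
by apply/subspace_continuousP => x Ax B fB; exact: cf.
Qed.

Lemma tvs_cvgD (V : tvsType R) T (F : set_system T) {FF : Filter F}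
  (f g : T -> V) a b : f @ F --> a -> g @ F --> b -> (fun x => f x + g x) @ F --> a + b.
Proof.
move=> fa gb.
apply: (@cvg_comp _ _ _ (fun x => (f x, g x)) (fun z : V * V => z.1 + z.2)).
  exact: cvg_pair fa gb.
exact: (@add_continuous V (a, b)).
Qed.

Lemma tvs_cvgZ (V : tvsType R) T (F : set_system T) {FF : Filter F}
  (r : T -> R) (f : T -> V) (c : R) a : r @ F --> c -> f @ F --> a ->
  (fun x => r x *: f x) @ F --> c *: a.
Proof.
move=> rc fa.
apply: (@cvg_comp _ _ _ (fun x => (r x, f x)) (fun z : R^o * V => z.1 *: z.2)).
  exact: (cvg_pair (rc : (r : T -> R^o) @ F --> (c : R^o)) fa).
exact: (@scale_continuous R V (c, a)).
Qed.

Lemma tvs_cvg_line (V : tvsType R) (x v : V) :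
  (fun t : R => x + t *: v) @ nbhs (0 : R) --> x.
Proof.
rewrite -[in X in _ --> X](addr0 x) -(scale0r v).
by apply: tvs_cvgD; [exact: cvg_cst|apply: tvs_cvgZ; [exact: cvg_id|exact: cvg_cst]].
Qed.

Lemma dnbhs_scale (t : R) : t != 0 -> (fun u : R => t * u) @ 0^' --> 0^'.
Proof.
move=> t0 A [/= d d0 dA]; exists (d / `|t|) => /=; first by rewrite divr_gt0 ?normr_gt0.
move=> u; rewrite /= sub0r normrN => ud u0; apply: dA; last by rewrite mulf_neq0.
by rewrite /= sub0r normrN normrM mulrC -ltr_pdivlMr ?normr_gt0.
Qed.

(** The space need not be separated, so the limit [a] of the constant [0] may
    differ from [0], but the two points have the same neighborhoods. This is
    what the differential in the direction [0] looks like. *)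
Lemma tvs_const_cvg (V : tvsType R) T (F : set_system T) {FF : ProperFilter F} (a : V) N :
  (fun=> 0 : V) @ F --> a -> nbhs (0 : V) N -> nbhs a N.
Proof.
move=> h0 N0.
have int0 : nbhs (0 : V) (fun u => nbhs u N) by apply: nbhs_interior.
suff : (fun u => nbhs u N) a by [].
have c : (fun u : V => a + (-1 : R) *: u) @ nbhs a --> (0 : V).
  rewrite -[in X in _ --> X](subrr a) -[X in a - X]scale1r -scaleNr.
  by apply: tvs_cvgD; [exact: cvg_cst|apply: tvs_cvgZ; [exact: cvg_cst|exact: cvg_id]].
have /filter_ex[_] : \forall x \near F, nbhs (a + (-1 : R) *: (0 : V)) N := h0 _ (c _ int0).
by rewrite scaler0 addr0.
Qed.

End TvsLimits.

Section CkCalculus.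
Variable R : realType.
Implicit Types F G K : tvsType R.

Definition subspace_like F (S : set F) :=
  S 0 /\ forall (a : R) u v, S u -> S v -> S (a *: u + v).

Lemma subspace_likeT F : subspace_like [set: F].
Proof. by []. Qed.

Lemma subspace_likeX F (S : set F) : subspace_like S -> subspace_like (S `*` S).
Proof. by move=> [S0 Sl]; split=> // a [u1 u2] [v1 v2] [/= ? ?] [/= ? ?]; split; exact: Sl. Qed.

Definition rel_open F (S A : set F) := exists2 O, open O & A = O `&` S.

Lemma rel_openT F (A : set F) : open A -> rel_open setT A.
Proof. by move=> oA; exists A => //; rewrite setIT. Qed.

Lemma openXT F G (W : set F) : open W -> open (W `*` [set: G]).
Proof.
move=> oW; rewrite (_ : _ `*` _ = fst @^-1` W); first by apply: open_comp => // z _; exact: cvg_fst.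
by apply/seteqP; split=> z //= [].
Qed.

Lemma rel_openX F (S A : set F) : rel_open S A -> rel_open (S `*` S) (A `*` S).
Proof.
move=> [W oW ->]; exists (W `*` setT).
  exact: openXT.
by apply/seteqP; split=> -[u v]; rewrite /setI/=; tauto.
Qed.

Lemma rel_open_sub F (S A : set F) : rel_open S A -> A `<=` S.
Proof. by move=> [W _ ->] x []. Qed.

Lemma rel_open_near F (S A : set F) x : rel_open S A -> A x ->
  nbhs x (fun y => S y -> A y).
Proof.
move=> [W oW ->] [Wx _]; apply: filterS (open_nbhs_nbhs (conj oW Wx)) => y Wy Sy.
by split.
Qed.

Lemma rel_open_line F (S A : set F) x v : subspace_like S -> rel_open S A ->
  A x -> S v -> \forall t \near (0 : R), A (x + t *: v).
Proof.
move=> [S0 Sl] oA Ax Sv.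
have h0 : \forall t \near (0 : R), S (x + t *: v) -> A (x + t *: v).
  exact: (@tvs_cvg_line _ _ x v _ (rel_open_near oA Ax)).
apply: filterS h0 => t h.
by apply: h; rewrite addrC; apply: Sl => //; exact: rel_open_sub Ax.
Qed.

Lemma Ck_sub k : forall F G (S S' A A' : set F) (f : F -> G),
  S' `<=` S -> A' `<=` A -> Ck k S A f -> Ck k S' A' f.
Proof.
elim: k => [|k IH] F G S S' A A' f SS AA /=; first exact: continuous_subspaceW.
move=> [df [fd kd]]; exists df; split.
  by move=> x v /AA Ax /SS Sv; exact: fd.
by apply: IH kd; apply: setSX.
Qed.

(** The equality has to hold on [A] only, because [A] is open in [S]: the lines
    along which differentials are taken stay in [A] for small times. *)
Lemma Ck_eq k F G (S A : set F) (f g : F -> G) : subspace_like S -> rel_open S A ->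
  (forall x, A x -> f x = g x) -> Ck k S A f -> Ck k S A g.
Proof.
move=> Sl oA fg; case: k => [|k] /=.
  by apply: subspace_eq_continuous => x /set_mem; exact: fg.
move=> [df [fd kd]]; exists df; split=> // x v Ax Sv.
apply: cvg_trans (fd x v Ax Sv); apply: near_eq_cvg.
apply: nbhs_dnbhs; have := rel_open_line Sl oA Ax Sv.
by apply: filterS => t h; rewrite !fg.
Qed.

Lemma Ck_cst k : forall F G (S A : set F) (c : G), Ck k S A (cst c).
Proof.
elim: k => [|k IH] F G S A c /=.
  by apply: continuous_subspaceT => x; exact: cvg_cst.
exists (cst 0); split; last exact: IH.
move=> x v _ _; rewrite (_ : (fun t : R => _) = fun=> 0); first exact: cvg_cst.
by apply/funext => t; rewrite subrr scaler0.
Qed.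

Lemma Ck_precomp k : forall F F' G (S A : set F) (S' A' : set F') (L : F' -> F) (f : F -> G),
  continuous L -> (forall (a : R) u v, L (u + a *: v) = L u + a *: L v) ->
  S' `<=` L @^-1` S -> A' `<=` L @^-1` A -> Ck k S A f -> Ck k S' A' (f \o L).
Proof.
elim: k => [|k IH] F F' G S A S' A' L f cL lL SS AA /=.
  move=> /within_continuousP cf; apply/within_continuousP => x A'x B fB.
  have h0 : nbhs x (fun y => A (L y) -> B (f (L y))) := cL x _ (cf _ (AA _ A'x) B fB).
  by apply: filterS h0 => y h /AA; exact: h.
move=> [df [fd kd]]; exists (df \o (fun z => (L z.1, L z.2))); split.
  move=> x v /AA Ax /SS Sv.
  by have := fd _ _ Ax Sv; rewrite /comp; under [in X in X -> _]eq_fun do rewrite -lL.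
apply: (IH _ _ _ (S `*` S) (A `*` S)) => //.
- move=> [x y]; apply: cvg_pair => /=.
    by apply: (@cvg_comp _ _ _ fst L _ (nbhs x)); [exact: cvg_fst|exact: cL].
  by apply: (@cvg_comp _ _ _ snd L _ (nbhs y)); [exact: cvg_snd|exact: cL].
- by move=> a [u1 u2] [v1 v2] /=; rewrite !lL.
- by move=> [x y] [/= /SS ? /SS ?].
- by move=> [x y] [/= /AA ? /SS ?].
Qed.

Lemma Ck_postcomp k : forall F G K (S A : set F) (T : G -> K) (f : F -> G),
  continuous T -> (forall (a : R) u v, T (a *: u + v) = a *: T u + T v) ->
  Ck k S A f -> Ck k S A (T \o f).
Proof.
elim: k => [|k IH] F G K S A T f cT lT /=.
  move=> /within_continuousP cf; apply/within_continuousP => x Ax B TB.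
  exact: cf x Ax _ (cT _ _ TB).
move=> [df [fd kd]]; exists (T \o df); split; last exact: IH.
move=> x v Ax Sv.
have T0 : T 0 = 0 by have := lT (-1) 0 0; rewrite scaler0 addr0 scaleN1r addNr.
have TZ a u : T (a *: u) = a *: T u by rewrite -[a *: u]addr0 lT T0 addr0.
have TB u w : T (u - w) = T u - T w.
  by rewrite addrC -scaleN1r lT scaleN1r addrC.
rewrite (_ : (fun t : R => _) = T \o (fun t : R => t^-1 *: (f (x + t *: v) - f x))).
  exact: (@cvg_comp _ _ _ _ T _ _ _ (fd x v Ax Sv) (cT _)).
by apply/funext => t /=; rewrite TZ TB.
Qed.

Lemma Ck_pair k : forall F G K (S A : set F) (f : F -> G) (g : F -> K),
  Ck k S A f -> Ck k S A g -> Ck k S A (fun x => (f x, g x)).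
Proof.
elim: k => [|k IH] F G K S A f g /=.
  move=> /within_continuousP cf /within_continuousP cg; apply/within_continuousP => x Ax B [[B1 B2] [/= fB gB] sB].
  by apply: filterS2 (cf x Ax _ fB) (cg x Ax _ gB) => y h1 h2 Ay; apply: sB; split=> /=; auto.
move=> [df [fd kd]] [dg [gd kg]]; exists (fun z => (df z, dg z)); split; last exact: IH.
by move=> x v Ax Sv; exact: cvg_pair (fd x v Ax Sv) (gd x v Ax Sv).
Qed.

(** On the segment from [x] to [y] the function has derivative [df (z, y - x)],
    which is close to [df (x, 0)], hence to [0], when [y] is close to [x]; the
    mean value theorem bounds [f y - f x]. *)
Lemma C1_continuous F G (S A : set F) (f : F -> G) : subspace_like S -> rel_open S A ->
  Ck 1 S A f -> {within A, continuous f}.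
Proof.
move=> Sl oA [df [fd /within_continuousP cd]]; apply/within_continuousP => x Ax B fB.
have S0 := Sl.1.
have B0 : nbhs (0 : G) [set u | B (f x + u)].
  have : (fun u : G => f x + u) @ nbhs 0 --> f x.
    by rewrite -[X in _ --> X]addr0; apply: tvs_cvgD; [exact: cvg_cst|exact: cvg_id].
  exact.
have [C [C0 CB Cc]] := convex_nbhs B0.
have dC : nbhs (df (x, 0)) (fun u => nbhs u C).
  apply: (@tvs_const_cvg _ _ R (0^') _); last exact: nbhs_interior.
  have := fd x 0 Ax S0; rewrite (_ : (fun t : R => _) = fun=> 0)//.
  by apply/funext => t; rewrite scaler0 addr0 subrr scaler0.
have [[N1 N2] [/= xN1 N20] sN] := cd (x, 0) (conj Ax S0) _ dC.
have oAx := rel_open_near oA Ax.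
have [C1 [xC1 C1s C1c]] := convex_nbhs (filterI xN1 oAx).
have yx : (fun y : F => y + (-1 : R) *: x) @ nbhs x --> (0 : F).
  rewrite -[in X in _ --> X](subrr x) -(scaleN1r x).
  by apply: tvs_cvgD; [exact: cvg_id|exact: cvg_cst].
have xC : C1 x := nbhs_singleton xC1.
apply: filterS2 xC1 (yx _ N20) => y yC1 /= yN2 Ay.
have Sx := rel_open_sub oA Ax; have Sy := rel_open_sub oA Ay.
rewrite scaleN1r in yN2.
have Syx : S (y - x) by rewrite addrC -scaleN1r; apply: Sl.2.
have seg (s : R) : 0 <= s -> s <= 1 -> C1 (x + s *: (y - x)).
  move=> s0 s1; have := C1c y x s s0 s1 yC1 xC.
  by rewrite scalerBr scalerBl scale1r addrCA.
have segA (s : R) : 0 <= s -> s <= 1 -> A (x + s *: (y - x)).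
  by move=> s0 s1; apply: (C1s _ (seg s s0 s1)).2; rewrite addrC; apply: Sl.2.
pose gam (s : R) := f (x + s *: (y - x)).
have : C (gam 1 - gam 0).
  apply: (@mean_value_convex _ _ gam (fun s => df (x + s *: (y - x), y - x))) => //.
    move=> s s0 s1; have := fd _ _ (segA s s0 s1) Syx.
    by apply: cvg_trans; apply: near_eq_cvg; apply: nearW => u; rewrite /gam scalerDl addrA.
  move=> s s0 s1; apply: sN; last by split => //; exact: segA.
  by split=> //; apply: (C1s _ (seg s s0 s1)).1.
rewrite /gam scale1r scale0r addr0 subrKC => /CB /=.
by rewrite subrKC.
Qed.

Lemma CkS k : forall F G (S A : set F) (f : F -> G), subspace_like S -> rel_open S A ->
  Ck k.+1 S A f -> Ck k S A f.
Proof.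
elim: k => [|k IH] F G S A f Sl oA; first exact: C1_continuous.
move=> [df [fd kd]]; exists df; split=> //.
by apply: IH kd; [exact: subspace_likeX|exact: rel_openX].
Qed.

(** The differential of [g \o f] is the composite of [dg] with [(x, v) |-> (f x,
    df (x, v))], to which induction applies. For the first derivative, write [f
    (x + t v)] as [f x + t q] with [q] close to [df (x, v)], and apply the mean
    value theorem to [g] on the segment from [f x] to [f x + t q]. *)
Lemma Ck_comp k : forall F G K (S A : set F) (B : set G) (f : F -> G) (g : G -> K),
  subspace_like S -> rel_open S A -> open B -> A `<=` f @^-1` B ->
  Ck k S A f -> Ck k setT B g -> Ck k S A (g \o f).
Proof.
elim: k => [|k IH] F G K S A B f g Sl oA oB AB.
  move=> /within_continuousP cf /within_continuousP cg; apply/within_continuousP => x Ax N gN.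
  have := cf x Ax _ (cg _ (AB _ Ax) N gN).
  by apply: filterS => y h Ay; apply: h => //; exact: AB.
move=> Cf; have Cfk := CkS Sl oA Cf; case: Cf => [df [fd kd]] [dg [gd kg]].
exists (dg \o (fun z => (f z.1, df z))); split.
  move=> x v Ax Sv N /= gN.
  have [C [C0 CN Cc]] := convex_nbhs gN.
  have : nbhs (dg (f x, df (x, v))) (fun u => nbhs u C) by apply: nbhs_interior.
  have kg0 : {within B `*` setT, continuous dg}.
    have : Ck 0 (setT `*` setT) (B `*` setT) dg.
      elim: k kg {IH Cfk kd} => [//|k IHk] kg; apply: IHk; apply: CkS kg.
        exact: subspace_likeX.
      exact/rel_openX/rel_openT.
    by [].
  move=> /((within_continuousP _ _).1 kg0 (f x, df (x, v)) (conj (AB _ Ax) I)).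
  move=> [[N1 N2] [/= yN1 wN2] sN].
  have : (fun z : R^o * G => f x + z.1 *: z.2) @ nbhs (0, df (x, v)) --> f x.
    rewrite -[in X in _ --> X](addr0 (f x)) -(scale0r (df (x, v))).
    apply: tvs_cvgD; first exact: cvg_cst.
    exact: (@scale_continuous R G (0, df (x, v))).
  move=> /(_ _ (filterI yN1 (open_nbhs_nbhs (conj oB (AB _ Ax))))).
  move=> [[D N3] [/= [d d0 dD] wN3] sD].
  have qN : \forall t \near (0 : R)^', (N2 `&` N3) (t^-1 *: (f (x + t *: v) - f x)).
    exact: fd x v Ax Sv _ (filterI wN2 wN3).
  have td : \forall t \near (0 : R)^', `|t| < d.
    by apply: nbhs_dnbhs; exists d => // t /=; rewrite sub0r normrN.
  have t0 : \forall t \near (0 : R)^', t != 0 by exact: nbhs_dnbhs_neq.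
  suff : \forall t \near (0 : R)^', N (t^-1 *: (g (f (x + t *: v)) - g (f x))) by [].
  near=> t; apply: CN.
  have tn0 : t != 0 by near: t.
  have ltd : `|t| < d by near: t.
  have : (N2 `&` N3) (t^-1 *: (f (x + t *: v) - f x)) by near: t.
  set q := t^-1 *: (f (x + t *: v) - f x) => -[q2 q3].
  have fq : f (x + t *: v) = f x + t *: q by rewrite scalerA divff// scale1r subrKC.
  have seg (s : R) : 0 <= s -> s <= 1 -> (N1 `&` B) (f x + (s * t) *: q).
    move=> s0 s1; apply: (sD (s * t, q)); split=> //=; apply: dD => /=.
    rewrite sub0r normrN normrM ger0_norm//; apply: le_lt_trans ltd.
    by rewrite ler_piMl.
  pose gam (s : R) := t^-1 *: g (f x + (s * t) *: q).
  have : C (gam 1 - gam 0).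
    apply: (@mean_value_convex _ _ gam (fun s => dg (f x + (s * t) *: q, q))) => //.
      move=> s s0 s1; have [_ Bs] := seg s s0 s1.
      have := @cvg_comp _ _ _ (fun u : R => t * u) _ _ _ _ (@dnbhs_scale _ t tn0) (gd _ q Bs I).
      apply: cvg_trans; apply: near_eq_cvg; apply: nearW => u; rewrite /gam /=.
      rewrite -addrA -scalerDl mulrDl (mulrC u t) invfM -scalerBr.
      by rewrite [RHS]scalerA (mulrC u^-1).
    move=> s s0 s1; have [N1s Bs] := seg s s0 s1; exact: (sN (_, _)).
  by rewrite /gam mul1r mul0r scale0r addr0 -fq scalerBr.
have oAS := rel_openX oA; have SlS := subspace_likeX Sl.
apply: (IH _ _ _ (S `*` S) (A `*` S) (B `*` setT)) => //.
- exact: openXT.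
- by move=> [x v] [/= Ax _]; split => //; exact: AB.
- apply: Ck_pair => //.
  apply: (Ck_precomp (L := fst)) Cfk => //; last 2 first.
  + by move=> [x v] [].
  + by move=> [x v] [].
  by move=> z; exact: cvg_fst.
- by apply: Ck_sub kg => //.
Unshelve. all: by end_near. Qed.

End CkCalculus.

Section CkAlgebra.
Variable R : realType.
Implicit Types F G K : tvsType R.
Local Notation Z := (realify R R[i]).

Lemma Ck_add k F G (S A : set F) (f g : F -> G) :
  Ck k S A f -> Ck k S A g -> Ck k S A (fun x => f x + g x).
Proof.
move=> Cf Cg; apply: (Ck_postcomp (T := fun z : G * G => z.1 + z.2)) (Ck_pair Cf Cg).
  exact: add_continuous.
by move=> a [u1 u2] [v1 v2] /=; rewrite scalerDr addrACA.
Qed.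

Lemma Ck_opp k F G (S A : set F) (f : F -> G) :
  Ck k S A f -> Ck k S A (fun x => - f x).
Proof.
apply: (Ck_postcomp (T := fun z : G => - z)); first exact: opp_continuous.
by move=> a u v; rewrite opprD scalerN.
Qed.

Lemma Ck_sum k F G (S A : set F) (I : Type) (r : seq I) (f : I -> F -> G) :
  (forall i, Ck k S A (f i)) -> Ck k S A (fun x => \sum_(i <- r) f i x).
Proof.
move=> Cf; elim: r => [|i r IH].
  by under eq_fun do rewrite big_nil; exact: Ck_cst.
by under eq_fun do rewrite big_cons; exact: Ck_add.
Qed.

Lemma Ck_linear k : forall F G (T : F -> G), continuous T ->
  (forall (a : R) u v, T (a *: u + v) = a *: T u + T v) -> Ck k setT setT T.
Proof.
elim: k => [|k IH] F G T cT lT /=; first exact: continuous_subspaceT.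
exists (T \o snd); split.
  move=> x v _ _.
  apply: (@cvg_trans _ ((fun=> T v) @ (0 : R)^')); last exact: cvg_cst.
  apply: near_eq_cvg; near=> t.
  have t0 : t != 0 by near: t; exact: nbhs_dnbhs_neq.
  by rewrite (addrC x) lT addrK scalerA mulVf// scale1r.
apply: (@Ck_sub _ _ _ _ setT _ setT) => //; apply: IH; last by move=> a [u1 u2] [v1 v2] /=.
by move=> z; apply: (@cvg_comp _ _ _ snd T _ (nbhs z.2)); [exact: cvg_snd|exact: cT].
Unshelve. all: by end_near. Qed.

(** The differential [b (x, w) + b (v, y)] at [(x, y)] in the direction [(v, w)]
    is a sum of two copies of [b] precomposed with linear maps, so the
    regularity of [b] improves by itself. *)
Lemma Ck_bilinear k F G K (b : F * G -> K) : continuous b ->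
  (forall (a : R) u v w, b (a *: u + v, w) = a *: b (u, w) + b (v, w)) ->
  (forall (a : R) u v w, b (w, a *: u + v) = a *: b (w, u) + b (w, v)) ->
  Ck k setT setT b.
Proof.
move=> cb bl br; elim: k => [|k IH] /=; first exact: continuous_subspaceT.
exists (fun z => b (z.1.1, z.2.2) + b (z.2.1, z.1.2)); split.
  move=> [x y] [v w] _ _ /=.
  apply: (@cvg_trans _ ((fun t : R => (b (x, w) + b (v, y)) + t *: b (v, w)) @ (0 : R)^')).
    apply: near_eq_cvg; near=> t.
    have t0 : t != 0 by near: t; exact: nbhs_dnbhs_neq.
    rewrite -[(x, y) + _]/(x + t *: v, y + t *: w) (addrC x) bl (addrC y) !br.
    rewrite (addrA _ (t *: b (x, w))) addrK -scalerDr scalerA mulVf// scale1r.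
    by rewrite [RHS]addrC [t *: _ + _]addrC addrA.
  have : (fun t : R => (b (x, w) + b (v, y)) + t *: b (v, w)) @ (0 : R)^' -->
      (b (x, w) + b (v, y)) + 0 *: b (v, w).
    apply: tvs_cvgD; first exact: cvg_cst.
    by apply: tvs_cvgZ; [exact: nbhs_dnbhs|exact: cvg_cst].
  by rewrite scale0r addr0.
apply: (@Ck_sub _ _ _ _ setT _ setT) => //; apply: Ck_add.
  apply: (Ck_precomp (L := fun z : (F * G) * (F * G) => (z.1.1, z.2.2))) IH => //.
  move=> z; apply: cvg_pair => /=.
    by apply: (@cvg_comp _ _ _ fst fst _ (nbhs z.1)); exact: cvg_fst.
  by apply: (@cvg_comp _ _ _ snd snd _ (nbhs z.2)); exact: cvg_snd.
apply: (Ck_precomp (L := fun z : (F * G) * (F * G) => (z.2.1, z.1.2))) IH => //.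
move=> z; apply: cvg_pair => /=.
  by apply: (@cvg_comp _ _ _ snd fst _ (nbhs z.2)); [exact: cvg_snd|exact: cvg_fst].
by apply: (@cvg_comp _ _ _ fst snd _ (nbhs z.1)); [exact: cvg_fst|exact: cvg_snd].
Unshelve. all: by end_near. Qed.

Lemma realify_normM (a b : R[i]) : `|(a * b : Z)| = `|(a : Z)| * `|(b : Z)|.
Proof.
apply: complexI; rewrite rmorphM/=.
rewrite -[`|(a * b : Z)|]/(realify_norm (a * b : Z)).
rewrite -[`|(a : Z)|]/(realify_norm (a : Z)) -[`|(b : Z)|]/(realify_norm (b : Z)).
by rewrite !realify_normE normrM.
Qed.

Lemma realify_norm1 : `|(1 : Z)| = 1.
Proof.
have := realify_normM 1 1; rewrite mulr1 => /esym/eqP.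
rewrite -[X in _ == X]mulr1 -subr_eq0 -mulrBr mulf_eq0 subr_eq0.
move=> /orP[|/eqP//]; rewrite normr_eq0 => /eqP h.
by have := @oner_neq0 R[i]; rewrite -[X in X != _]/(1 : Z) h => /eqP.
Qed.

Lemma realify_normV (a : R[i]) : `|(a^-1 : Z)| = `|(a : Z)|^-1.
Proof.
have [->|a0] := eqVneq a 0.
  by rewrite invr0 -[X in `|X|]/(0 : Z) normr0 invr0.
have n0 : `|(a : Z)| != 0 by rewrite normr_eq0.
by apply: (mulfI n0); rewrite -realify_normM !divff// realify_norm1.
Qed.

Lemma realify_mul_continuous :
  continuous ((fun z : Z * Z => (z.1 : R[i]) * z.2) : Z * Z -> Z).
Proof.
move=> [a b]; rewrite /continuous_at /=.
have fa : (fun z : Z * Z => z.1) @ nbhs (a, b) --> a by exact: cvg_fst.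
have gb : (fun z : Z * Z => z.2) @ nbhs (a, b) --> b by exact: cvg_snd.
apply: (@cvg_sub0 _ _ _ _ _ _ (fun=> ((a : R[i]) * b : Z))); last exact: cvg_cst.
apply: norm_cvg0.
have fa0 : (fun z : Z * Z => `|z.1 - a|) @ nbhs (a, b) --> (0 : R).
  by apply/norm_cvg0P; rewrite -(subrr a); apply: cvgB => //; exact: cvg_cst.
have gb0 : (fun z : Z * Z => `|z.2 - b|) @ nbhs (a, b) --> (0 : R).
  by apply/norm_cvg0P; rewrite -(subrr b); apply: cvgB => //; exact: cvg_cst.
have H : (fun z : Z * Z => `|z.1 - a| * `|z.2| + `|a| * `|z.2 - b|) @ nbhs (a, b) --> (0 : R).
  have -> : (0 : R) = 0 * `|b| + `|a| * 0 by rewrite mul0r mulr0 addr0.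
  apply: cvgD; first by apply: cvgM => //; exact: cvg_norm.
  by apply: cvgM => //; exact: cvg_cst.
apply: squeeze_cvgr H; last exact: cvg_cst.
apply: nearW => -[x y] /=; rewrite normr_ge0 /=.
rewrite -!realify_normM.
apply: le_trans (ler_normD _ _); rewrite le_eqVlt; apply/orP; left; apply/eqP.
congr (`|_|); rewrite -[LHS]/((x : R[i]) * y - (a : R[i]) * b : R[i]).
rewrite -[RHS]/(((x : R[i]) - a) * y + (a : R[i]) * ((y : R[i]) - b) : R[i]).
by rewrite mulrBl mulrBr addrA subrK.
Qed.

Lemma realify_cvgM T (F : set_system T) {FF : Filter F} (f g : T -> Z) (a b : Z) :
  f @ F --> a -> g @ F --> b ->
  ((fun x => (f x : R[i]) * g x) : T -> Z) @ F --> ((a : R[i]) * b : Z).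
Proof.
move=> fa gb.
apply: (@cvg_comp _ _ _ (fun x => (f x, g x)) ((fun z : Z * Z => (z.1 : R[i]) * z.2) : Z * Z -> Z) _ (nbhs (a, b))).
  exact: cvg_pair fa gb.
exact: (@realify_mul_continuous (a, b)).
Qed.

Lemma open_neq0 : open [set z : Z | z != 0].
Proof.
rewrite openE => z /= z0; have nz0 : 0 < `|z| by rewrite normr_gt0.
apply: (@filterS _ (nbhs z) _ _ _ _ (nbhsx_ballx z _ nz0)) => w.
rewrite -ball_normE /= => h; apply/eqP => w0.
by move: h; rewrite w0 subr0 ltxx.
Qed.

Lemma realify_inv_continuous (z : Z) : z != 0 ->
  (fun w : Z => ((w : R[i])^-1 : Z)) @ nbhs z --> ((z : R[i])^-1 : Z).
Proof.
move=> z0; have nz0 : 0 < `|z| by rewrite normr_gt0.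
apply: (@cvg_sub0 _ _ _ _ _ _ (fun=> ((z : R[i])^-1 : Z))); last exact: cvg_cst.
apply: norm_cvg0.
have H : (fun w : Z => `|z - w| * (`|w|^-1 * `|z|^-1)) @ nbhs z --> (0 : R).
  have -> : (0 : R) = 0 * (`|z|^-1 * `|z|^-1) by rewrite mul0r.
  apply: cvgM.
    by apply/norm_cvg0P; rewrite -(subrr z); apply: cvgB; [exact: cvg_cst|exact: cvg_id].
  apply: cvgM; last exact: cvg_cst.
  by apply: cvgV; [exact: lt0r_neq0|apply: cvg_norm; exact: cvg_id].
apply: squeeze_cvgr H; last exact: cvg_cst.
have wn0 : \forall w \near z, w != 0 :> Z by exact: open_nbhs_nbhs (conj open_neq0 z0).
near=> w; have w0 : w != 0 by near: w.
rewrite normr_ge0 /= -!realify_normV -!realify_normM le_eqVlt; apply/orP; left; apply/eqP.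
congr (`|_|); rewrite -[LHS]/((w : R[i])^-1 - (z : R[i])^-1 : R[i]).
rewrite -[X in X * _]/((z : R[i]) - w : R[i]) mulrBl.
have [w1 z1] : (w : R[i]) != 0 /\ (z : R[i]) != 0 by [].
by field; rewrite ?w1 ?z1.
Unshelve. all: by end_near. Qed.

Lemma Ck_mul_bilin k : Ck k setT setT ((fun z : Z * Z => (z.1 : R[i]) * z.2) : Z * Z -> Z).
Proof.
apply: Ck_bilinear; first exact: realify_mul_continuous.
  move=> a u v w /=.
  rewrite -[LHS]/((a%:C * (u : R[i]) + (v : R[i])) * (w : R[i]) : R[i]).
  by rewrite mulrDl -mulrA.
move=> a u v w /=.
rewrite -[LHS]/((w : R[i]) * (a%:C * (u : R[i]) + (v : R[i])) : R[i]).
by rewrite mulrDr mulrCA.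
Qed.

Lemma Ck_mul k F (S A : set F) (f g : F -> Z) : subspace_like S -> rel_open S A ->
  Ck k S A f -> Ck k S A g -> Ck k S A ((fun x => (f x : R[i]) * g x) : F -> Z).
Proof.
move=> Sl oA Cf Cg.
exact: (Ck_comp Sl oA openT _ (Ck_pair Cf Cg) (Ck_mul_bilin k)).
Qed.

(** The identity [(z + t v)^-1 - z^-1 = - t v / (z (z + t v))] reduces the
    derivative of the inverse to its continuity. *)
Lemma realify_inv_quotient (z v : Z) : z != 0 ->
  ((fun t : R => t^-1 *: ((((z + t *: v : Z) : R[i])^-1 : Z) - ((z : R[i])^-1 : Z))) : R -> Z)
    @ (0 : R)^' --> (- (z^-1 * z^-1 * v : R[i]) : Z).
Proof.
move=> z0.
have c0 : (fun t : R => z + t *: v) @ (0 : R)^' --> z.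
  move=> B zB; apply: nbhs_dnbhs; exact: (@tvs_cvg_line _ _ z v _ zB).
have H : ((fun t : R => - (z^-1 * ((z + t *: v : Z) : R[i])^-1 * v : R[i])) : R -> Z)
    @ (0 : R)^' --> (- (z^-1 * z^-1 * v : R[i]) : Z).
  apply: (@cvgN _ Z); apply: realify_cvgM; last exact: cvg_cst.
  apply: realify_cvgM; first exact: cvg_cst.
  exact: (@cvg_comp _ _ _ _ (fun w : Z => ((w : R[i])^-1 : Z)) _ _ _ c0 (realify_inv_continuous z0)).
apply: cvg_trans H; apply: near_eq_cvg; near=> t.
have t0 : t != 0 by near: t; exact: nbhs_dnbhs_neq.
have zt0 : z + t *: v != 0 :> Z.
  by near: t; exact: (c0 _ (open_nbhs_nbhs (conj open_neq0 z0))).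
have tC : t%:C != 0 :> R[i] by rewrite -(rmorph0 (real_complex R)) (inj_eq (@complexI _)).
rewrite -[RHS]/((t^-1)%:C * (((z + t *: v : Z) : R[i])^-1 - z^-1) : R[i]).
have : ((z + t *: v : Z) : R[i]) != 0 by [].
rewrite -[(z + t *: v : Z)]/((z : R[i]) + t%:C * (v : R[i]) : R[i]) fmorphV /= => zt1.
have z1 : (z : R[i]) != 0 by [].
move: (t%:C) tC zt1 => c c0' zt1.
by field; rewrite ?c0' ?zt1 ?z1.
Unshelve. all: by end_near. Qed.

(** The differential is a polynomial in the inverse itself, which makes the
    induction on the order work. *)
Lemma Ck_inv k : Ck k setT [set z : Z | z != 0] ((fun z : Z => (z : R[i])^-1) : Z -> Z).
Proof.
elim: k => [|k IH] /=.
  apply/within_continuousP => z z0 B zB.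
  have : nbhs z (fun w : Z => B ((w : R[i])^-1 : Z)) := realify_inv_continuous z0 zB.
  by apply: filterS.
exists ((fun z : Z * Z => - ((z.1 : R[i])^-1 * (z.1 : R[i])^-1 * (z.2 : R[i]))) : Z * Z -> Z); split.
  move=> z v /= z0 _.
  exact: realify_inv_quotient.
apply: (@Ck_sub _ _ _ _ setT _ ([set z : Z | z != 0] `*` setT)) => //.
apply: Ck_opp.
have oW : open ([set z : Z | z != 0] `*` [set: Z]) by apply: openXT; exact: open_neq0.
have Sl := @subspace_likeT R (Z * Z)%type.
have Cf : Ck k setT ([set z : Z | z != 0] `*` [set: Z]) ((fun z => (z.1 : R[i])^-1) : Z * Z -> Z).
  apply: (Ck_precomp (L := fst)) IH => //; last by move=> [? ?] [].
  by move=> z; exact: cvg_fst.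
apply: Ck_mul => //; first exact: rel_openT.
  by apply: Ck_mul => //; exact: rel_openT.
apply: (@Ck_sub _ _ _ _ setT _ setT) => //; apply: Ck_linear => // z; exact: cvg_snd.
Unshelve. all: by end_near. Qed.

Lemma Ck_invf k F (S A : set F) (f : F -> Z) : subspace_like S -> rel_open S A ->
  (forall x, A x -> f x != 0) ->
  Ck k S A f -> Ck k S A ((fun x => (f x : R[i])^-1) : F -> Z).
Proof.
move=> Sl oA f0 Cf.
exact: (Ck_comp Sl oA open_neq0 _ Cf (Ck_inv k)).
Qed.

Lemma Ck_prod k F (S A : set F) (I : Type) (r : seq I) (f : I -> F -> Z) :
  subspace_like S -> rel_open S A -> (forall i, Ck k S A (f i)) ->
  Ck k S A ((fun x => \prod_(i <- r) (f i x : R[i])) : F -> Z).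
Proof.
move=> Sl oA Cf; elim: r => [|i r IH].
  by under eq_fun do rewrite big_nil; exact: Ck_cst.
by under eq_fun do rewrite big_cons; exact: Ck_mul.
Qed.

Lemma Ck_det k F (S A : set F) d (M : F -> 'M[R[i]]_d) :
  subspace_like S -> rel_open S A ->
  (forall i j, Ck k S A ((fun x => M x i j) : F -> Z)) ->
  Ck k S A ((fun x => \det (M x)) : F -> Z).
Proof.
move=> Sl oA CM; rewrite /determinant.
apply: Ck_sum => s; apply: Ck_mul => //; first exact: Ck_cst.
exact: Ck_prod.
Qed.

Lemma Ck_adj k F (S A : set F) d (M : F -> 'M[R[i]]_d) i j :
  subspace_like S -> rel_open S A ->
  (forall i j, Ck k S A ((fun x => M x i j) : F -> Z)) ->
  Ck k S A ((fun x => (\adj (M x)) i j) : F -> Z).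
Proof.
move=> Sl oA CM; under eq_fun do rewrite mxE /cofactor.
apply: Ck_mul => //; first exact: Ck_cst.
by apply: Ck_det => // a b; under eq_fun do rewrite !mxE.
Qed.

(** Cramer's rule: the inverse is a polynomial in the entries divided by the
    determinant. *)
Lemma Ck_invmx k F (S A : set F) d (M : F -> 'M[R[i]]_d) i j :
  subspace_like S -> rel_open S A ->
  (forall x, A x -> M x \in unitmx) ->
  (forall i j, Ck k S A ((fun x => M x i j) : F -> Z)) ->
  Ck k S A ((fun x => (invmx (M x)) i j) : F -> Z).
Proof.
move=> Sl oA MU CM.
apply: (@Ck_eq _ _ _ _ _ _ ((fun x => (\det (M x))^-1 * (\adj (M x)) i j) : F -> Z)) => //.
  by move=> x Ax; rewrite /invmx MU// !mxE.
apply: Ck_mul => //; last exact: Ck_adj.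
apply: Ck_invf => //; exact: Ck_det.
Qed.

End CkAlgebra.

(** * Smooth and holomorphic functions of several variables *)

Section DirectionalLimits.
Variable R : realType.
Implicit Types V W : normedModType R.
Local Notation Z := (realify R R[i]).

(** Since ['D_v f] is a [lim], it has a value even where difference quotients
    diverge; [dlim] records the convergence together with the limit. *)
Definition dlim V W (f : V -> W) (x v : V) (d : W) : Prop :=
  (fun t : R => t^-1 *: (f (x + t *: v) - f x)) @ (0 : R)^' --> d.

Lemma dlimE V W (f : V -> W) x v :
  (fun h : R => h^-1 *: ((f \o shift x) (h *: v) - f x)) =
  (fun t : R => t^-1 *: (f (x + t *: v) - f x)).
Proof. by apply/funext => h /=; rewrite [x + _]addrC. Qed.

Lemma derivable_dlim V W (f : V -> W) x v :
  derivable f x v -> dlim f x v ('D_v f x).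
Proof. by rewrite /derivable /derive /dlim -dlimE. Qed.

Lemma dlim_derivable V W (f : V -> W) x v d : dlim f x v d -> derivable f x v.
Proof. by rewrite /derivable /dlim dlimE => h; apply/cvg_ex; exists d. Qed.

Lemma dlim_derive V W (f : V -> W) x v d : dlim f x v d -> 'D_v f x = d.
Proof. by rewrite /derive /dlim dlimE => h; exact: cvg_lim h. Qed.

Lemma dlim_unique V W (f : V -> W) x v d d' : dlim f x v d -> dlim f x v d' -> d = d'.
Proof. by move=> /dlim_derive <- /dlim_derive <-. Qed.

Lemma dlim_line V W (f : V -> W) x v d : dlim f x v d ->
  (fun t : R => f (x + t *: v)) @ (0 : R)^' --> f x.
Proof.
move=> h.
have : (fun t : R => f x + t *: (t^-1 *: (f (x + t *: v) - f x))) @ (0 : R)^' --> f x + 0 *: d.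
  by apply: tvs_cvgD; [exact: cvg_cst|apply: tvs_cvgZ => //; exact: nbhs_dnbhs].
rewrite scale0r addr0; apply: cvg_trans; apply: near_eq_cvg; near=> t.
have t0 : t != 0 by near: t; exact: nbhs_dnbhs_neq.
by rewrite scalerA divff// scale1r subrKC.
Unshelve. all: by end_near. Qed.

Lemma dlim_near V W (f g : V -> W) x v d : (\forall y \near x, f y = g y) ->
  dlim f x v d -> dlim g x v d.
Proof.
move=> fg; apply: cvg_trans; apply: near_eq_cvg; near=> t.
rewrite (nbhs_singleton fg); congr (_ *: (_ - _)); near: t.
apply: nbhs_dnbhs; exact: (@tvs_cvg_line _ _ x v _ fg).
Unshelve. all: by end_near. Qed.

Lemma dlim_cst V W (c : W) (x v : V) : dlim (fun=> c) x v 0.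
Proof.
rewrite /dlim (_ : (fun t : R => _) = fun=> 0); first exact: cvg_cst.
by apply/funext => t; rewrite subrr scaler0.
Qed.

Lemma dlimD V W (f g : V -> W) x v a b : dlim f x v a -> dlim g x v b ->
  dlim (fun y => f y + g y) x v (a + b).
Proof.
move=> fa gb.
have H : (fun t : R => t^-1 *: (f (x + t *: v) - f x) + t^-1 *: (g (x + t *: v) - g x))
  @ (0 : R)^' --> a + b by apply: tvs_cvgD; [exact: fa|exact: gb].
apply: cvg_trans H; apply: near_eq_cvg.
by apply: nearW => t; rewrite -scalerDr opprD addrACA.
Qed.

Lemma dlim_post V W W' (T : W -> W') (f : V -> W) x v d : continuous T ->
  (forall (a : R) u v, T (a *: u + v) = a *: T u + T v) ->
  dlim f x v d -> dlim (fun y => T (f y)) x v (T d).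
Proof.
move=> cT lT fd.
have T0 : T 0 = 0 by have := lT (-1) 0 0; rewrite scaler0 addr0 scaleN1r addNr.
have TZ a u : T (a *: u) = a *: T u by rewrite -[a *: u]addr0 lT T0 addr0.
have TB u w : T (u - w) = T u - T w.
  by rewrite addrC -scaleN1r lT scaleN1r addrC.
have := @cvg_comp _ _ _ _ T _ _ _ fd (cT d); apply: cvg_trans; apply: near_eq_cvg.
by apply: nearW => t /=; rewrite TZ TB.
Qed.

Lemma dlimM V (f g : V -> Z) x v (a b : Z) : dlim f x v a -> dlim g x v b ->
  dlim ((fun y => (f y : R[i]) * g y) : V -> Z) x v ((a : R[i]) * g x + (f x : R[i]) * b : Z).
Proof.
move=> fa gb.
have H : ((fun t : R => ((t^-1 *: (f (x + t *: v) - f x) : Z) : R[i]) * g (x + t *: v) +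
   (f x : R[i]) * ((t^-1 *: (g (x + t *: v) - g x) : Z) : R[i])) : R -> Z) @ (0 : R)^' -->
   ((a : R[i]) * g x + (f x : R[i]) * b : Z).
  apply: (@tvs_cvgD _ Z).
    by apply: realify_cvgM => //; exact: dlim_line gb.
  by apply: realify_cvgM => //; exact: cvg_cst.
apply: cvg_trans H; apply: near_eq_cvg; apply: nearW => t.
rewrite -[LHS]/((t^-1)%:C * ((f (x + t *: v) : R[i]) - f x) * g (x + t *: v) +
   (f x : R[i]) * ((t^-1)%:C * ((g (x + t *: v) : R[i]) - g x)) : R[i]).
rewrite -[RHS]/((t^-1)%:C * ((f (x + t *: v) : R[i]) * g (x + t *: v) - (f x : R[i]) * g x) : R[i]).
by ring.
Qed.

Lemma dlim_sum V W (I : Type) (r : seq I) (f : I -> V -> W) x v (d : I -> W) :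
  (forall i, dlim (f i) x v (d i)) ->
  dlim (fun y => \sum_(i <- r) f i y) x v (\sum_(i <- r) d i).
Proof.
move=> fd; elim: r => [|i r IH].
  rewrite big_nil (_ : (fun y => _) = fun=> 0); first exact: dlim_cst.
  by apply/funext => y; rewrite big_nil.
rewrite big_cons (_ : (fun y => _) = fun y => f i y + \sum_(j <- r) f j y); first exact: dlimD.
by apply/funext => y; rewrite big_cons.
Qed.

(** Subtracting [L] measures how far [f] is from being affine, which is the form
    needed to differentiate limits and to prove the chain rule. *)
Lemma mean_value_norm W (f : R -> W) (df : R -> W) (L : W) (K : R) :
  (forall s, 0 <= s -> s <= 1 ->
     (fun t : R => t^-1 *: (f (s + t) - f s)) @ (0 : R)^' --> df s) ->
  (forall s, 0 <= s -> s <= 1 -> `|df s - L| <= K) ->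
  `|f 1 - f 0 - L| <= K.
Proof.
move=> fd dK; apply/ler_addgt0Pr => e e0; apply: ltW.
pose C := [set u : W | `|u - L| < K + e].
suff : C (f 1 - f 0) by [].
apply: (@mean_value_convex _ _ _ df) => //.
  move=> u v a a0 a1 /= Cu Cv; rewrite /C /=.
  have -> : a *: u + (1 - a) *: v - L = a *: (u - L) + (1 - a) *: (v - L).
    rewrite !scalerBr addrACA; congr (_ + _).
    by rewrite -opprD -scalerDl subrKC scale1r.
  apply: le_lt_trans (ler_normD _ _) _; rewrite !normrZ.
  rewrite (ger0_norm a0) ger0_norm ?subr_ge0//.
  have -> : K + e = a * (K + e) + (1 - a) * (K + e) by rewrite -mulrDl subrKC mul1r.
  have [->|an0] := eqVneq a 0; first by rewrite !mul0r !add0r subr0 !mul1r.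
  by apply: ltr_leD; [rewrite ltr_pM2l// lt_def an0|rewrite ler_wpM2l ?subr_ge0// ltW].
move=> s s0 s1; apply: (@filterS _ (nbhs (df s)) _ (ball (df s) e)); last exact: nbhsx_ballx.
move=> u; rewrite -ball_normE /= /C /= distrC => ue.
have -> : u - L = (u - df s) + (df s - L) by rewrite addrA subrK.
apply: le_lt_trans (ler_normD _ _) _; rewrite addrC; apply: ler_ltD => //.
exact: dK.
Qed.

Lemma mean_value_segment V W (f : V -> W) (df : R -> W) (x v : V) (t : R) (L : W) (K : R) :
  (forall s, 0 <= s -> s <= 1 -> dlim f (x + (s * t) *: v) v (df s)) ->
  (forall s, 0 <= s -> s <= 1 -> `|df s - L| <= K) ->
  `|f (x + t *: v) - f x - t *: L| <= `|t| * K.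
Proof.
move=> fd dK.
have [->|t0] := eqVneq t 0.
  by rewrite normr0 mul0r !scale0r addr0 subrr subr0 normr0.
pose gam (s : R) := f (x + (s * t) *: v).
have -> : f (x + t *: v) - f x = gam 1 - gam 0.
  by rewrite /gam mul1r mul0r scale0r addr0.
apply: (@mean_value_norm _ gam (fun s => t *: df s)).
  move=> s s0 s1.
  have h1 := @cvg_comp _ _ _ (fun u : R => t * u) _ _ _ _ (@dnbhs_scale _ t t0) (fd s s0 s1).
  have H : (fun u : R => t *: ((t * u)^-1 *: (f (x + (s * t) *: v + (t * u) *: v)
      - f (x + (s * t) *: v)))) @ (0 : R)^' --> t *: df s.
    by apply: tvs_cvgZ; [exact: cvg_cst|exact: h1].
  apply: cvg_trans H; apply: near_eq_cvg; apply: nearW => u; rewrite /gam /=.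
  rewrite -addrA -scalerDl mulrDl (mulrC u t) scalerA; congr (_ *: _).
  by rewrite invfM mulrA divff// mul1r.
by move=> s s0 s1; rewrite -scalerBr normrZ ler_wpM2l// dK.
Qed.

End DirectionalLimits.

Section SmoothClosure.
Variable R : realType.
Implicit Types V W : normedModType R.
Local Notation Z := (realify R R[i]).

Lemma smooth_in_cont V W (D : set V) (f : V -> W) x :
  smooth_in D f -> D x -> f @ nbhs x --> f x.
Proof. by move=> sf Dx; have [] := sf [::] x Dx. Qed.

Lemma smooth_in_dlim V W (D : set V) (f : V -> W) x v :
  smooth_in D f -> D x -> dlim f x v ('D_v f x).
Proof. by move=> sf Dx; apply: derivable_dlim; have [_] := sf [::] x Dx; exact. Qed.

Lemma smooth_in_iter V W (D : set V) (f : V -> W) us :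
  smooth_in D f -> smooth_in D (iter_derive us f).
Proof.
move=> sf vs x Dx.
have -> : iter_derive vs (iter_derive us f) = iter_derive (vs ++ us) f.
  by rewrite /iter_derive foldr_cat.
exact: sf.
Qed.

Lemma smooth_in_derive V W (D : set V) (f : V -> W) v :
  smooth_in D f -> smooth_in D ('D_v f).
Proof. exact: (@smooth_in_iter _ _ _ _ [:: v]). Qed.

Lemma smooth_in_sub V W (D D' : set V) (f : V -> W) : D' `<=` D ->
  smooth_in D f -> smooth_in D' f.
Proof. by move=> DD sf vs x /DD; exact: sf. Qed.

(** Smoothness is proved by exhibiting a class of functions that contains [f],
    consists of continuous functions, and is stable under directional
    derivatives. *)
Lemma smooth_in_class V W (D : set V) (S : set (V -> W)) : open D ->
  (forall f x, S f -> D x -> f @ nbhs x --> f x) ->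
  (forall f v, S f -> exists2 g, S g & forall x, D x -> dlim f x v (g x)) ->
  forall f, S f -> smooth_in D f.
Proof.
move=> oD Sc Sd f Sf.
have H vs : exists2 g, S g & forall x, D x -> iter_derive vs f x = g x.
  elim: vs => [|v vs [g Sg IH]]; first by exists f.
  have [g' Sg' gg'] := Sd g v Sg; exists g' => // x Dx.
  apply: dlim_derive; apply: dlim_near (gg' x Dx).
  by near=> y; rewrite -[RHS]/(iter_derive vs f y) IH//; near: y; exact: open_nbhs_nbhs.
move=> vs x Dx; have [g Sg vg] := H vs.
have E : \forall y \near x, g y = iter_derive vs f y.
  by near=> y; rewrite vg//; near: y; exact: open_nbhs_nbhs.
split=> [|v].
  rewrite /prop_for /continuous_at -(nbhs_singleton E).
  apply: cvg_trans; first exact: near_eq_cvg E.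
  exact: Sc.
have [g' Sg' gg'] := Sd g v Sg.
exact: dlim_derivable (dlim_near E (gg' x Dx)).
Unshelve. all: by end_near. Qed.

Lemma iter_derive_eq V W (D : set V) (f g : V -> W) : open D ->
  (forall x, D x -> f x = g x) -> forall vs x, D x -> iter_derive vs f x = iter_derive vs g x.
Proof.
move=> oD fg; elim=> [|v vs IH] x Dx /=; first exact: fg.
apply: near_eq_derive; near=> y; apply: IH; near: y; exact: open_nbhs_nbhs.
Unshelve. all: by end_near. Qed.

Lemma smooth_in_eq V W (D : set V) (f g : V -> W) : open D ->
  (forall x, D x -> f x = g x) -> smooth_in D f -> smooth_in D g.
Proof.
move=> oD fg sf; apply: (@smooth_in_class _ _ D [set h | exists vs, forall x, D x -> h x = iter_derive vs f x]) => //.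
- move=> h x [vs hf] Dx; have [c _] := sf vs x Dx.
  rewrite (hf x Dx); apply: cvg_trans c; apply: near_eq_cvg.
  by near=> y; rewrite hf//; near: y; exact: open_nbhs_nbhs.
- move=> h v [vs hf]; exists (iter_derive (v :: vs) f); first by exists (v :: vs).
  move=> x Dx; apply: dlim_near (derivable_dlim ((sf vs x Dx).2 v)).
  by near=> y; rewrite hf//; near: y; exact: open_nbhs_nbhs.
- by exists [::] => x Dx; rewrite /= fg.
Unshelve. all: by end_near. Qed.

Lemma smooth_in_post V W W' (T : W -> W') (D : set V) (f : V -> W) : open D ->
  continuous T -> (forall (a : R) u v, T (a *: u + v) = a *: T u + T v) ->
  smooth_in D f -> smooth_in D (fun x => T (f x)).
Proof.
move=> oD cT lT sf.
apply: (@smooth_in_class _ _ D [set h | exists vs, h = fun x => T (iter_derive vs f x)]) => //.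
- move=> h x [vs ->] Dx; have [c _] := sf vs x Dx.
  exact: (@cvg_comp _ _ _ (iter_derive vs f) T _ _ _ c (cT _)).
- move=> h v [vs ->]; exists (fun x => T (iter_derive (v :: vs) f x)); first by exists (v :: vs).
  move=> x Dx; apply: dlim_post => //.
  exact: derivable_dlim ((sf vs x Dx).2 v).
- by exists [::].
Qed.

Lemma smooth_inM V (D : set V) (f g : V -> Z) : open D ->
  smooth_in D f -> smooth_in D g -> smooth_in D ((fun x => (f x : R[i]) * g x) : V -> Z).
Proof.
move=> oD sf sg.
(* By the product rule, the sums of products of a derivative of f and a
   derivative of g form a stable class. *)
pose term (p : seq V * seq V) : V -> Z := fun x => (iter_derive p.1 f x : R[i]) * iter_derive p.2 g x.
apply: (@smooth_in_class _ _ D [set h | exists l, h = fun x => \sum_(p <- l) term p x]) => //.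
- move=> h x [l ->] Dx; elim: l => [|p l IH].
    by under eq_fun do rewrite big_nil; rewrite big_nil; exact: cvg_cst.
  under eq_fun do rewrite big_cons; rewrite big_cons; apply: (@tvs_cvgD _ Z) => //.
  have [c1 _] := sf p.1 x Dx; have [c2 _] := sg p.2 x Dx.
  exact: realify_cvgM.
- move=> h v [l ->].
  exists (fun x => \sum_(p <- [seq (v :: p.1, p.2) | p <- l] ++ [seq (p.1, v :: p.2) | p <- l]) term p x).
    by eexists.
  move=> x Dx.
  have -> : \sum_(p <- [seq (v :: p.1, p.2) | p <- l] ++ [seq (p.1, v :: p.2) | p <- l]) term p x
     = \sum_(p <- l) (term (v :: p.1, p.2) x + term (p.1, v :: p.2) x).
    by rewrite big_cat /= !big_map big_split.
  apply: dlim_sum => p; apply: dlimM.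
    exact: derivable_dlim ((sf p.1 x Dx).2 v).
  exact: derivable_dlim ((sg p.2 x Dx).2 v).
- by exists [:: ([::], [::])]; apply/funext => x; rewrite big_seq1.
Qed.

Lemma smooth_in_sum V W (D : set V) (I : Type) (r : seq I) (f : I -> V -> W) : open D ->
  (forall i, smooth_in D (f i)) -> smooth_in D (fun x => \sum_(i <- r) f i x).
Proof.
move=> oD sf; elim: r => [|i r IH].
  by under eq_fun do rewrite big_nil; exact: smooth_in_cst.
by under eq_fun do rewrite big_cons; exact: (smooth_inD oD (sf i) IH).
Qed.

Lemma nbhs_box V (x v w : V) (P : set V) : nbhs x P ->
  exists2 d : R, 0 < d & forall a b : R, `|a| <= d -> `|b| <= d -> P (x + a *: v + b *: w).
Proof.
move=> /nbhs_ballP[r /= r0 rP].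
have v0 := normr_ge0 v; have w0 := normr_ge0 w.
have c0 : 0 < 1 + `|v| + `|w| by lra.
pose q := r / 2 / (1 + `|v| + `|w|).
have q0 : 0 < q by rewrite !divr_gt0.
have qE : q * (1 + `|v| + `|w|) = r / 2 by rewrite /q mulfVK// gt_eqF.
exists q => // a b ad bd; apply: rP.
rewrite -ball_normE /= -addrA opprD addrA subrr sub0r normrN.
apply: le_lt_trans (ler_normD _ _) _; rewrite !normrZ.
have h1 : `|a| * `|v| <= q * `|v| by rewrite ler_wpM2r.
have h2 : `|b| * `|w| <= q * `|w| by rewrite ler_wpM2r.
rewrite !mulrDr mulr1 in qE; lra.
Qed.

(** The second difference is the increment of [f (. + t v) - f] along [w]; apply
    the mean value inequality to this function along [w], then to ['D_w f] along
    [v]. *)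
Lemma second_difference V W (D : set V) (f : V -> W) (v w x : V) (t e : R) :
  smooth_in D f -> 0 < t ->
  (forall a b : R, `|a| <= t -> `|b| <= t -> D (x + a *: v + b *: w) /\
     `|'D_v ('D_w f) (x + a *: v + b *: w) - 'D_v ('D_w f) x| <= e) ->
  `|f (x + t *: v + t *: w) - f (x + t *: w) - (f (x + t *: v) - f x)
    - t *: (t *: 'D_v ('D_w f) x)| <= t * (t * e).
Proof.
move=> sf t0 H; set L := 'D_v ('D_w f) x.
have tt : `|t| <= t by rewrite gtr0_norm.
have st s : 0 <= s -> s <= 1 -> `|s * t| <= t.
  by move=> s0 s1; rewrite normrM !ger0_norm ?(ltW t0)// ler_piMl// ltW.
have z0 : `|0 : R| <= t by rewrite normr0 ltW.
pose phi (y : V) := f (y + t *: v) + (-1 : R) *: f y.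
have phid s : 0 <= s -> s <= 1 -> dlim phi (x + (s * t) *: w) w
    ('D_w f (x + (s * t) *: w + t *: v) + (-1 : R) *: 'D_w f (x + (s * t) *: w)).
  move=> s0 s1.
  have D1 : D (x + (s * t) *: w + t *: v).
    by rewrite addrAC; have [] := H t (s * t) tt (st s s0 s1).
  have D2 : D (x + (s * t) *: w).
    by have [] := H 0 (s * t) z0 (st s s0 s1); rewrite scale0r addr0.
  apply: dlimD.
    have := @smooth_in_dlim _ _ _ _ _ w sf D1; apply: cvg_trans; apply: near_eq_cvg.
    by apply: nearW => u; rewrite addrAC.
  apply: (@dlim_post _ _ _ _ (fun y : W => (-1 : R) *: y)); last exact: smooth_in_dlim sf D2.
    by move=> y; apply: tvs_cvgZ; [exact: cvg_cst|exact: cvg_id].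
  by move=> a u1 u2; rewrite scalerDr !scalerA mulrC.
have := @mean_value_segment _ _ _ phi _ x w t (t *: L) (t * e) phid.
rewrite /phi !scaleN1r (addrAC x (t *: w)) [`|t|]gtr0_norm//.
rewrite opprD opprK.
have -> : f (x + t *: v + t *: w) - f (x + t *: w) + (- f (x + t *: v) + f x) =
   f (x + t *: v + t *: w) - f (x + t *: w) - (f (x + t *: v) - f x).
  by rewrite opprB [f x - _]addrC.
apply=> s s0 s1; rewrite scaleN1r -[X in _ <= X * _](gtr0_norm t0).
apply: (@mean_value_segment R V W ('D_w f) (fun u => 'D_v ('D_w f) (x + (u * t) *: v + (s * t) *: w))).
  move=> u u0 u1.
  have [Du _] := H (u * t) (s * t) (st u u0 u1) (st s s0 s1).
  by rewrite addrAC; apply: smooth_in_dlim Du; exact: smooth_in_derive.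
by move=> u u0 u1; have [] := H (u * t) (s * t) (st u u0 u1) (st s s0 s1).
Qed.

Lemma second_difference_limits W (P L1 L2 : W) (t e : R) : 0 < t ->
  `|P - t *: (t *: L1)| <= t * (t * e) -> `|P - t *: (t *: L2)| <= t * (t * e) ->
  `|L1 - L2| <= e + e.
Proof.
move=> t0 h1 h2.
have : `|t *: (t *: (L1 - L2))| <= t * (t * e) + t * (t * e).
  have -> : t *: (t *: (L1 - L2)) = (P - t *: (t *: L2)) - (P - t *: (t *: L1)).
    by rewrite !scalerBr opprB [RHS]addrC addrA subrK.
  by apply: le_trans (ler_normB _ _) _; exact: lerD.
by rewrite !normrZ gtr0_norm// -mulrDr ler_pM2l// -mulrDr ler_pM2l.
Qed.

Lemma thirds_lt (q : R) : 0 < q -> ~~ (q <= q / 3 + q / 3).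
Proof. by move=> q0; rewrite -ltNge; lra. Qed.

Lemma near_dist_lt V W (f : V -> W) (x : V) (L : W) (e : R) : f @ nbhs x --> L -> 0 < e ->
  nbhs x (fun y => `|L - f y| < e).
Proof. by move=> fL e0; exact: cvgr_dist_lt. Qed.

(** The second difference of [f] is symmetric in [v] and [w], and it
    approximates both mixed derivatives times the same square of the step. *)
Lemma deriveC V W (D : set V) (f : V -> W) (v w x : V) : open D -> smooth_in D f -> D x ->
  'D_v ('D_w f) x = 'D_w ('D_v f) x.
Proof.
move=> oD sf Dx; set L1 := LHS; set L2 := RHS.
apply/eqP; rewrite -subr_eq0 -normr_eq0 -[_ == 0]negbK.
apply/negP => /negPf n0.
have Lp : 0 < `|L1 - L2| by rewrite lt_def n0 normr_ge0.
pose e := `|L1 - L2| / 3; have e0 : 0 < e by rewrite divr_gt0.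
have nD : nbhs x D by exact: open_nbhs_nbhs.
have c1 : 'D_v ('D_w f) @ nbhs x --> L1 by have [] := sf [:: v; w] x Dx.
have c2 : 'D_w ('D_v f) @ nbhs x --> L2 by have [] := sf [:: w; v] x Dx.
have n1 := near_dist_lt c1 e0.
have n2 := near_dist_lt c2 e0.
have [t t0 tP] := nbhs_box v w (filterI nD (filterI n1 n2)).
have h1 := @second_difference _ _ D f v w x t e sf t0.
have h2 := @second_difference _ _ D f w v x t e sf t0.
have {}h1 : `|f (x + t *: v + t *: w) - f (x + t *: w) - (f (x + t *: v) - f x)
    - t *: (t *: L1)| <= t * (t * e).
  apply: h1 => a b ha hb; have [Dp [hh _]] := tP a b ha hb.
  by split; [exact: Dp|rewrite distrC; exact: ltW hh].
have {}h2 : `|f (x + t *: w + t *: v) - f (x + t *: v) - (f (x + t *: w) - f x)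
    - t *: (t *: L2)| <= t * (t * e).
  apply: h2 => a b ha hb; have [Dp [_ hh]] := tP b a hb ha.
  rewrite (addrAC x (a *: w)); split; first exact: Dp.
  by rewrite distrC; exact: ltW hh.
rewrite (addrAC x (t *: w)) in h2.
set Q := f (x + t *: v + t *: w) in h1 h2.
have E : Q - f (x + t *: v) - (f (x + t *: w) - f x) = Q - f (x + t *: w) - (f (x + t *: v) - f x).
  by rewrite -!addrA; congr (_ + _); rewrite !opprB addrCA [RHS]addrCA; congr (_ + _); exact: addrC.
rewrite E in h2; set P := (Q - _ - _) in h1 h2.
exact: (negP (thirds_lt Lp) (second_difference_limits t0 h1 h2)).
Qed.

End SmoothClosure.

Section ComplexLinear.
Variable R : realType.
Local Notation Z := (realify R R[i]).

(** Complex linearity is imposed on directional derivatives only. Unlike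
    differentiability over the complex numbers, this condition is inherited by
    the derivatives of [f]. *)
Definition holo (W : normedModType R[i]) (D : set (realify R W)) (f : realify R W -> Z) :=
  smooth_in D f /\ forall x, D x -> forall (a : R[i]) (v w : W),
    'D_(a *: v + w : realify R W) f x = (a * ('D_(v : realify R W) f x : R[i]) + 'D_(w : realify R W) f x : Z).

Lemma mulC_linear (c : R[i]) (a : R) (u v : Z) :
  (c * ((a *: u + v : Z) : R[i]) : Z) = a *: (c * (u : R[i]) : Z) + (c * (v : R[i]) : Z).
Proof.
rewrite -[LHS]/(c * (a%:C * (u : R[i]) + (v : R[i])) : R[i]).
by rewrite mulrDr mulrCA.
Qed.

(** Mixed derivatives commute, so the derivative of [f] along [v] has complex
    linear derivatives, being in turn derivatives along [v] of complex linear
    expressions. *)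
Lemma holo_derive (W : normedModType R[i]) (D : set (realify R W)) f (v : realify R W) :
  open D -> holo D f -> holo D ('D_v f).
Proof.
move=> oD [sf lf]; split; first exact: smooth_in_derive.
move=> x Dx a u w.
have C u' : 'D_u' ('D_v f) x = 'D_v ('D_u' f) x := deriveC u' v oD sf Dx.
have Ca := C (a *: u + w : realify R W).
have Cu := C (u : realify R W); have Cw := C (w : realify R W).
apply: (etrans Ca).
apply: (etrans _ (esym (f_equal2 (fun p q : Z => (a * (p : R[i]) + (q : R[i]) : Z)) Cu Cw))).
have nD := open_nbhs_nbhs (conj oD Dx).
apply: dlim_derive.
apply: (@dlim_near _ _ _ ((fun y => a * ('D_(u : realify R W) f y : R[i]) + ('D_(w : realify R W) f y : R[i])) : realify R W -> Z)).
  by apply: filterS nD => y Dy; exact: esym (lf y Dy a u w).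
apply: (@dlimD _ _ Z).
  apply: (@dlim_post _ _ _ _ ((fun z : Z => a * (z : R[i])) : Z -> Z)).
  - exact: mulC_continuous.
  - by move=> b z1 z2; exact: mulC_linear.
  - by apply: smooth_in_dlim Dx; exact: smooth_in_derive.
by apply: smooth_in_dlim Dx; exact: smooth_in_derive.
Unshelve. all: by end_near. Qed.

Lemma holo_iter (W : normedModType R[i]) (D : set (realify R W)) f (vs : seq (realify R W)) :
  open D -> holo D f -> holo D (iter_derive vs f).
Proof. by move=> oD hf; elim: vs => [//|v vs IH]; exact: holo_derive. Qed.

Lemma real_complex_cvg0 : (fun t : R => t%:C) @ (0 : R)^' --> (0 : R[i])^'.
Proof.
move=> A [/= d d0 dA].
have [/= e e0 ed] : exists2 e : R, 0 < e & e%:C <= d.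
  have rd : d \is Num.real by rewrite gtr0_real.
  exists (complex.Re d); last by rewrite RRe_real.
  by rewrite -ltcR RRe_real.
exists e => // t /=; rewrite sub0r normrN => te t0; apply: dA.
  rewrite /= sub0r normrN; apply: lt_le_trans ed.
  by rewrite normc_def /= expr0n addr0 sqrtr_sqr ltcR.
by rewrite -(rmorph0 (real_complex R)) (inj_eq (@complexI _)).
Qed.

Lemma realify_cvg T (F : set_system T) (FF : Filter F) (W : normedModType R[i]) (f : T -> W) (l : W) :
  (f @ F --> l) <-> ((f : T -> realify R W) @ F --> (l : realify R W)).
Proof.
have E t : (`|(l : realify R W) - (f t : realify R W)|)%:C = `|l - f t|.
  exact: (realify_normE (l - f t : realify R W)).
split=> /cvgrPdist_lt h; apply/cvgrPdist_lt => e e0.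
  have := h e%:C; rewrite ltcR => /(_ e0); apply: filterS => t.
  by rewrite -E ltcR.
have re : e \is Num.real by rewrite gtr0_real.
have e1 : 0 < complex.Re e by rewrite -ltcR RRe_real.
have := h _ e1; apply: filterS => t.
by rewrite -ltcR E RRe_real.
Qed.

(** A complex differential restricts to the real directional derivatives. *)
Lemma holomorphic_holo n (D : set (Cn R n)) (f : Cn R n -> R[i]) :
  holomorphic_in D f -> holo D (f : Cn R n -> Z).
Proof.
move=> [sf df]; split=> // x Dx a v w.
suff E (u : 'rV[R[i]]_n) : 'D_(u : Cn R n) (f : Cn R n -> Z) x =
    'd (f : 'rV[R[i]]_n -> R[i]) (x : 'rV[R[i]]_n) u.
  by rewrite !E linearP.
apply: dlim_derive; rewrite /dlim.
have := df x Dx => /(@diff_derivable _ _ _ _ _ u).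
rewrite /derivable => h.
have {}h : (fun t : R[i] => t^-1 *: (f (t *: u + (x : 'rV[R[i]]_n)) - f x)) @ (0 : R[i])^' -->
   'd (f : 'rV[R[i]]_n -> R[i]) (x : 'rV[R[i]]_n) u.
  by rewrite -deriveE; [exact: h|exact: df].
have /realify_cvg h1 := @cvg_comp _ _ _ (fun t : R => t%:C) (fun t : R[i] => t^-1 *: (f (t *: u + (x : 'rV[R[i]]_n)) - f x)) _ _ _ (@real_complex_cvg0) h.
apply: cvg_trans h1; apply: near_eq_cvg; apply: nearW => t /=.
rewrite -[RHS]/((t^-1)%:C * (f (x + t *: (u : Cn R n)) - f x) : R[i]).
by rewrite fmorphV; congr (_ * (f _ - _)); exact: addrC.
Qed.

End ComplexLinear.

Section ChainRule.
Variable R : realType.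
Local Notation Z := (realify R R[i]).

(** The vectors [e_j] and [i e_j] form a real basis of the coordinate space; the
    boolean marks the imaginary directions. *)
Definition Cbasis n (k : 'I_n * bool) : Cn R n :=
  (if k.2 then 'i%C else 1) *: (delta_mx 0 k.1 : 'rV[R[i]]_n).

Definition Ccoord n (k : 'I_n * bool) (z : Cn R n) : R :=
  let c := (z : 'rV[R[i]]_n) 0 k.1 in if k.2 then complex.Im c else complex.Re c.

Lemma Ccoord_sum n (z : Cn R n) : z = \sum_k Ccoord k z *: Cbasis k.
Proof.
rewrite (eq_bigr (fun p : 'I_n * bool => Ccoord (p.1, p.2) z *: Cbasis (p.1, p.2))); last by case.
rewrite -(pair_bigA _ (fun j b => Ccoord (j, b) z *: Cbasis (j, b))) /=.
rewrite [LHS]row_sum_delta; apply: eq_bigr => j _; rewrite big_bool /=.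
rewrite /Ccoord /Cbasis /=.
rewrite -[RHS]/((complex.Im (z 0 j))%:C *: ('i%C *: delta_mx 0 j) +
   (complex.Re (z 0 j))%:C *: (1 *: (delta_mx 0 j : 'rV[R[i]]_n))).
move: (z 0 j) => c; rewrite [in LHS](complexE c) scalerDl addrC mulrC -scalerA.
by rewrite scale1r.
Qed.

Lemma Ccoord_sub n (k : 'I_n * bool) (z w : Cn R n) : Ccoord k (z - w) = Ccoord k z - Ccoord k w.
Proof.
rewrite /Ccoord -[(z - w : Cn R n)]/((z : 'rV[R[i]]_n) - (w : 'rV[R[i]]_n)) !mxE.
by case: k.2; rewrite raddfB.
Qed.

(** A function with continuous partial derivatives is differentiable: move along
    the [w i] one at a time and use the mean value inequality on each leg. *)
Lemma expansion (V W : normedModType R) (I : eqType) (r : seq I) (w : I -> V)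
    (h : V -> W) (p : V) :
  (forall i, \forall q \near p, dlim h q (w i) ('D_(w i) h q)) ->
  (forall i, 'D_(w i) h @ nbhs p --> 'D_(w i) h p) ->
  forall e : R, 0 < e -> exists2 d : R, 0 < d & forall a : I -> R,
   (forall i, `|a i| <= d) ->
   `|h (p + \sum_(i <- r) a i *: w i) - h p - \sum_(i <- r) a i *: 'D_(w i) h p|
     <= e * \sum_(i <- r) `|a i|.
Proof.
move=> hd hc e e0; elim: r => [|i r [d d0 IH]].
  by exists 1 => // a _; rewrite !big_nil addr0 subrr subr0 normr0 mulr0.
have : \forall q \near p, dlim h q (w i) ('D_(w i) h q) /\ `|'D_(w i) h q - 'D_(w i) h p| <= e.
  apply: filterS2 (hd i) (cvgr_dist_lt _ _ (hc i) _ e0) => q h1 h2; split=> //.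
  by rewrite distrC ltW.
move=> /nbhs_ballP[b /= b0 bP].
pose N := \sum_(j <- i :: r) `|w j|.
have NE : N = `|w i| + \sum_(j <- r) `|w j| by rewrite /N big_cons.
have N0 : 0 <= N by apply: sumr_ge0.
have N1 : 0 < N + 1 by rewrite ltr_wpDl.
have [q q0 qN] : exists2 q, 0 < q & q * (N + 1) = b / 2.
  by exists (b / 2 / (N + 1)); [rewrite !divr_gt0|rewrite mulfVK// gt_eqF].
exists (Num.min d q); first by rewrite lt_min d0.
move=> a ad.
have ad1 j : `|a j| <= d by apply: le_trans (ad j) _; rewrite ge_min lexx.
have ad2 j : `|a j| <= q by apply: le_trans (ad j) _; rewrite ge_min lexx orbT.
rewrite !big_cons; set S := \sum_(j <- r) a j *: w j; set T := \sum_(j <- r) a j *: _.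
have inb (s : R) : 0 <= s -> s <= 1 -> ball p b (p + S + (s * a i) *: w i).
  move=> s0 s1; rewrite -ball_normE /= -addrA opprD addrA subrr sub0r normrN.
  apply: (@le_lt_trans _ _ (q * N)).
    rewrite NE mulrDr addrC; apply: le_trans (ler_normD _ _) _; apply: lerD.
      rewrite normrZ ler_wpM2r// normrM ger0_norm//.
      by apply: le_trans (ad2 i); rewrite ler_piMl.
    apply: le_trans (ler_norm_sum _ _ _) _; rewrite mulr_sumr; apply: ler_sum => j _.
    by rewrite normrZ ler_wpM2r.
  move: qN; rewrite mulrDr mulr1; lra.
have := @mean_value_segment R V W h (fun s => 'D_(w i) h (p + S + (s * a i) *: w i))
  (p + S) (w i) (a i) ('D_(w i) h p) e.
have seg1 (s : R) : 0 <= s -> s <= 1 -> dlim h (p + S + (s * a i) *: w i) (w i)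
   ('D_(w i) h (p + S + (s * a i) *: w i)).
  by move=> s0 s1; have [] := bP _ (inb s s0 s1).
have seg2 (s : R) : 0 <= s -> s <= 1 ->
   `|'D_(w i) h (p + S + (s * a i) *: w i) - 'D_(w i) h p| <= e.
  by move=> s0 s1; have [] := bP _ (inb s s0 s1).
move=> /(_ seg1 seg2) H1; have H2 := IH a ad1.
rewrite [X in h (p + X)]addrC addrA.
have -> : h (p + S + a i *: w i) - h p - (a i *: 'D_(w i) h p + T) =
  (h (p + S + a i *: w i) - h (p + S) - a i *: 'D_(w i) h p) + (h (p + S) - h p - T).
  rewrite opprD; set A := h (p + S + a i *: w i); set B := h (p + S).
  by rewrite [RHS]addrACA [A - B + _]addrA subrK addrA.
apply: le_trans (ler_normD _ _) _; rewrite mulrDr; apply: lerD => //.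
by rewrite mulrC.
Qed.

Lemma realify_ge_Re (z : R[i]) : `|complex.Re z| <= `|(z : Z)|.
Proof. by rewrite -lecR -[`|(z : Z)|]/(realify_norm (z : Z)) realify_normE; exact: normc_ge_Re. Qed.

Lemma realify_normi : `|('i%C : Z)| = 1.
Proof.
apply: complexI; rewrite -[`|('i%C : Z)|]/(realify_norm ('i%C : Z)) realify_normE.
by rewrite normc_def /= expr0n expr1n add0r sqrtr1.
Qed.

Lemma realify_ge_Im (z : R[i]) : `|complex.Im z| <= `|(z : Z)|.
Proof.
rewrite -normrN -ReiNIm; apply: le_trans (realify_ge_Re _) _.
by rewrite realify_normM realify_normi mulr1.
Qed.

Lemma realify_le_ReIm (z : R[i]) : `|(z : Z)| <= `|complex.Re z| + `|complex.Im z|.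
Proof.
rewrite -lecR -[`|(z : Z)|]/(realify_norm (z : Z)) realify_normE {1}(complexE z).
rewrite rmorphD /=; apply: le_trans (ler_normD _ _) _.
have E (x : R) : `|x%:C| = `|x|%:C by rewrite normc_def /= expr0n addr0 sqrtr_sqr.
rewrite normrM !E; apply: lerD => //.
by rewrite normc_def /= expr0n expr1n add0r sqrtr1 mul1r.
Qed.

Lemma Re_linear (a : R) (u v : Z) : complex.Re (a *: u + v : Z) = a * complex.Re u + complex.Re v.
Proof.
rewrite -[(a *: u + v : Z)]/(a%:C * (u : R[i]) + (v : R[i])) raddfD /=.
by case: u => x y /=; rewrite mul0r subr0.
Qed.

Lemma Im_linear (a : R) (u v : Z) : complex.Im (a *: u + v : Z) = a * complex.Im u + complex.Im v.
Proof.
rewrite -[(a *: u + v : Z)]/(a%:C * (u : R[i]) + (v : R[i])) raddfD /=.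
by case: u => x y /=; rewrite mul0r addr0.
Qed.

Lemma lipschitz_continuous (V W : normedModType R) (f : V -> W) (K : R) : 0 <= K ->
  (forall x y, `|f x - f y| <= K * `|x - y|) -> continuous f.
Proof.
move=> K0 fl z; apply/cvgrPdist_lt => e e0; near=> y.
have K1 : 0 < K + 1 by rewrite ltr_wpDl.
apply: le_lt_trans (fl _ _) _; apply: (@le_lt_trans _ _ ((K + 1) * `|z - y|)).
  by rewrite ler_wpM2r// lerDl.
rewrite mulrC -ltr_pdivlMr//; near: y.
by apply: cvgr_dist_lt; [exact: cvg_id|rewrite divr_gt0// ltr_wpDl].
Unshelve. all: by end_near. Qed.

Lemma lipschitz1_continuous (V W : normedModType R) (f : V -> W) :
  (forall x y, `|f x - f y| <= `|x - y|) -> continuous f.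
Proof.
by move=> fl; apply: (@lipschitz_continuous V W f 1) => // x y; rewrite mul1r.
Qed.

Lemma Re_continuous : continuous (@complex.Re R : Z -> R).
Proof.
apply: (@lipschitz1_continuous Z R^o) => x y.
by apply: le_trans (realify_ge_Re _); rewrite raddfB.
Qed.

Lemma Im_continuous : continuous (@complex.Im R : Z -> R).
Proof.
apply: (@lipschitz1_continuous Z R^o) => x y.
by apply: le_trans (realify_ge_Im _); rewrite raddfB.
Qed.

Lemma real_complex_continuous : continuous ((fun x : R => x%:C) : R -> Z).
Proof.
apply: (@lipschitz1_continuous R^o Z) => x y.
rewrite -lecR -[`|_ : Z|]/(realify_norm _) realify_normE -rmorphB /=.
by rewrite normc_def /= expr0n addr0 sqrtr_sqr.
Qed.

Lemma normed_cvg_sum (V : normedModType R) T (F : set_system T) {FF : Filter F} (I : Type) (r : seq I)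
   (f : I -> T -> V) (l : I -> V) : (forall i, f i @ F --> l i) ->
  (fun t => \sum_(i <- r) f i t) @ F --> \sum_(i <- r) l i.
Proof.
move=> fl; elim: r => [|i r IH].
  by under eq_fun do rewrite big_nil; rewrite big_nil; exact: cvg_cst.
under eq_fun do rewrite big_cons; rewrite big_cons; exact: (@tvs_cvgD _ V).
Qed.

(** Expand [h] at [phi x] along the coordinate directions; the real coordinates
    of [phi (x + t v)] have derivatives given by the real and imaginary parts of
    [c]. *)
Lemma chain_rule (V : normedModType R) n (W : normedModType R) (phi : V -> Cn R n) (h : Cn R n -> W)
    (x v : V) (c : 'I_n -> Z) :
  (forall j, dlim ((fun y => (phi y : 'rV[R[i]]_n) 0 j) : V -> Z) x v (c j)) ->
  (forall k, \forall q \near phi x, dlim h q (Cbasis k) ('D_(Cbasis k) h q)) ->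
  (forall k, 'D_(Cbasis k) h @ nbhs (phi x) --> 'D_(Cbasis k) h (phi x)) ->
  dlim (h \o phi) x v
    (\sum_k (if k.2 then complex.Im (c k.1) else complex.Re (c k.1)) *: 'D_(Cbasis k) h (phi x)).
Proof.
move=> phid hd hc.
pose al (k : 'I_n * bool) : R := if k.2 then complex.Im (c k.1) else complex.Re (c k.1).
pose a (k : 'I_n * bool) (t : R) : R := Ccoord k (phi (x + t *: v)) - Ccoord k (phi x).
have adl k : (fun t : R => t^-1 * a k t) @ (0 : R)^' --> al k.
  have := phid k.1; rewrite /dlim => hk.
  pose T (z : Z) : R^o := if k.2 then complex.Im z else complex.Re z.
  have cT : continuous T.
    by rewrite /T; case: k.2; [exact: Im_continuous|exact: Re_continuous].
  have lT (b : R) u w : T (b *: u + w) = b * T u + T w.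
    by rewrite /T; case: k.2; [exact: Im_linear|exact: Re_linear].
  have T0 : T 0 = 0 by have := lT (-1) 0 0; rewrite scaler0 addr0 mulN1r addNr.
  have TZ b u : T (b *: u) = b * T u by rewrite -[b *: u]addr0 lT T0 addr0.
  have TB u w : T (u - w) = T u - T w.
    by rewrite addrC -scaleN1r lT mulN1r addrC.
  have hT := @cvg_comp _ _ _ _ T _ _ _ hk (cT _).
  apply: cvg_trans hT; apply: near_eq_cvg; apply: nearW => t /=.
  by rewrite TZ TB.
have a0 k : (fun t : R => a k t) @ (0 : R)^' --> (0 : R).
  have : (fun t : R => t * (t^-1 * a k t)) @ (0 : R)^' --> 0 * al k.
    by apply: cvgM; [exact: nbhs_dnbhs|exact: adl].
  rewrite mul0r; apply: cvg_trans; apply: near_eq_cvg; near=> t.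
  have t0 : t != 0 by near: t; exact: nbhs_dnbhs_neq.
  by rewrite mulrA divff// mul1r.
have phiE t : phi (x + t *: v) = phi x + \sum_k a k t *: Cbasis k.
  have := Ccoord_sum (phi (x + t *: v) - phi x) => /esym hs.
  rewrite -[LHS](subrKC (phi x)) -hs; congr (_ + _); apply: eq_bigr => k _.
  by rewrite Ccoord_sub.
pose S := \sum_k `|al k|.
have S0 : 0 <= S by apply: sumr_ge0.
have aS : (fun t : R => \sum_k `|t^-1 * a k t|) @ (0 : R)^' --> S.
  by apply: (@normed_cvg_sum R^o) => k; apply: cvg_norm; exact: adl.
have lin : (fun t : R => \sum_k (t^-1 * a k t) *: 'D_(Cbasis k) h (phi x)) @ (0 : R)^' -->
   \sum_k al k *: 'D_(Cbasis k) h (phi x).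
  by apply: normed_cvg_sum => k; apply: cvgZr_tmp; exact: adl.
apply: (cvg_sub0 _ lin); apply/norm_cvg0P/cvgrPdist_le => e e0.
have [d d0 dP] := @expansion _ _ _ (index_enum _) (@Cbasis n) h (phi x) hd hc (e / (S + 1)) ltac:(by rewrite divr_gt0// ltr_wpDl).
have nS : \forall t \near (0 : R)^', `|S - \sum_k `|t^-1 * a k t| | < 1 by exact: (@cvgr_dist_lt _ R^o).
near=> t.
have t0 : t != 0 by near: t; exact: nbhs_dnbhs_neq.
have ad k : `|a k t| <= d.
  move: k; near: t; apply: filter_forall => k.
  have nk : \forall t \near (0 : R)^', `|0 - a k t| < d by exact: (@cvgr_dist_lt _ R^o).
  apply: filterS nk => t.
  by rewrite sub0r normrN => /ltW.
have aS1 : \sum_k `|t^-1 * a k t| <= S + 1.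
  near: t; apply: filterS nS => t.
  by rewrite ltr_distlC => /andP[_ /ltW].
have := dP (fun k => a k t) ad; rewrite -phiE => H.
rewrite sub0r normrN normr_id /=.
rewrite [X in `|X|](_ : _ =
  t^-1 *: (h (phi (x + t *: v)) - h (phi x) - \sum_k a k t *: 'D_(Cbasis k) h (phi x))); last first.
  rewrite -[LHS]/(t^-1 *: (h (phi (x + t *: v)) - h (phi x))
    - \sum_k (t^-1 * a k t) *: 'D_(Cbasis k) h (phi x)).
  rewrite [RHS]scalerBr; congr (_ - _); rewrite scaler_sumr; apply: eq_bigr => k _.
  by rewrite scalerA.
have S1 : 0 < S + 1 by rewrite ltr_wpDl.
have eS0 : 0 <= e / (S + 1) by rewrite divr_ge0// ltW.
rewrite normrZ; apply: (@le_trans _ _ (e / (S + 1) * \sum_k `|t^-1 * a k t|)).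
  apply: le_trans (ler_wpM2l (normr_ge0 _) H) _.
  rewrite mulrCA; apply: ler_wpM2l => //; rewrite mulr_sumr.
  by apply: ler_sum => k _; rewrite normrM.
apply: (@le_trans _ _ (e / (S + 1) * (S + 1))); last by rewrite mulfVK// gt_eqF.
by rewrite ler_wpM2l.
Unshelve. all: by end_near. Qed.

Definition part_complex (b : bool) (z : Z) : Z :=
  ((if b then complex.Im z else complex.Re z)%:C : Z).

Lemma smooth_in_part (V : normedModType R) (D : set V) (b : bool) (f : V -> Z) : open D ->
  smooth_in D f -> smooth_in D (fun x => part_complex b (f x)).
Proof.
move=> oD; apply: smooth_in_post => //.
  move=> z; rewrite /part_complex; case: b.
    exact: (@cvg_comp _ _ _ (@complex.Im R : Z -> R) (fun x : R => x%:C : Z) _ _ _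
      (Im_continuous (x := z)) (@real_complex_continuous (complex.Im z))).
  exact: (@cvg_comp _ _ _ (@complex.Re R : Z -> R) (fun x : R => x%:C : Z) _ _ _
      (Re_continuous (x := z)) (@real_complex_continuous (complex.Re z))).
move=> a u v; rewrite /part_complex.
by case: b; rewrite ?Im_linear ?Re_linear rmorphD rmorphM.
Qed.

(** The coefficients [a] do not depend on the functions [f j]: each derivative
    of a section in one chart and trivialization is bounded, uniformly over all
    sections, by finitely many derivatives in another chart and trivialization. *)
Lemma smooth_chain (V : normedModType R) n (D : set V) (D' : set (Cn R n)) (phi : V -> Cn R n) :
  open D -> open D' -> D `<=` phi @^-1` D' ->
  (forall j, smooth_in D ((fun y => (phi y : 'rV[R[i]]_n) 0 j) : V -> Z)) ->
  forall (J : finType) (vs : seq V) (a0 : J -> V -> Z), (forall j, smooth_in D (a0 j)) ->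
  exists (I : finType) (a : I -> V -> Z) (ws : I -> seq ('I_n * bool)) (jj : I -> J),
   (forall i, smooth_in D (a i)) /\
   forall f : J -> Cn R n -> Z, (forall j, smooth_in D' (f j)) -> forall x, D x ->
     iter_derive vs (fun y => \sum_j ((a0 j y : R[i]) * f j (phi y) : Z)) x =
     \sum_i ((a i x : R[i]) * iter_derive (map (@Cbasis n) (ws i)) (f (jj i)) (phi x) : Z).
Proof.
move=> oD oD' DD phis J vs a0 sa0; elim: vs => [|v vs [I [a [ws [jj [sa IH]]]]]].
  by exists J, a0, (fun=> [::]), id; split=> // f sf x Dx.
pose phij j : V -> Z := fun y => (phi y : 'rV[R[i]]_n) 0 j.
(* Differentiating a term a * (D f o phi) yields one term where a is
   differentiated, and, by the chain rule, one term for each real coordinate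
   direction of the target. *)
exists (I + I * ('I_n * bool))%type,
  (fun p => match p with inl i => 'D_v (a i)
    | inr (i, k) => fun y => (a i y : R[i]) * part_complex k.2 ('D_v (phij k.1) y) end),
  (fun p => match p with inl i => ws i | inr (i, k) => k :: ws i end),
  (fun p => match p with inl i => jj i | inr (i, k) => jj i end).
split.
  case=> [i|[i k]]; first exact: (smooth_in_derive v (sa i)).
  exact: (smooth_inM oD (sa i) (smooth_in_part k.2 oD (smooth_in_derive v (phis k.1)))).
move=> f sf x Dx.
pose h i := iter_derive (map (@Cbasis n) (ws i)) (f (jj i)).
rewrite big_sumType /=.
have -> : \sum_(p : I * ('I_n * bool)) ((match inr p with inl i => 'D_v (a i)
    | inr (i, k) => fun y => (a i y : R[i]) * part_complex k.2 ('D_v (phij k.1) y) end x : R[i]) *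
     iter_derive (map (@Cbasis n) (match inr p with inl i => ws i | inr (i, k) => k :: ws i end))
      (f (match inr p with inl i => jj i | inr (i, k) => jj i end)) (phi x) : Z)
  = \sum_i \sum_k ((a i x : R[i]) * part_complex k.2 ('D_v (phij k.1) x) * 'D_(Cbasis k) (h i) (phi x) : Z).
  by rewrite pair_bigA /=; apply: eq_bigr => -[i k] _.
rewrite -big_split /=.
apply: dlim_derive.
apply: (@dlim_near _ _ _ (fun y => \sum_i ((a i y : R[i]) * h i (phi y) : Z))).
  by apply: filterS (open_nbhs_nbhs (conj oD Dx)) => y Dy; rewrite -[RHS]/(iter_derive vs _ y) IH.
apply: (@dlim_sum _ V Z) => i.
have sh : smooth_in D' (h i) := smooth_in_iter _ (sf (jj i)).
have nD' : nbhs (phi x) D' by apply: open_nbhs_nbhs; split => //; exact: DD.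
have := @chain_rule V n Z phi (h i) x v (fun j => 'D_v (phij j) x).
move=> /(_ (fun j => @smooth_in_dlim _ _ _ _ _ _ v (phis j) Dx)).
have c1 k : \forall q \near phi x, dlim (h i) q (Cbasis k) ('D_(Cbasis k) (h i) q).
  by apply: filterS nD' => q Dq; exact: (smooth_in_dlim sh Dq).
have c2 k : 'D_(Cbasis k) (h i) @ nbhs (phi x) --> 'D_(Cbasis k) (h i) (phi x).
  exact: (smooth_in_cont (smooth_in_derive (Cbasis k) sh) (DD _ Dx)).
move=> /(_ c1 c2) hch.
have := dlimM (@smooth_in_dlim _ _ _ _ _ x v (sa i) Dx) hch.
congr (dlim _ _ _ _); congr (_ + _).
rewrite [LHS]mulr_sumr; apply: eq_bigr => k _.
by rewrite mulrA.
Qed.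

End ChainRule.

(** * The maximum principle and the Schwarz lemma in one variable *)

Section ClosedBalls.
Variable R : realType.
Local Notation Z := (realify R R[i]).

Lemma closed_norm_le (V : normedModType R) (p : V) (r : R) : closed [set x : V | `|x - p| <= r].
Proof.
apply: (@closed_comp _ _ (fun x : V => `|x - p|) [set t : R | t <= r]); last exact: closed_le.
move=> x _; apply: cvg_norm; apply: cvgB; [exact: cvg_id|exact: cvg_cst].
Qed.

Lemma realify_ball_compact (p : Z) (r : R) : compact [set z : Z | `|z - p| <= r].
Proof.
pose f (ab : R * R) : Z := p + (ab.1 *: (1 : Z) + ab.2 *: ('i%C : Z)).
apply: (@subclosed_compact _ _ (f @` (`[-r, r]%classic `*` `[-r, r]%classic))).
- exact: closed_norm_le.
- apply: continuous_compact; last by apply: compact_setX; exact: segment_compact.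
  apply: continuous_subspaceT => ab; apply: (@tvs_cvgD _ Z); first exact: cvg_cst.
  by apply: (@tvs_cvgD _ Z); apply: (@tvs_cvgZ _ Z);
    rewrite ?/cvg_to; try exact: cvg_cst; [exact: cvg_fst|exact: cvg_snd].
- move=> z /= zr.
  have h1 := le_trans (realify_ge_Re (z - p : Z)) zr.
  have h2 := le_trans (realify_ge_Im (z - p : Z)) zr.
  exists (complex.Re (z - p : Z), complex.Im (z - p : Z)) => /=.
    by split; rewrite /= in_itv /= -ler_norml.
  rewrite /f /=.
  rewrite -[RHS](subrKC p); congr (_ + _).
  move: (z - p) => {h1 h2 zr} {}z.
  rewrite -[LHS]/((complex.Re z)%:C * 1 + (complex.Im z)%:C * 'i%C : R[i]).
  by rewrite mulr1 mulrC -complexE.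
Qed.

Lemma mx_norm_coord (K : numFieldType) m n (x : 'M[K]_(m, n)) i j : `|x i j| <= `|x|.
Proof.
rewrite [leRHS]mx_normE -[leLHS]nngE num_le.
exact: (le_bigmax _ (fun ij => `|x ij.1 ij.2|%:nng) (i, j)).
Qed.

Lemma Cn_coord_le n (x : Cn R n) (j : 'I_n) : `|((x : 'rV[R[i]]_n) 0 j : Z)| <= `|x|.
Proof.
rewrite -lecR -[`|(_ : Z)|]/(realify_norm (_ : Z)) -[`|x|]/(realify_norm x) !realify_normE.
exact: (@mx_norm_coord _ _ _ (x : 'rV[R[i]]_n) 0 j).
Qed.

Lemma Ccoord_le n (x : Cn R n) k : `|Ccoord k x| <= `|x|.
Proof.
apply: le_trans (Cn_coord_le x k.1); rewrite /Ccoord; case: k.2.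
  exact: realify_ge_Im.
exact: realify_ge_Re.
Qed.

(** The ball is a closed subset of the image of a cube under the real
    coordinates. *)
Lemma Cn_ball_compact n (p : Cn R n) (r : R) : compact [set z : Cn R n | `|z - p| <= r].
Proof.
pose m := #|{: 'I_n * bool}|.
pose f (a : 'rV[R]_m) : Cn R n := p + \sum_k a 0 (enum_rank k) *: Cbasis R k.
pose K := [set v : 'rV[R]_m | forall i : 'I_m, `[-r, r]%classic (v ord0 i)].
have cK : compact K := @rV_compact R m (fun=> `[-r, r]%classic) (fun=> @segment_compact R (- r) r).
apply: (@subclosed_compact _ _ (f @` K)).
- exact: closed_norm_le.
- apply: continuous_compact cK; apply: continuous_subspaceT => a; rewrite /f /continuous_at.
  have FF : Filter (nbhs a) := nbhs_filter a.
  apply: (@tvs_cvgD R (Cn R n)); first exact: cvg_cst.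
  apply: (@normed_cvg_sum R (Cn R n)) => k; apply: (@tvs_cvgZ R (Cn R n)); last exact: cvg_cst.
  exact: (@coord_continuous R).
- move=> z /= zr.
  exists (\row_i Ccoord (enum_val i) (z - p)).
    move=> i; rewrite /= mxE in_itv /= -ler_norml.
    exact: le_trans (Ccoord_le _ _) zr.
  rewrite /f -[RHS](subrKC p) [in RHS](Ccoord_sum (z - p)); congr (_ + _).
  by apply: eq_bigr => k _; rewrite mxE enum_rankK.
Qed.

End ClosedBalls.

Section OneVariable.
Variable R : realType.
Local Notation Z := (realify R R[i]).
Implicit Types F G : Z -> Z.

(** Complex differentiability in one variable, tested along real lines. *)
Definition cdlim F (z d : Z) := forall v : Z, dlim F z v ((v : R[i]) * d : Z).

Lemma cdlimM F G (z a b : Z) : cdlim F z a -> cdlim G z b ->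
  cdlim ((fun w => (F w : R[i]) * G w) : Z -> Z) z ((a : R[i]) * G z + (F z : R[i]) * b : Z).
Proof.
move=> Fa Gb v; have := dlimM (Fa v) (Gb v); congr (dlim _ _ _ _).
rewrite -[LHS]/((v : R[i]) * a * G z + (F z : R[i]) * ((v : R[i]) * b)).
rewrite -[RHS]/((v : R[i]) * ((a : R[i]) * G z + (F z : R[i]) * b)).
by ring.
Qed.

Lemma cdlimD F G (z a b : Z) : cdlim F z a -> cdlim G z b ->
  cdlim (fun w => F w + G w) z (a + b).
Proof.
move=> Fa Gb v; have := dlimD (Fa v) (Gb v); congr (dlim _ _ _ _).
by rewrite -[RHS]/((v : R[i]) * ((a : R[i]) + (b : R[i]))) mulrDr.
Qed.

Lemma cdlim_cst (c z : Z) : cdlim (fun=> c) z 0.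
Proof. by move=> v; rewrite -[X in dlim _ _ _ X]/((v : R[i]) * 0) mulr0; exact: dlim_cst. Qed.

Lemma cdlim_id (z : Z) : cdlim id z (1 : R[i]).
Proof.
move=> v; rewrite mulr1 /dlim.
apply: (@cvg_trans _ ((fun=> v) @ (0 : R)^')); last exact: cvg_cst.
apply: near_eq_cvg; near=> t.
have t0 : t != 0 by near: t; exact: nbhs_dnbhs_neq.
by rewrite (addrC z) addrK scalerA mulVf// scale1r.
Unshelve. all: by end_near. Qed.

Lemma cdlim_inv (z : Z) : z != 0 ->
  cdlim ((fun w => (w : R[i])^-1) : Z -> Z) z (- ((z : R[i])^-1 * (z : R[i])^-1) : R[i]).
Proof.
move=> z0 v; have := @realify_inv_quotient R z v z0; rewrite /dlim.
suff -> : (- ((z : R[i])^-1 * (z : R[i])^-1 * (v : R[i])) : R[i]) = (v : R[i]) * (- ((z : R[i])^-1 * (z : R[i])^-1)) by [].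
by rewrite mulrN [in RHS]mulrC.
Qed.

(** This is all that the second derivative test at a maximum requires. *)
Definition cdiff2 F (z : Z) := exists (F1 : Z -> Z) (c : Z),
  (\forall w \near z, cdlim F w (F1 w)) /\ cdlim F1 z c.

Lemma cdiff2M F G z : cdiff2 F z -> cdiff2 G z ->
  cdiff2 ((fun w => (F w : R[i]) * G w) : Z -> Z) z.
Proof.
move=> [F1 [c [nF cF]]] [G1 [d [nG cG]]].
exists ((fun w => (F1 w : R[i]) * G w + (F w : R[i]) * G1 w) : Z -> Z); eexists; split.
  by apply: filterS2 nF nG => w; exact: cdlimM.
have F0 := nbhs_singleton nF; have G0 := nbhs_singleton nG.
exact: (cdlimD (cdlimM cF G0) (cdlimM F0 cG)).
Qed.

Lemma cdiff2_cst (c z : Z) : cdiff2 (fun=> c) z.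
Proof.
exists (fun=> 0), 0; split; last exact: cdlim_cst.
exact: (@filterE _ (nbhs z) _ _ (fun w => cdlim_cst c w)).
Qed.

Lemma cdiff2_inv (z : Z) : z != 0 -> cdiff2 ((fun w => (w : R[i])^-1) : Z -> Z) z.
Proof.
move=> z0; pose inv : Z -> Z := fun w => (w : R[i])^-1.
exists ((fun w => (-1) * ((w : R[i])^-1 * (w : R[i])^-1)) : Z -> Z); eexists; split.
  apply: filterS (open_nbhs_nbhs (conj (@open_neq0 R) z0)) => w w0.
  have := cdlim_inv w0; congr (cdlim _ _ _).
  by rewrite mulN1r.
exact: (cdlimM (cdlim_cst (-1 : R[i]) z) (cdlimM (cdlim_inv z0) (cdlim_inv z0))).
Qed.

Lemma cdiff2X F z N : cdiff2 F z -> cdiff2 ((fun w => (F w : R[i]) ^+ N) : Z -> Z) z.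
Proof.
move=> F2; elim: N => [|N IH]; first exact: cdiff2_cst.
have := cdiff2M F2 IH; congr (cdiff2 _ _).
by apply/funext => w; rewrite exprS.
Qed.

Definition normsq (z : R[i]) : R := complex.Re z ^+ 2 + complex.Im z ^+ 2.

Lemma normsqE (z : R[i]) : `|(z : Z)| ^+ 2 = normsq z.
Proof.
apply: complexI; rewrite rmorphXn /= -[`|(z : Z)|]/(realify_norm (z : Z)) realify_normE.
rewrite normc_def -rmorphXn /= sqr_sqrtr// /normsq.
by rewrite addr_ge0 ?sqr_ge0.
Qed.

(** Subtract the Taylor polynomial: the derivative of the difference is [o(s)]
    along the segment, so the mean value inequality bounds the difference by
    [o(t^2)]. *)
Lemma taylor2 F (F1 : Z -> Z) (z h : Z) (v : Z) (e : R) : 0 < e -> `|v| = 1 ->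
  (\forall w \near z, cdlim F w (F1 w)) -> cdlim F1 z (h + h) ->
  exists2 d : R, 0 < d & forall t : R, 0 < t -> t < d ->
   `|F (z + t *: v) - (F z + (((t *: v : Z) : R[i]) * F1 z : Z)
      + ((t *: v : Z) : R[i]) ^+ 2 * h : Z)| <= t * (t * e).
Proof.
move=> e0 v1 nF; set c := h + h => cF.
have h1 : \forall t \near (0 : R)^', `|((v : R[i]) * c : Z) - t^-1 *: (F1 (z + t *: v) - F1 z)| < e.
  exact: (@cvgr_dist_lt _ Z _ _ _ _ _ (cF v) _ e0).
have h2 : \forall t \near (0 : R), forall v', dlim F (z + t *: v) v' ((v' : R[i]) * F1 (z + t *: v)).
  exact: (@tvs_cvg_line _ Z z v _ nF).
move: h1 => [/= d1 d10 dP1]; move: h2 => [/= d2 d20 dP2].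
exists (Num.min d1 d2); first by rewrite lt_min d10.
move=> t t0; rewrite lt_min => /andP[td1 td2].
pose G (w : Z) : Z := F w + ((-1) * (F z + ((w : R[i]) - z) * F1 z + ((w : R[i]) - z) * ((w : R[i]) - z) * h) : R[i]).
pose dG (w : Z) : Z := F1 w + ((-1) * ((F1 z : R[i]) + ((w : R[i]) - z) * c) : R[i]).
have cG w : cdlim F w (F1 w) -> cdlim G w (dG w).
  move=> Fw; apply: cdlimD => //.
  have c1 : cdlim ((fun w : Z => (w : R[i]) - z) : Z -> Z) w (1 : R[i]).
    have := cdlimD (cdlim_id w) (cdlim_cst (- z) w); congr (cdlim _ _ _).
    by rewrite addr0.
  have := cdlimM (cdlim_cst (-1 : R[i]) w) (cdlimD (cdlimD (cdlim_cst (F z) w) (cdlimM c1 (cdlim_cst (F1 z) w)))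
     (cdlimM (cdlimM c1 c1) (cdlim_cst h w))).
  congr (cdlim _ _ _).
  rewrite -[LHS]/(0 * _ + (-1) * (0 + (1 * (F1 z : R[i]) + ((w : R[i]) - z) * 0) +
     ((1 * ((w : R[i]) - z) + ((w : R[i]) - z) * 1) * h + ((w : R[i]) - z) * ((w : R[i]) - z) * 0))).
  rewrite -[RHS]/((-1) * ((F1 z : R[i]) + ((w : R[i]) - z) * ((h : R[i]) + h))).
  by ring.
have in1 s : 0 <= s -> s <= 1 -> `|s * t| < d1.
  by move=> s0 s1; rewrite ger0_norm ?mulr_ge0// ?(ltW t0)//; apply: le_lt_trans td1; rewrite ler_piMl// ltW.
have in2 s : 0 <= s -> s <= 1 -> `|s * t| < d2.
  by move=> s0 s1; rewrite ger0_norm ?mulr_ge0// ?(ltW t0)//; apply: le_lt_trans td2; rewrite ler_piMl// ltW.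
have := @mean_value_segment R Z Z G (fun s => ((v : R[i]) * dG (z + (s * t) *: v) : Z)) z v t 0 (t * e).
have A1 s : 0 <= s -> s <= 1 -> dlim G (z + (s * t) *: v) v ((v : R[i]) * dG (z + (s * t) *: v) : Z).
  move=> s0 s1; apply: cG => v'; apply: dP2 => /=.
  by rewrite sub0r normrN; exact: in2.
move=> /(_ A1) H.
have dGE s : dG (z + s *: v) = F1 (z + s *: v) - F1 z - s *: ((v : R[i]) * c : Z).
  rewrite /dG -[LHS]/((F1 (z + s *: v) : R[i]) + (-1) * ((F1 z : R[i]) + (((z : R[i]) + s%:C * (v : R[i])) - z) * c)).
  rewrite -[RHS]/((F1 (z + s *: v) : R[i]) - (F1 z : R[i]) - s%:C * ((v : R[i]) * c)).
  by ring.
have G0 : G z = 0.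
  rewrite /G -[LHS]/((F z : R[i]) + (-1) * ((F z : R[i]) + ((z : R[i]) - z) * F1 z + ((z : R[i]) - z) * ((z : R[i]) - z) * h)).
  by rewrite subrr !mul0r !addr0 mulN1r subrr.
rewrite scaler0 subr0 G0 subr0 [`|t|]gtr0_norm// in H.
have -> : F (z + t *: v) - (F z + (((t *: v : Z) : R[i]) * F1 z : Z)
      + ((t *: v : Z) : R[i]) ^+ 2 * h : Z) = G (z + t *: v).
  rewrite /G.
  rewrite -[LHS]/((F (z + t *: v) : R[i]) - ((F z : R[i]) + (t%:C * (v : R[i])) * F1 z + (t%:C * (v : R[i])) ^+ 2 * h)).
  rewrite -[RHS]/((F (z + t *: v) : R[i]) + (-1) * ((F z : R[i]) + (((z : R[i]) + t%:C * (v : R[i])) - z) * F1 z + (((z : R[i]) + t%:C * (v : R[i])) - z) * (((z : R[i]) + t%:C * (v : R[i])) - z) * h)).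
  by ring.
apply: H => s s0 s1; rewrite subr0 realify_normM v1 mul1r dGE.
have [->|sn0] := eqVneq (s * t) 0.
  by rewrite !scale0r addr0 subrr subr0 normr0 mulr_ge0// ltW.
have := dP1 (s * t); rewrite /= sub0r normrN => /(_ (in1 s s0 s1) sn0) /ltW hq.
have -> : F1 (z + (s * t) *: v) - F1 z - (s * t) *: ((v : R[i]) * c : Z) =
   (- (s * t)) *: (((v : R[i]) * c : Z) - (s * t)^-1 *: (F1 (z + (s * t) *: v) - F1 z)).
  by rewrite scaleNr scalerBr scalerA divff// scale1r opprB.
rewrite normrZ normrN; apply: ler_pM => //.
by rewrite ger0_norm ?mulr_ge0// ?(ltW t0)// ler_piMl// ltW.
Qed.

(** The mean over the fourth roots of unity of the squared modulus of a
    polynomial of degree two is the sum of the squared moduli of its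
    coefficients. This replaces a mean over a circle. *)
Lemma parseval4 (A B C : R[i]) (v : bool * bool -> R[i]) :
  (forall b, v b = (if b.1 then 1 else -1) * (if b.2 then 1 else 'i%C)) ->
  \sum_b normsq (A + v b * B + v b ^+ 2 * C) = (normsq A + normsq B + normsq C) *+ 4.
Proof.
move=> vE.
have E (p q : bool * bool -> R) : p =1 q -> \sum_b p b = q (true, true) + q (true, false) + (q (false, true) + q (false, false)).
  move=> pq; rewrite (eq_bigr q)// (eq_bigr (fun b => q (b.1, b.2))); last by case.
  by rewrite -(pair_bigA _ (fun x y => q (x, y))) /= big_bool /= !big_bool.
rewrite (E _ _ (fun b => erefl)) !vE /=.
case: A => a1 a2; case: B => b1 b2; case: C => c1 c2.
rewrite /normsq /=; simpc => /=.
ring.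
Qed.

(** [|F|^2 + e |z|^2] is strictly subharmonic: by [parseval4], its mean over the
    four points at distance [t] from [z] exceeds its value at [z] by at least [e
    t^2 - o(t^2)]. *)
Lemma no_interior_max F (z : Z) (e : R) : 0 < e -> cdiff2 F z ->
  (\forall w \near z, `|F w| ^+ 2 + e * `|w| ^+ 2 <= `|F z| ^+ 2 + e * `|z| ^+ 2) -> False.
Proof.
move=> e0 [F1 [c [nF cF]]] nmax.
pose h : Z := (c : R[i]) / 2.
have ch : c = h + h by rewrite -[RHS]/((c : R[i]) / 2 + (c : R[i]) / 2) -splitr.
rewrite ch in cF.
pose v (b : bool * bool) : R[i] := (if b.1 then 1 else -1) * (if b.2 then 1 else 'i%C).
have v1 b : `|(v b : Z)| = 1.
  rewrite /v realify_normM; have -> : `|((if b.1 then 1 else -1) : R[i]) : Z| = 1.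
    by case: b.1; rewrite ?(@normrN _ Z) realify_norm1.
  by rewrite mul1r; case: b.2; rewrite ?realify_norm1 ?realify_normi.
pose K := `|F z| + `|F1 z| + `|h| + 1.
have K0 : 1 <= K by rewrite /K lerDr !addr_ge0.
(* The Taylor error t^2 q changes each square by at most t^2 q (2 K - 1), which
   this q makes smaller than e t^2. *)
pose q := e / (2 * K + 2).
have K2 : 0 < 2 * K + 2 by lra.
have q0 : 0 < q by rewrite divr_gt0.
have qE : q * (2 * K + 2) = e by rewrite mulfVK// gt_eqF.
have T b := @taylor2 F F1 z h (v b : Z) q q0 (v1 b) nF cF.
have nz : \forall t \near (0 : R), forall b, (0 < t ->
   `|F (z + t *: (v b : Z)) - (F z + (((t *: (v b : Z) : Z) : R[i]) * F1 z : Z)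
      + ((t *: (v b : Z) : Z) : R[i]) ^+ 2 * h : Z)| <= t * (t * q))
   /\ `|F (z + t *: (v b : Z))| ^+ 2 + e * `|z + t *: (v b : Z)| ^+ 2 <= `|F z| ^+ 2 + e * `|z| ^+ 2.
  apply: (@filter_forall _ (bool * bool)%type _ (nbhs (0 : R)) (nbhs_filter _)) => b; have [d d0 dT] := T b.
  have n2 : \forall t \near (0 : R), `|F (z + t *: (v b : Z))| ^+ 2 + e * `|z + t *: (v b : Z)| ^+ 2 <= `|F z| ^+ 2 + e * `|z| ^+ 2.
    exact: (@tvs_cvg_line _ Z z (v b) _ nmax).
  have nd : \forall t \near (0 : R), `|t| < d.
    by exists d => // t /=; rewrite sub0r normrN.
  apply: filterS2 n2 nd => t h1 h2; split=> // t0; apply: dT => //.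
  by rewrite -(gtr0_norm t0).
move: nz => [/= r r0 rP].
pose t := Num.min (r / 2) 1.
have t0 : 0 < t by rewrite lt_min divr_gt0/=.
have t1 : t <= 1 by rewrite ge_min lexx orbT.
have tr : `|0 - t| < r.
  by rewrite sub0r normrN gtr0_norm// gt_min; apply/orP; left; lra.
have {rP}P b := rP t tr b.
pose A : R[i] := F z; pose B : R[i] := t%:C * (F1 z : R[i]); pose C : R[i] := (t%:C) ^+ 2 * (h : R[i]).
pose m b : R[i] := A + v b * B + v b ^+ 2 * C.
have tq0 : 0 <= t * (t * q) by apply: mulr_ge0; [|apply: mulr_ge0]; exact: ltW.
have dist b : `|F (z + t *: (v b : Z)) - (m b : Z)| <= t * (t * q).
  have [/(_ t0) h1 _] := P b; apply: le_trans h1; rewrite le_eqVlt; apply/orP; left; apply/eqP.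
  congr (`|_|); congr (_ - _).
  rewrite -[RHS]/((F z : R[i]) + t%:C * v b * (F1 z : R[i]) + (t%:C * v b) ^+ 2 * (h : R[i])).
  by rewrite /m /A /B /C; ring.
have tC : `|(t%:C : Z)| = t.
  apply: complexI; rewrite -[`|_ : Z|]/(realify_norm _) realify_normE.
  by rewrite normc_def /= expr0n addr0 sqrtr_sqr gtr0_norm.
have tt1 : t * t <= 1 by rewrite mulr_ile1// ltW.
have mK b : `|(m b : Z)| <= K - 1.
  have mv : `|(v b ^+ 2 * C : R[i]) : Z| <= `|h|.
    rewrite realify_normM expr2 realify_normM !v1 !mul1r /C expr2 !realify_normM !tC.
    by rewrite ler_piMl.
  have mb : `|(v b * B : R[i]) : Z| <= `|F1 z|.
    by rewrite realify_normM v1 mul1r /B realify_normM tC ler_piMl.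
  apply: (le_trans (ler_normD ((A + v b * B : R[i]) : Z) ((v b ^+ 2 * C : R[i]) : Z))).
  apply: (le_trans (lerD (ler_normD (A : Z) ((v b * B : R[i]) : Z)) mv)).
  by rewrite /K addrK; apply: lerD => //; apply: lerD.
have sqb b : `|(m b : Z)| ^+ 2 <= `|F (z + t *: (v b : Z))| ^+ 2 + t * (t * q) * (2 * K - 1).
  have h1 := dist b; have h2 := mK b.
  have h3 : `|(m b : Z)| <= `|F (z + t *: (v b : Z))| + t * (t * q).
    have -> : (m b : Z) = F (z + t *: (v b : Z)) - (F (z + t *: (v b : Z)) - (m b : Z)) by rewrite subKr.
    by apply: le_trans (ler_normB _ _) _; rewrite lerD2l.
  move: (`|(m b : Z)|) (`|F (z + t *: (v b : Z))|) (normr_ge0 (m b : Z)) (normr_ge0 (F (z + t *: (v b : Z)))) h2 h3.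
  move=> x y x0 y0 xK xy.
  have [xly|yx] := leP x y.
    have := tq0; nra.
  nra.
have S1 := @parseval4 A B C v (fun b => erefl).
have S2 := @parseval4 (z : R[i]) t%:C 0 v (fun b => erefl).
have sum1 : \sum_b `|(m b : Z)| ^+ 2 = (normsq A + normsq B + normsq C) *+ 4.
  by rewrite -S1; apply: eq_bigr => b _; rewrite normsqE.
have sum2 : \sum_b `|z + t *: (v b : Z)| ^+ 2 = (`|z| ^+ 2 + t ^+ 2) *+ 4.
  rewrite (normsqE z) -[t in t ^+ 2]tC normsqE.
  rewrite -[X in (_ + X) *+ 4]addr0 addrA -[X in _ + X](_ : normsq 0 = 0); last by rewrite /normsq /= expr0n addr0.
  rewrite -S2; apply: eq_bigr => b _; rewrite normsqE mulr0 addr0.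
  by rewrite -[z + _]/((z : R[i]) + t%:C * v b) mulrC.
have A2 : normsq A = `|F z| ^+ 2 by rewrite normsqE.
have c4 : #|{: bool * bool}| = 4%N by rewrite card_prod card_bool.
have L2 : \sum_b `|F (z + t *: (v b : Z))| ^+ 2 + e * \sum_b `|z + t *: (v b : Z)| ^+ 2 <=
   (`|F z| ^+ 2 + e * `|z| ^+ 2) *+ 4.
  rewrite mulr_sumr -big_split /= -c4 -sumr_const.
  by apply: ler_sum => b _; have [] := P b.
have L1 : \sum_b `|(m b : Z)| ^+ 2 <= \sum_b `|F (z + t *: (v b : Z))| ^+ 2 + (t * (t * q) * (2 * K - 1)) *+ 4.
  by rewrite -c4 -sumr_const -big_split /=; apply: ler_sum => b _; exact: sqb.
rewrite sum1 A2 in L1; rewrite sum2 in L2.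
have nB : 0 <= normsq B by rewrite addr_ge0 ?sqr_ge0.
have nC : 0 <= normsq C by rewrite addr_ge0 ?sqr_ge0.
move: L1 L2; move: (\sum_(b : bool * bool) `|F (z + t *: (v b : Z))| ^+ 2) => S.
move: (normsq B) (normsq C) nB nC (`|F z| ^+ 2) (`|z| ^+ 2) => nb nc nb0 nc0 f2 z2 u1 u2.
have u3 : 4 * (e * t ^+ 2) <= 4 * (t * (t * q) * (2 * K - 1)).
  clear - u1 u2 nb0 nc0; nra.
have u4 : t * (t * q) * (2 * K - 1) = t ^+ 2 * (q * (2 * K + 2) - 3 * q) by ring.
rewrite u4 qE in u3.
have : 0 < t ^+ 2 * q by rewrite mulr_gt0// exprn_gt0.
clear - u3; nra.
Qed.

(** The quotient [g = F / z^N] extends continuously by [0] at the origin. By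
    [no_interior_max], the function [|g|^2 + e |z|^2] attains its maximum over
    the disc at the origin, where it vanishes, or on the unit circle, where it
    is at most [M^2 + e]; let [e] tend to [0]. *)
Lemma schwarz_power F (N : nat) (M : R) : 0 <= M ->
  (forall z : Z, `|z| <= 1 -> F @ nbhs z --> F z) ->
  (forall z : Z, 0 < `|z| < 1 -> cdiff2 F z) ->
  (forall z : Z, `|z| = 1 -> `|F z| <= M) ->
  (exists C d : R, 0 < d /\ forall z : Z, `|z| < d -> `|F z| <= C * `|z| ^+ N.+1) ->
  forall z : Z, `|z| <= 1 -> `|F z| <= M * `|z| ^+ N.
Proof.
move=> M0 cF dF bF [C [d [d0 Fd]]].
pose g (z : Z) : Z := (F z : R[i]) * ((z : R[i])^-1) ^+ N.
have F0 : F 0 = 0.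
  by apply/eqP; rewrite -normr_le0; have := Fd 0; rewrite normr0 expr0n mulr0; apply.
have g0 : g 0 = 0 by rewrite /g F0 mul0r.
have gn (z : Z) : z != 0 -> `|F z| = `|g z| * `|z| ^+ N.
  move=> z0.
  have E m : `|(((z : R[i])^-1) ^+ m : Z)| = (`|z| ^+ m)^-1.
    elim: m => [|m IH]; first by rewrite !expr0 invr1 realify_norm1.
    by rewrite !exprS realify_normM IH realify_normV invfM.
  by rewrite /g realify_normM E mulfVK// expf_neq0// normr_eq0.
have cg (z : Z) : `|z| <= 1 -> g @ nbhs z --> g z.
  move=> z1; have [->|z0] := eqVneq z 0.
    rewrite g0; apply/norm_cvg0P.
    have H : (fun w : Z => `|C| * `|w|) @ nbhs (0 : Z) --> (0 : R).
      rewrite -[X in _ --> X](mulr0 `|C|); apply: cvgM; first exact: cvg_cst.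
      by rewrite -[X in _ --> X](@normr0 _ Z); apply: cvg_norm; exact: cvg_id.
    apply: squeeze_cvgr H; last exact: cvg_cst.
    have nd : \forall w \near (0 : Z), `|w| < d.
      by apply: filterS (nbhsx_ballx (0 : Z) d d0) => w; rewrite -ball_normE /= sub0r normrN.
    apply: filterS nd => w wd /=; rewrite normr_ge0 /=.
    have [->|w0] := eqVneq w 0; first by rewrite g0 normr0 mulr0.
    have wN : 0 < `|w| ^+ N by rewrite exprn_gt0// normr_gt0.
    rewrite -(ler_pM2r wN) -gn//; apply: le_trans (Fd w wd) _.
    rewrite exprS mulrA; apply: ler_wpM2r; first exact: ltW.
    by apply: ler_wpM2r => //; exact: ler_norm.
  rewrite /g; apply: realify_cvgM; first exact: cF.
  have E m : (fun w : Z => ((w : R[i])^-1) ^+ m : Z) @ nbhs z --> (((z : R[i])^-1) ^+ m : Z).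
    elim: m => [|m IH]; first exact: cvg_cst.
    rewrite exprS (_ : (fun w : Z => _) = (fun w : Z => ((w : R[i])^-1 : Z) * ((w : R[i])^-1) ^+ m : Z)).
      by apply: realify_cvgM => //; exact: realify_inv_continuous.
    by apply/funext => w; rewrite exprS.
  exact: E.
have dg (z : Z) : 0 < `|z| < 1 -> cdiff2 g z.
  move=> z01; apply: cdiff2M; first exact: dF.
  apply: (@cdiff2X ((fun w => (w : R[i])^-1) : Z -> Z)); apply: cdiff2_inv.
  by case/andP: z01; rewrite normr_gt0.
have key (e : R) : 0 < e -> forall z : Z, `|z| <= 1 -> `|g z| ^+ 2 <= M ^+ 2 + e.
  move=> e0.
  pose psi (z : Z) : R := `|g z| ^+ 2 + e * `|z| ^+ 2.
  have cK := @realify_ball_compact R 0 1.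
  have K0 : [set z : Z | `|z - 0| <= 1] !=set0 by exists 0; rewrite /= subr0 normr0.
  have cpsi : {within [set z : Z | `|z - 0| <= 1], continuous psi}.
    apply: continuous_in_subspaceT => z /set_mem /=; rewrite subr0 => z1.
    have FF : Filter (nbhs (z : Z)) := nbhs_filter _.
    suff : psi @ nbhs (z : Z) --> psi z by [].
    have sq (f : Z -> R) (l : R) : f @ nbhs (z : Z) --> l -> (fun w => f w ^+ 2) @ nbhs (z : Z) --> l ^+ 2.
      by move=> fl; rewrite expr2; under eq_fun do rewrite expr2; exact: cvgM.
    apply: cvgD; first by apply: sq; apply: cvg_norm; exact: cg.
    apply: cvgM; first exact: cvg_cst.
    by apply: sq; apply: cvg_norm; exact: cvg_id.
  have [c /set_mem /= cc cmax] := compact_EVT_max K0 cK cpsi.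
  rewrite subr0 in cc.
  have pm : psi c <= M ^+ 2 + e.
    have [c0|c0] := eqVneq c 0.
      by rewrite /psi c0 g0 !normr0 expr0n mulr0 addr0 addr_ge0 ?sqr_ge0// ltW.
    move: cc; rewrite le_eqVlt => /predU1P[c1|c1].
      rewrite /psi c1 expr1n mulr1 lerD2r.
      have := gn c c0; rewrite c1 expr1n mulr1 => <-.
      by rewrite ler_sqr ?nnegrE//; exact: bF.
    exfalso; apply: (@no_interior_max g c e e0).
      by apply: dg; rewrite normr_gt0 c0.
    have nd : \forall w \near c, `|w| < 1.
      have r0 : 0 < 1 - `|c| by rewrite subr_gt0.
      apply: filterS (nbhsx_ballx c _ r0) => w; rewrite -ball_normE /= => h.
      have -> : w = c - (c - w) by rewrite subKr.
      by apply: le_lt_trans (ler_normB _ _) _; rewrite -ltrBrDl.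
    apply: filterS nd => w w1; apply: cmax.
    by apply/mem_set; rewrite /= subr0 ltW.
  move=> z z1; apply: le_trans pm; apply: le_trans (cmax z _).
    by rewrite lerDl mulr_ge0 ?sqr_ge0// ltW.
  by apply/mem_set; rewrite /= subr0.
move=> z z1.
have [->|z0] := eqVneq z 0.
  by rewrite F0 normr0 mulr_ge0// exprn_ge0.
rewrite gn// ler_wpM2r ?exprn_ge0//.
rewrite -ler_sqr ?nnegrE//; apply/ler_addgt0Pr => e e0.
exact: key.
Qed.

End OneVariable.

(** * Restriction to complex lines *)

Section ComplexLines.
Variable R : realType.
Local Notation Z := (realify R R[i]).

Definition cline n (p w : Cn R n) (z : Z) : Cn R n := p + ((z : R[i]) *: (w : 'rV[R[i]]_n) : Cn R n).

Lemma Cn_normZ n (z : R[i]) (w : Cn R n) :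
  `|(z *: (w : 'rV[R[i]]_n) : Cn R n)| = `|(z : Z)| * `|w|.
Proof.
apply: complexI; rewrite rmorphM /=.
rewrite -[`|_ : Cn R n|]/(realify_norm _) -[`|w|]/(realify_norm w) -[`|(z : Z)|]/(realify_norm (z : Z)).
by rewrite !realify_normE normrZ.
Qed.

Lemma clineE n (p w : Cn R n) (z v : Z) (t : R) :
  cline p w (z + t *: v) = cline p w z + t *: ((v : R[i]) *: (w : 'rV[R[i]]_n) : Cn R n).
Proof.
rewrite /cline -addrA; congr (_ + _).
rewrite -[LHS]/((((z : R[i]) + t%:C * (v : R[i])) *: (w : 'rV[R[i]]_n))).
by rewrite scalerDl -scalerA.
Qed.

Lemma cline_continuous n (p w : Cn R n) : continuous (cline p w).
Proof.
apply: (@lipschitz_continuous _ _ _ _ `|w|) => // z y.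
have -> : cline p w z - cline p w y = (((z - y : Z) : R[i]) *: (w : 'rV[R[i]]_n) : Cn R n).
  rewrite /cline opprD addrACA subrr add0r.
  by rewrite -[RHS]/(((z : R[i]) - (y : R[i])) *: (w : 'rV[R[i]]_n)) scalerBl.
by rewrite Cn_normZ mulrC.
Qed.

Lemma holo_derive0 n (D : set (Cn R n)) (f : Cn R n -> Z) x : holo D f -> D x -> 'D_0 f x = 0.
Proof.
move=> [_ lf] Dx; have := lf x Dx 1 0 0; rewrite scaler0 addr0 mul1r.
move=> /(congr1 (fun u : R[i] => u - ('D_(0 : Cn R n) f x : R[i]))).
by rewrite subrr addrK => /esym.
Qed.

Section OneLine.
Variables (n : nat) (D : set (Cn R n)) (f : Cn R n -> Z) (p w : Cn R n).
Hypotheses (oD : open D) (hf : holo D f).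

(** The derivatives along [w] of [f] are the successive complex derivatives of
    the restriction of [f] to the complex line through [p] with direction [w]. *)
Definition on_line (k : nat) (z : Z) : Z := iter_derive (nseq k w) f (cline p w z).

Lemma on_line_cdlim k (z : Z) : D (cline p w z) -> cdlim (on_line k) z (on_line k.+1 z).
Proof.
move=> Dz v.
have hk : holo D (iter_derive (nseq k w) f) := holo_iter (nseq k w) oD hf.
have := @smooth_in_dlim _ _ _ _ _ _ ((v : R[i]) *: (w : 'rV[R[i]]_n) : Cn R n) hk.1 Dz.
have -> : 'D_((v : R[i]) *: (w : 'rV[R[i]]_n) : Cn R n) (iter_derive (nseq k w) f) (cline p w z) =
  ((v : R[i]) * on_line k.+1 z : Z).
  have := hk.2 _ Dz (v : R[i]) (w : 'rV[R[i]]_n) 0.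
  by rewrite addr0 (holo_derive0 hk Dz) addr0.
apply: cvg_trans; apply: near_eq_cvg; apply: nearW => t.
by rewrite /on_line clineE.
Qed.

Lemma on_line_cvg k (z : Z) : D (cline p w z) -> on_line k @ nbhs z --> on_line k z.
Proof.
move=> Dz.
have hk : holo D (iter_derive (nseq k w) f) := holo_iter (nseq k w) oD hf.
exact: (@cvg_comp _ _ _ (cline p w) (iter_derive (nseq k w) f) _ _ _ (@cline_continuous n p w z)
  (smooth_in_cont hk.1 Dz)).
Qed.

Lemma on_line_open : open [set z : Z | D (cline p w z)].
Proof. by apply: (@open_comp _ _ (cline p w) D) => // z _; exact: cline_continuous. Qed.

Lemma on_line_cdiff2 k (z : Z) : D (cline p w z) -> cdiff2 (on_line k) z.
Proof.
move=> Dz; exists (on_line k.+1), (on_line k.+2 z); split; last exact: on_line_cdlim.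
apply: filterS (open_nbhs_nbhs (conj on_line_open Dz)) => y Dy.
exact: on_line_cdlim.
Qed.

End OneLine.

Lemma cvg_at_ball (V W : normedModType R) (f : V -> W) (x : V) (l : W) (e : R) : 0 < e ->
  f @ nbhs x --> l -> exists2 d : R, 0 < d & forall y, `|y - x| < d -> `|f y - l| < e.
Proof.
move=> e0 fl; have : \forall y \near x, `|l - f y| < e by exact: cvgr_dist_lt.
move=> /nbhs_ballP[d /= d0 dP]; exists d => // y yd; rewrite distrC; apply: dP.
by rewrite -ball_normE /= distrC.
Qed.

(** The derivatives form a sequence of functions, each the complex derivative of
    the one before it; the order of vanishing at [0] goes up by one with each
    application of the mean value inequality. *)
Lemma vanishing_order (L : nat -> Z -> Z) (r : R) : 0 < r ->
  (forall k z, `|z| < r -> cdlim (L k) z (L k.+1 z)) ->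
  (forall k, L k @ nbhs (0 : Z) --> L k 0) ->
  forall N m, (forall j, (j < N)%N -> L (m + j)%N 0 = 0) ->
  exists C d : R, [/\ 0 <= C, 0 < d & forall z : Z, `|z| < d -> `|L m z| <= C * `|z| ^+ N].
Proof.
move=> r0 Ld Lc; elim=> [|N IH] m L0.
  have [d d0 dP] := cvg_at_ball ltr01 (Lc m).
  exists (`|L m 0| + 1), d; split=> // z zd.
  rewrite expr0 mulr1; have := dP z; rewrite subr0 => /(_ zd) h.
  rewrite -[L m z](subrK (L m 0)) addrC.
  by apply: le_trans (ler_normD _ _) _; rewrite lerD2l ltW.
have [C [d [C0 d0 dP]]] : exists C d : R, [/\ 0 <= C, 0 < d & forall z : Z, `|z| < d -> `|L m.+1 z| <= C * `|z| ^+ N].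
  by apply: IH => j jN; rewrite addSnnS; apply: L0.
exists C, (Num.min d r); split=> //; first by rewrite lt_min d0.
move=> z; rewrite lt_min => /andP[zd zr].
have Lm0 : L m 0 = 0 by have := L0 0%N isT; rewrite addn0.
have inr (s : R) (q : R) : 0 <= s -> s <= 1 -> `|z| < q -> `|0 + (s * 1) *: z| < q.
  by move=> s0 s1; apply: le_lt_trans; rewrite add0r mulr1 normrZ ger0_norm// ler_piMl.
have := @mean_value_segment R Z Z (L m) (fun s => ((z : R[i]) * L m.+1 (0 + (s * 1) *: z) : Z)) 0 z 1 0 (C * `|z| ^+ N.+1).
rewrite scale1r add0r Lm0 subr0 scaler0 subr0 normr1 mul1r; apply.
  by move=> s s0 s1; apply: Ld; exact: inr.
move=> s s0 s1; rewrite subr0 realify_normM exprS mulrCA ler_wpM2l//.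
apply: le_trans (dP _ (inr s d s0 s1 zd)) _; rewrite ler_wpM2l//.
apply: lerXn2r; rewrite ?nnegrE//.
by rewrite add0r mulr1 normrZ ger0_norm// ler_piMl.
Qed.

Lemma cline_ball n (D : set (Cn R n)) (p w : Cn R n) (rho : R) : ball p rho `<=` D -> `|w| < rho ->
  forall z : Z, `|z| <= 1 -> D (cline p w z).
Proof.
move=> pD wr z z1; apply: pD; rewrite -ball_normE /= /cline opprD addrA subrr sub0r normrN Cn_normZ.
by apply: le_lt_trans wr; rewrite ler_piMl.
Qed.

Lemma cline_target n (p z : Cn R n) (r : R) : 0 < r ->
  cline p (r^-1 *: (z - p)) (r%:C : R[i]) = z.
Proof.
move=> r0; rewrite /cline.
rewrite -[X in p + X]/(r *: (r^-1 *: (z - p))) scalerA divff ?gt_eqF// scale1r.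
by rewrite subrKC.
Qed.

Lemma realify_normC (r : R) : `|(r%:C : Z)| = `|r|.
Proof.
apply: complexI; rewrite -[`|(r%:C : Z)|]/(realify_norm _) realify_normE.
by rewrite normc_def /= expr0n addr0 sqrtr_sqr.
Qed.

(** The Schwarz lemma applied to the square of [f] on a complex line through
    [p]. [schwarz_power] loses one power of [z] and the square vanishes to order
    two, whence one power of [eta] instead of two. *)
Lemma holo_equicontinuity n (D : set (Cn R n)) (f : Cn R n -> Z) (p : Cn R n) (rho M eta : R) :
  open D -> holo D f -> ball p rho `<=` D -> 0 <= M ->
  (forall x, ball p rho x -> `|f x| <= M) -> f p = 0 -> 0 < eta -> eta < 1 ->
  forall z, `|z - p| < eta * rho -> `|f z| ^+ 2 <= M ^+ 2 * eta.
Proof.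
move=> oD hf pD M0 fM fp e0 e1 z zr.
pose w : Cn R n := eta^-1 *: (z - p).
have wr : `|w| < rho by rewrite /w normrZ gtr0_norm ?invr_gt0// mulrC ltr_pdivrMr// mulrC.
have inD := cline_ball pD wr.
have inB := cline_ball (@subset_refl _ (ball p rho)) wr.
pose L := on_line f p w.
have c0 : cline p w 0 = p by rewrite /cline scale0r addr0.
have [C [d [C0 d0 dP]]] : exists C d : R, [/\ 0 <= C, 0 < d & forall z : Z, `|z| < d -> `|L 0%N z| <= C * `|z| ^+ 1].
  apply: (@vanishing_order L 1) => //.
  - by move=> k u /ltW u1; apply: (on_line_cdlim oD hf); exact: inD.
  - by move=> k; apply: (on_line_cvg oD hf); rewrite c0; apply: pD; apply: ballxx; exact: le_lt_trans wr.
  - by case=> // _; rewrite /L /on_line /= c0.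
pose F2 (u : Z) : Z := (L 0%N u : R[i]) ^+ 2.
have F2n u : `|F2 u| = `|L 0%N u| ^+ 2 by rewrite /F2 !expr2 realify_normM.
have := @schwarz_power R F2 1 (M ^+ 2) _ _ _ _ _ (eta%:C : R[i]).
rewrite F2n realify_normC gtr0_norm// expr1 /L /on_line /= cline_target//.
apply.
- by rewrite sqr_ge0.
- move=> u u1; rewrite /F2; under eq_fun do rewrite expr2; rewrite expr2.
  by apply: realify_cvgM; apply: (on_line_cvg oD hf); exact: inD.
- by move=> u /andP[_ /ltW u1]; apply: (@cdiff2X _ (L 0%N)); apply: (on_line_cdiff2 oD hf); exact: inD.
- move=> u u1; rewrite F2n; apply: lerXn2r; rewrite ?nnegrE//.
  by apply: fM; apply: inB; rewrite u1.
- exists (C ^+ 2), d; split=> // u ud; rewrite F2n -exprMn.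
  apply: lerXn2r; rewrite ?nnegrE ?mulr_ge0//.
  exact: dP.
- exact: ltW.
Qed.

(** On the complex line through [p] and [z], the function vanishes at [p] to
    infinite order, so the Schwarz lemma bounds [|f z|] by [M r^N] for all [N],
    with a fixed [r < 1]. *)
Lemma holo_identity_ball n (D : set (Cn R n)) (f : Cn R n -> Z) (p : Cn R n) (rho : R) :
  open D -> holo D f -> ball p rho `<=` D ->
  (forall w k, iter_derive (nseq k w) f p = 0) ->
  forall z, ball p rho z -> f z = 0.
Proof.
move=> oD hf pD f0 z zB.
have rho0 : 0 < rho by rewrite -ball_normE /= in zB; exact: le_lt_trans zB.
have [r r0 [r1 zr]] : exists2 r : R, 0 < r & r < 1 /\ `|z - p| < r * rho.
  have zp : `|z - p| < rho by rewrite -ball_normE /= distrC in zB.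
  exists ((`|z - p| / rho + 1) / 2).
    by rewrite divr_gt0// ltr_wpDl// divr_ge0// ltW.
  have : `|z - p| / rho < 1 by rewrite ltr_pdivrMr// mul1r.
  have E : `|z - p| = `|z - p| / rho * rho by rewrite mulfVK// gt_eqF.
  move: (`|z - p| / rho) E => q -> q1; split; first by lra.
  by rewrite ltr_pM2r//; lra.
pose w : Cn R n := r^-1 *: (z - p).
have wr : `|w| < rho by rewrite /w normrZ gtr0_norm ?invr_gt0// mulrC ltr_pdivrMr// mulrC.
have inD := cline_ball pD wr.
pose L := on_line f p w.
have c0 : cline p w 0 = p by rewrite /cline scale0r addr0.
have Lcvg (u : Z) : `|u| <= 1 -> L 0%N @ nbhs u --> L 0%N u.
  by move=> u1; apply: (on_line_cvg oD hf); exact: inD.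
have [M M0 LM] : exists2 M : R, 0 <= M & forall u : Z, `|u| <= 1 -> `|L 0%N u| <= M.
  have cK := @realify_ball_compact R 0 1.
  have K0 : [set z : Z | `|z - 0| <= 1] !=set0 by exists 0; rewrite /= subr0 normr0.
  have cL : {within [set z : Z | `|z - 0| <= 1], continuous (fun u => `|L 0%N u|)}.
    apply: continuous_in_subspaceT => u /set_mem /=; rewrite subr0 => u1.
    have FF : Filter (nbhs (u : Z)) := nbhs_filter _.
    suff : (fun u => `|L 0%N u|) @ nbhs (u : Z) --> `|L 0%N u| by [].
    by apply: cvg_norm; exact: Lcvg.
  have [c _ cmax] := compact_EVT_max K0 cK cL.
  by exists (`|L 0%N c|) => // u u1; apply: cmax; apply/mem_set; rewrite /= subr0.
have H N : `|f z| <= M * r ^+ N.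
  have d2 (u : Z) : 0 < `|u| < 1 -> cdiff2 (L 0%N) u.
    by move=> /andP[_ /ltW u1]; apply: (on_line_cdiff2 oD hf); exact: inD.
  have bL (u : Z) : `|u| = 1 -> `|L 0%N u| <= M by move=> u1; apply: LM; rewrite u1.
  have [C [d [C0 d0 dP]]] : exists C d : R, [/\ 0 <= C, 0 < d & forall z : Z, `|z| < d -> `|L 0%N z| <= C * `|z| ^+ N.+1].
    apply: (@vanishing_order L 1) => //.
    - by move=> k u /ltW u1; apply: (on_line_cdlim oD hf); exact: inD.
    - by move=> k; apply: (on_line_cvg oD hf); rewrite c0; apply: pD; apply: ballxx.
    - by move=> j _; rewrite /L /on_line /= c0.
  have hC : exists C d : R, 0 < d /\ forall z : Z, `|z| < d -> `|L 0%N z| <= C * `|z| ^+ N.+1.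
    by exists C, d.
  have := @schwarz_power R (L 0%N) N M M0 Lcvg d2 bL hC (r%:C : R[i]).
  rewrite realify_normC gtr0_norm// => /(_ (ltW r1)).
  by rewrite /L /on_line /= cline_target.
apply/eqP; rewrite -normr_le0.
have cv : (fun N : nat => M * r ^+ N) @ \oo --> M * 0.
  by apply: cvgM; [exact: cvg_cst|apply: cvg_expr; rewrite gtr0_norm].
rewrite -(mulr0 M); apply: (cvgr_to_ge cv).
by apply: nearW => N; exact: H.
Qed.

End ComplexLines.

(** * A countable family of seminorms for smooth sections *)

(** Induction over finite covers without choosing them. If [P K] fails, then the
    sets [A] such that [P (K `\` A)] holds form a proper filter, and a cluster
    point of this filter in [K] contradicts the local validity of [P]. *)
Lemma compact_local (T : topologicalType) (K : set T) (P : set T -> Prop) : compact K ->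
  P set0 -> (forall A B, A `<=` B -> P B -> P A) ->
  (forall A B, P A -> P B -> P (A `|` B)) ->
  (forall x, K x -> exists2 W, nbhs x W & P (K `&` W)) -> P K.
Proof.
move=> cK P0 Psub PU Pl; apply: contrapT => nPK.
pose F : set_system T := fun A => P (K `\` A).
have FF : ProperFilter F.
  split; first by rewrite /F setD0.
  split; first by rewrite /F setDT.
    by move=> A B FA FB; rewrite /F setDIr; exact: PU.
  by move=> A B AB; apply: Psub => x [Kx nB]; split=> // /AB.
have [|x [Kx clx]] := cK F FF; first by rewrite /F setDv.
have [W xW PW] := Pl x Kx.
have FW : F (~` W) by rewrite /F setDE setCK.
by have [y [nW]] := clx _ _ FW xW.
Qed.

Lemma near_norm_bound (R : realType) (V W : normedModType R) (f : V -> W) (x : V) :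
  f @ nbhs x --> f x -> \forall z \near x, `|f z| <= `|f x| + 1.
Proof.
move=> cf; near=> z.
rewrite -[f z](subrK (f x)) addrC; apply: le_trans (ler_normD _ _) _.
rewrite lerD2l distrC ltW//; near: z.
by apply: cvgr_dist_lt.
Unshelve. all: by end_near. Qed.

Section Patches.
Variables (R : realType) (n : nat) (X : complexManifold R n).
Variable (B : bundle_data R X).
Local Notation Z := (realify R R[i]).

Lemma Cinfty_nbhsE (s0 : Cinfty B) (A : set (Cinfty B)) : nbhs s0 A <->
  exists (ks : seq (Cinfty_index B)) (e : R), 0 < e /\
    forall s, \sum_(k <- ks) Cinfty_norm k (s - s0) < e -> A s.
Proof.
split; first by move=> [[ks e] /= e0 h]; exists ks, e.
by move=> [ks [e [e0 h]]]; exists (ks, e).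
Qed.

Definition chart_preimage (c : chart R X n) (V : set (Cn R n)) : set X :=
  [set x | chart_dom c x /\ V (chart_map c x)].

Lemma chart_preimage_open (c : chart R X n) V : open V -> open (chart_preimage c V).
Proof.
move=> oV; have /continuousP/(_ V oV) := @chart_map_continuous _ _ _ c.
move=> /open_subspaceP[U oU UE].
suff -> : chart_preimage c V = U `&` chart_dom c.
  by apply: openI => //; exact: chart_dom_open.
by rewrite UE setIC.
Qed.

(** The trivialization is available on a ball of twice the radius, which leaves
    room around the inner ball for the Schwarz lemma. *)
Record patch := Patch {
  patch_chart : chart R X n;
  patch_triv : trivialization (fiber B) (rank B);
  patch_center : Cn R n;
  patch_radius : R;
  patch_chartP : atlas X patch_chart;
  patch_trivP : trivs B patch_triv;
  patch_radius_gt0 : 0 < patch_radius;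
  patch_double_sub : [set z | `|z - patch_center| <= 2 * patch_radius] `<=`
    chart_image patch_chart (triv_dom patch_triv)
}.

Lemma patch_sub (k : patch) : [set z | `|z - patch_center k| <= patch_radius k] `<=`
  chart_image (patch_chart k) (triv_dom (patch_triv k)).
Proof.
move=> z /= zr; apply: patch_double_sub; apply: le_trans zr _.
by rewrite ler_peMl ?ler1n// ltW// patch_radius_gt0.
Qed.

Definition patch_inner (k : patch) : set X :=
  chart_preimage (patch_chart k) [set z | `|z - patch_center k| < patch_radius k].

Lemma open_nball (V : normedModType R) (p : V) (r : R) : open [set z | `|z - p| < r].
Proof.
by have := @ball_open _ V p r; rewrite -ball_normE; under eq_set => z do rewrite -[X in X < _]normrN opprB.
Qed.

Lemma patch_inner_open k : open (patch_inner k).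
Proof. by apply: chart_preimage_open; exact: open_nball. Qed.

Hypothesis cover : forall x, exists2 t, trivs B t & triv_dom t x.

Lemma chart_triv_image (c : chart R X n) (t : trivialization (fiber B) (rank B)) x :
  chart_dom c x -> triv_dom t x -> chart_image c (triv_dom t) (chart_map c x).
Proof. by move=> cx tx; split; [exact: chart_mapP|rewrite chart_mapK]. Qed.

Lemma open_closed_ball (V : normedModType R) (D : set V) (p : V) : open D -> D p ->
  exists2 r : R, 0 < r & [set z | `|z - p| <= r] `<=` D.
Proof.
move=> oD Dp; have /nbhs_ballP[r /= r0 rD] : nbhs p D by exact: open_nbhs_nbhs.
exists (r / 2); first by rewrite divr_gt0.
move=> z /= zr; apply: rD; rewrite -ball_normE /= distrC.
by apply: le_lt_trans zr _; rewrite ltr_pdivrMr// ltr_pMr// ltr1n.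
Qed.

Lemma patch_exists x : exists k : patch, patch_inner k x.
Proof.
have [t Bt tx] := cover x; have [c Ac cx] := atlas_cover x.
have [r r0 rD] := open_closed_ball (@chart_image_open _ _ _ c _ (@triv_dom_open _ _ _ _ t)) (chart_triv_image cx tx).
have r2 : 0 < r / 2 by rewrite divr_gt0.
rewrite -[r](@mulrVK _ 2) ?unitfE// mulrC in rD.
by exists (Patch Ac Bt r2 rD); split=> //=; rewrite subrr normr0.
Qed.

Hypothesis X_compact : compact [set: X].

Lemma patch_cover : exists (I : finType) (f : I -> patch), forall x, exists i, patch_inner (f i) x.
Proof.
pose P (A : set X) := exists (I : finType) (f : I -> patch), forall x, A x -> exists i, patch_inner (f i) x.
suff [I [f fP]] : P [set: X] by exists I, f => x; exact: fP.
apply: compact_local => //.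
- by exists 'I_0, (fun i : 'I_0 => match i with Ordinal _ h => match notF h with end end).
- by move=> A A' AA [I [f fP]]; exists I, f => x /AA; exact: fP.
- move=> A A' [I [f fP]] [J [g gP]].
  exists (I + J)%type, (fun s => match s with inl i => f i | inr j => g j end) => x [Ax|Ax].
    by have [i h] := fP x Ax; exists (inl i).
  by have [j h] := gP x Ax; exists (inr j).
- move=> x _; have [k kx] := patch_exists x.
  exists (patch_inner k); first by apply: open_nbhs_nbhs; split=> //; exact: patch_inner_open.
  by exists unit, (fun=> k) => y [_ ky]; exists tt.
Qed.

Section CountableBase.
Variables (I : finType) (f : I -> patch).
Hypothesis fP : forall x, exists i, patch_inner (f i) x.
Hypothesis transition : forall t1 t2, trivs B t1 -> trivs B t2 ->
      exists g : X -> 'M[R[i]]_(rank B),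
        (forall i j, smooth_on (triv_dom t1 `&` triv_dom t2) (fun x => g x i j)) /\
        forall x, triv_dom t1 x -> triv_dom t2 x ->
          forall e : fiber B x, triv_map t1 x e = triv_map t2 x e *m g x.

(** The partial derivatives of the coordinates over the patches: a countable
    set, whose enumeration provides the countable base. *)
Definition patch_index : countType := (I * 'I_(rank B) * seq ('I_n * bool))%type.

Definition patch_seminorm (l : patch_index) : Cinfty_index B :=
  CinftyIndex (map (@Cbasis R n) l.2) l.1.2 (patch_chartP (f l.1.1)) (patch_trivP (f l.1.1))
    (@Cn_ball_compact R n _ _) (@patch_sub (f l.1.1)).

Lemma smooth_section_local (c : chart R X n) t j (s : Cinfty B) : atlas X c -> trivs B t ->
  smooth_in (chart_image c (triv_dom t)) (local_coord c t j (s : smooth_section B)).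
Proof.
by move=> Ac Bt; have /asboolP := valP (s : smooth_section B); move=> /(_ _ Bt j _ Ac).
Qed.

(** Near [y] the sections can be computed in a patch whose inner ball contains
    [y]: the coordinates change by a transition matrix and by a change of
    charts, which [smooth_chain] controls. *)
Lemma patch_seminorm_local (k : Cinfty_index B) y : ci_set k y ->
  exists2 W, nbhs y W & exists (C : R) (L : seq patch_index), 0 <= C /\
   forall z, W z -> forall s : Cinfty B, `|iter_derive (ci_dirs k) (ci_local k s) z| <=
     C * \sum_(l <- L) Cinfty_norm (patch_seminorm l) s.
Proof.
move=> Ky; set c := ci_chart k; set t := ci_triv k.
have [ty iy] := ci_sub Ky.
have [i ki] := fP (chart_inv c y); set ck := patch_chart (f i); set tk := patch_triv (f i).
pose N := [set z : Cn R n | `|z - patch_center (f i)| < patch_radius (f i)].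
have NK z : N z -> [set z | `|z - patch_center (f i)| <= patch_radius (f i)] z by move=> /ltW.
pose D := chart_image c (triv_dom t `&` patch_inner (f i)).
have oD : open D.
  by apply: chart_image_open; apply: openI; [exact: triv_dom_open|exact: patch_inner_open].
have Dy : D y by [].
pose D' := chart_image ck (triv_dom tk).
have oD' : open D' by apply: chart_image_open; exact: triv_dom_open.
pose phi : Cn R n -> Cn R n := fun z => chart_map ck (chart_inv c z).
have Dphi z : D z -> N (phi z) by move=> [_ [_ []]].
have DD' : D `<=` phi @^-1` D' by move=> z /Dphi /NK; exact: patch_sub.
have phis j : smooth_in D ((fun z => (phi z : 'rV[R[i]]_n) 0 j) : Cn R n -> Z).
  have [h _] := atlas_holomorphic (ci_chartP k) (patch_chartP (f i)) j.
  by apply: smooth_in_sub h => z [tz [_ [cz _]]].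
have [g [gs gE]] := transition (ci_trivP k) (patch_trivP (f i)).
(* The column of the transition matrix that computes the coordinate of k from
   those of the patch. *)
pose a0 (l : 'I_(rank B)) : Cn R n -> Z := fun z => g (chart_inv c z) l (ci_coord k).
have a0s l : smooth_in D (a0 l).
  have := gs l (ci_coord k) c (ci_chartP k); apply: smooth_in_sub => z [cz [tz kz]].
  by split=> //; split=> //; have [] := DD' z (conj cz (conj tz kz)); rewrite /phi chart_mapK//; case: kz.
have [J [a [ws [jj [as_ aE]]]]] := smooth_chain oD oD' DD' phis (ci_dirs k) a0s.
pose L := [seq (i, jj q, ws q) : patch_index | q <- enum J].
have near_a : \forall z \near y, D z /\ forall q, `|a q z| <= `|a q y| + 1.
  apply: filterI; first by exact: open_nbhs_nbhs.
  apply: (@filter_forall _ _ _ (nbhs y) (nbhs_filter y)) => q.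
  have ca : a q @ nbhs y --> a q y by exact: smooth_in_cont (as_ q) Dy.
  exact: near_norm_bound ca.
eexists; first exact: near_a.
exists (\sum_q (`|a q y| + 1)), L; split.
  by apply: sumr_ge0 => q _; rewrite addr_ge0.
move=> z /= [Dz az] s.
have -> : iter_derive (ci_dirs k) (ci_local k s) z =
   \sum_q ((a q z : R[i]) * iter_derive (map (@Cbasis R n) (ws q)) (local_coord ck tk (jj q) (s : smooth_section B)) (phi z) : Z).
  rewrite -(aE (fun l => local_coord ck tk l (s : smooth_section B))); first last.
  - exact: Dz.
  - by move=> l; apply: smooth_section_local; [exact: patch_chartP|exact: patch_trivP].
  apply: (@iter_derive_eq _ _ _ D) => // x Dx.
  have [cx [tx [kx _]]] := Dx; have [ckx tkx] := DD' x Dx.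
  have tkx' : triv_dom tk (chart_inv c x) by move: tkx; rewrite /phi chart_mapK.
  rewrite /ci_local /local_coord /section_coord /= gE// mxE; apply: eq_bigr => l _.
  by rewrite /phi chart_mapK// mulrC.
rewrite mulr_suml; apply: le_trans (ler_norm_sum _ _ _) _; apply: ler_sum => q _.
rewrite realify_normM; apply: ler_pM => //.
have -> : \sum_(l <- L) Cinfty_norm (patch_seminorm l) s =
   \sum_q' Cinfty_norm (patch_seminorm (i, jj q', ws q')) s by rewrite big_map big_enum.
rewrite (bigD1 q)//=; apply: le_trans (_ : Cinfty_norm (patch_seminorm (i, jj q, ws q)) s <= _).
  exact: (@Cinfty_norm_ub _ _ _ _ (patch_seminorm (i, jj q, ws q)) s (phi z) (NK _ (Dphi z Dz))).
by rewrite lerDl sumr_ge0// => q' _; exact: Cinfty_norm_ge0.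
Qed.

Lemma patch_seminorm_bound (k : Cinfty_index B) : exists (C : R) (L : seq patch_index), 0 <= C /\
   forall s : Cinfty B, Cinfty_norm k s <= C * \sum_(l <- L) Cinfty_norm (patch_seminorm l) s.
Proof.
pose P (A : set (Cn R n)) := exists (C : R) (L : seq patch_index), 0 <= C /\
   forall z, A z -> forall s : Cinfty B, `|iter_derive (ci_dirs k) (ci_local k s) z| <=
     C * \sum_(l <- L) Cinfty_norm (patch_seminorm l) s.
have S0 L s : 0 <= \sum_(l <- L) Cinfty_norm (patch_seminorm l) s.
  by apply: sumr_ge0 => l _; exact: Cinfty_norm_ge0.
suff [C [L [C0 CL]]] : P (ci_set k).
  exists C, L; split=> // s; apply: Cinfty_norm_lub; first by rewrite mulr_ge0.
  by move=> y Ky; exact: CL.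
apply: compact_local; first exact: (@ci_compact _ _ _ _ k).
- by exists 0, [::].
- by move=> A A' AA [C [L [C0 CL]]]; exists C, L; split=> // z /AA; exact: CL.
- move=> A A' [C [L [C0 CL]]] [C' [L' [C'0 CL']]]; exists (C + C'), (L ++ L'); split; first exact: addr_ge0.
  move=> z Az s; rewrite big_cat /=.
  case: Az => [/CL|/CL'] /(_ s) h; apply: le_trans h _; apply: ler_pM => //.
  + by rewrite lerDl.
  + by rewrite lerDl.
  + by rewrite lerDr.
  + by rewrite lerDr.
- move=> y Ky; have [W yW [C [L [C0 CL]]]] := patch_seminorm_local Ky.
  by exists W => //; exists C, L; split=> // z [_ Wz]; exact: CL.
Qed.

(** An increasing sequence of seminorms, cofinal by [patch_norm_bound]. *)
Definition patch_norm (N : nat) (s : Cinfty B) : R :=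
  \sum_(l <- pmap (@unpickle patch_index) (iota 0 N)) Cinfty_norm (patch_seminorm l) s.

Lemma patch_norm_mono N N' s : (N <= N')%N -> patch_norm N s <= patch_norm N' s.
Proof.
move=> NN; rewrite /patch_norm -(subnKC NN) iotaD pmap_cat big_cat /= lerDl.
by apply: sumr_ge0 => l _; exact: Cinfty_norm_ge0.
Qed.

Lemma patch_norm_ge (l : patch_index) s : Cinfty_norm (patch_seminorm l) s <= patch_norm (pickle l).+1 s.
Proof.
rewrite /patch_norm -addn1 iotaD pmap_cat big_cat /= pickleK big_seq1 lerDr.
by apply: sumr_ge0 => l' _; exact: Cinfty_norm_ge0.
Qed.

Lemma patch_norm_bound (ks : seq (Cinfty_index B)) : exists (C : R) (N0 : nat), 0 <= C /\
  forall N, (N0 <= N)%N -> forall s, \sum_(k <- ks) Cinfty_norm k s <= C * patch_norm N s.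
Proof.
have sumb (L : seq patch_index) : exists (C : R) (N0 : nat), 0 <= C /\
    forall N, (N0 <= N)%N -> forall s, \sum_(l <- L) Cinfty_norm (patch_seminorm l) s <= C * patch_norm N s.
  elim: L => [|l L [C [N0 [C0 CN]]]].
    by exists 0, 0%N; split=> // N _ s; rewrite big_nil mul0r.
  exists (1 + C), (maxn (pickle l).+1 N0); split; first exact: addr_ge0.
  move=> N; rewrite geq_max => /andP[lN NN] s; rewrite big_cons mulrDl mul1r lerD//; last exact: CN.
  exact: le_trans (patch_norm_ge _ _) (patch_norm_mono _ lN).
elim: ks => [|k ks [C [N0 [C0 CN]]]].
  by exists 0, 0%N; split=> // N _ s; rewrite big_nil mul0r.
have [C1 [L [C10 CL]]] := patch_seminorm_bound k; have [C2 [N2 [C20 CN2]]] := sumb L.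
exists (C1 * C2 + C), (maxn N2 N0); split; first by rewrite addr_ge0// mulr_ge0.
move=> N; rewrite geq_max => /andP[N2N NN] s; rewrite big_cons mulrDl lerD//; last exact: CN.
by apply: le_trans (CL s) _; rewrite -mulrA; apply: ler_wpM2l => //; exact: CN2.
Qed.

Lemma Cinfty_countable_base : exists2 V : nat -> set (Cinfty B), (forall i, nbhs (0 : Cinfty B) (V i)) &
  forall A, nbhs (0 : Cinfty B) A -> exists i, V i `<=` A.
Proof.
exists (fun N => [set s | patch_norm N s < N.+1%:R^-1]).
  move=> N; apply/Cinfty_nbhsE.
  exists (map patch_seminorm (pmap (@unpickle patch_index) (iota 0 N))), N.+1%:R^-1; split.
    by rewrite invr_gt0.
  by move=> s; rewrite subr0 big_map.
move=> A /Cinfty_nbhsE[ks [e [e0 ksA]]].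
have [C [N0 [C0 CN]]] := patch_norm_bound ks.
pose N := maxn N0 (Num.truncn (C / e)).
exists N => s /= sN; apply: ksA; rewrite subr0; apply: le_lt_trans (CN N _ s) _; first exact: leq_maxl.
have N1 : (0 : R) < N.+1%:R by rewrite ltr0n.
have CeN : C < e * N.+1%:R.
  rewrite mulrC -ltr_pdivrMr//; apply: lt_le_trans (_ : (Num.truncn (C / e)).+1%:R <= _).
    by apply: truncnS_gt.
  by rewrite ler_nat ltnS leq_maxr.
have sN0 : 0 <= patch_norm N s by apply: sumr_ge0 => l _; exact: Cinfty_norm_ge0.
apply: le_lt_trans (_ : C * N.+1%:R^-1 < _); first by rewrite ler_wpM2l// ltW.
by rewrite ltr_pdivrMr.
Qed.

End CountableBase.

End Patches.

(** * Completeness of the space of smooth sections *)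

Section CauchyFilter.
Variable (R : realType).
Local Notation Z := (realify R R[i]).

Lemma cauchy_filter_cvg_real (T : Type) (U : set_system T) (FF : ProperFilter U) (f : T -> R^o) :
  (forall e : R, 0 < e -> exists2 A, U A & forall x y, A x -> A y -> `|f x - f y| < e) ->
  exists l : R^o, f @ U --> l.
Proof.
move=> cf; have : cauchy (f @ U).
  apply: cauchy_exP => e e0; have [A UA Ae] := cf e e0.
  have [x Ax] := filter_ex UA; exists (f x).
  rewrite /=; apply: (filterS _ UA) => y Ay; rewrite -ball_normE /=; exact: Ae.
by move=> /cauchy_cvgP/cvg_ex.
Qed.

(** The real and imaginary parts converge by completeness of the real numbers. *)
Lemma cauchy_filter_cvg (T : Type) (U : set_system T) (FF : ProperFilter U) (f : T -> Z) :
  (forall e : R, 0 < e -> exists2 A, U A & forall x y, A x -> A y -> `|f x - f y| < e) ->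
  exists l : Z, f @ U --> l.
Proof.
move=> cf.
have [a fa] : exists l : R^o, (fun x => complex.Re (f x) : R^o) @ U --> l.
  apply: cauchy_filter_cvg_real => e e0; have [A UA Ae] := cf e e0; exists A => // x y Ax Ay.
  by apply: le_lt_trans (Ae x y Ax Ay); rewrite -raddfB; exact: (realify_ge_Re (f x - f y)).
have [b fb] : exists l : R^o, (fun x => complex.Im (f x) : R^o) @ U --> l.
  apply: cauchy_filter_cvg_real => e e0; have [A UA Ae] := cf e e0; exists A => // x y Ax Ay.
  by apply: le_lt_trans (Ae x y Ax Ay); rewrite -raddfB; exact: (realify_ge_Im (f x - f y)).
exists (Complex a b : Z); apply/cvgrPdist_lt => e e0.
have e2 : 0 < e / 2 by rewrite divr_gt0.
have ha : \forall x \near U, `|a - complex.Re (f x)| < e / 2 by exact: (@cvgr_dist_lt _ R^o).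
have hb : \forall x \near U, `|b - complex.Im (f x)| < e / 2 by exact: (@cvgr_dist_lt _ R^o).
apply: filterS2 ha hb => x ax bx; apply: le_lt_trans (realify_le_ReIm _) _.
rewrite [ltRHS]splitr; apply: ltrD.
  by rewrite raddfB.
by rewrite raddfB.
Qed.

Lemma cvg_dist_le (T : Type) (U : set_system T) (FF : ProperFilter U) (W : normedModType R)
  (f : T -> W) (l a : W) (e : R) (A : set T) : U A -> (forall x, A x -> `|f x - a| <= e) ->
  f @ U --> l -> `|l - a| <= e.
Proof.
move=> UA fA fl; apply/ler_addgt0Pr => d d0.
have H : \forall x \near U, `|l - f x| < d by exact: (@cvgr_dist_lt _ W).
have [x [Ax xd]] := filter_ex (filterI UA H).
have -> : l - a = (f x - a) + (l - f x) by rewrite [RHS]addrC addrA subrK.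
apply: le_trans (ler_normD _ _) _; apply: lerD; [exact: fA|exact: ltW].
Qed.

Lemma iter_deriveB (V W : normedModType R) (D : set V) (f g h : V -> W) : open D ->
  smooth_in D g -> smooth_in D h -> (forall x, f x = g x + h x) ->
  forall vs x, D x -> iter_derive vs f x - iter_derive vs g x = iter_derive vs h x.
Proof.
move=> oD sg sh fE vs x Dx; have -> : f = g + h by apply/funext => y; exact: fE.
by rewrite (iter_deriveD oD sg sh vs Dx) addrC addKr.
Qed.

Lemma halves_le (W : normedModType R) (a b : W) (e : R) :
  `|a| <= e / 2 -> `|b| <= e / 2 -> `|a + b| <= e.
Proof.
by move=> ha hb; apply: le_trans (ler_normD _ _) _; rewrite [leRHS]splitr lerD.
Qed.

Lemma close_transfer (W : normedModType R) (a b a' b' w : W) (K g : R) :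
  `|a' - b' - w| <= K -> `|b' - b| <= g / 2 -> `|a' - a| <= g / 2 -> `|a - b - w| <= K + g.
Proof.
move=> hK hb ha; rewrite (_ : a - b - w = (a' - b' - w) + ((b' - b) - (a' - a))).
  apply: le_trans (ler_normD _ _) _; apply: lerD => //.
  by apply: halves_le; rewrite ?normrN.
rewrite [RHS]addrAC; congr (_ - _).
rewrite addrA subrKA [a' - b - _]addrAC opprB.
by rewrite subrKC.
Qed.

Lemma quotient_close (W : normedModType R) (a w : W) (h e : R) : h != 0 ->
  `|a - h *: w| <= `|h| * e -> `|w - h^-1 *: a| <= e.
Proof.
move=> h0 H; rewrite (_ : w - h^-1 *: a = - (h^-1 *: (a - h *: w))).
  by rewrite normrN normrZ normfV ler_pdivrMl ?normr_gt0.
by rewrite scalerBr scalerA mulVf// scale1r opprB.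
Qed.

Lemma small_steps (V : normedModType R) (v : V) (q : R) : 0 < q ->
  \forall h \near (0 : R)^', `|h| * `|v| < q /\ h != 0.
Proof.
move=> q0; have v1 : 0 < `|v| + 1 by rewrite ltr_wpDl.
have [d d0 dE] : exists2 d : R, 0 < d & d * (`|v| + 1) = q.
  by exists (q / (`|v| + 1)); [rewrite divr_gt0|rewrite divfK ?gt_eqF].
exists d => // h /=; rewrite sub0r normrN => hd h0; split=> //.
rewrite -dE; apply: le_lt_trans (_ : `|h| * (`|v| + 1) < _).
  by rewrite ler_wpM2l// lerDl.
by rewrite ltr_pM2r.
Qed.

End CauchyFilter.

Section Completeness.
Variables (R : realType) (n : nat) (X : complexManifold R n).
Variable (B : bundle_data R X).
Hypothesis Bb : is_bundle (@smooth_on R n X) B.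
Local Notation Z := (realify R R[i]).

Lemma ci_iterB (k : Cinfty_index B) (s u : Cinfty B) y : ci_set k y ->
  iter_derive (ci_dirs k) (ci_local k s) y - iter_derive (ci_dirs k) (ci_local k u) y =
  iter_derive (ci_dirs k) (ci_local k (s - u)) y.
Proof.
move=> Ky; apply: (iter_deriveB (@ci_dom_open _ _ _ _ k) (ci_local_smooth u) (ci_local_smooth (s - u)) _ _ (ci_sub Ky)).
by move=> x; have := congr1 (fun f => f x) (ci_localD k u (s - u)); rewrite subrKC.
Qed.

Variables (U : set_system (Cinfty B)) (UF : ProperFilter U).
Hypothesis Uc : forall A, nbhs (0 : Cinfty B) A ->
  exists2 V, U V & forall x y, V x -> V y -> A (x - y).

(** The pointwise limit along the Cauchy filter of a derivative of a coordinate
    of sections; it is locally uniform, so these limits turn out to be the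
    derivatives of the coordinates of the limit section. *)
Definition limit_jet c t j vs (y : Cn R n) : Z :=
  xget 0 [set l : Z | (fun s : Cinfty B => iter_derive vs (local_coord c t j (s : smooth_section B)) y : Z) @ U --> l].

Lemma jets_cauchy (k : Cinfty_index B) (e : R) : 0 < e ->
  exists2 A, U A & forall s u, A s -> A u -> forall y, ci_set k y ->
   `|iter_derive (ci_dirs k) (ci_local k s) y - iter_derive (ci_dirs k) (ci_local k u) y| < e.
Proof.
move=> e0; have [|A UA Ae] := Uc (A := [set s | Cinfty_norm k s < e]).
  apply/Cinfty_nbhsE; exists [:: k], e; split=> // s.
  by rewrite big_seq1 subr0.
exists A => // s u As Au y Ky; rewrite ci_iterB//; apply: le_lt_trans (Ae s u As Au).
exact: Cinfty_norm_ub.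
Qed.

Lemma limit_jet_cvg (k : Cinfty_index B) y : ci_set k y ->
  (fun s : Cinfty B => iter_derive (ci_dirs k) (ci_local k s) y : Z) @ U -->
    limit_jet (ci_chart k) (ci_triv k) (ci_coord k) (ci_dirs k) y.
Proof.
move=> Ky; have [l lE] : exists l : Z,
  (fun s : Cinfty B => iter_derive (ci_dirs k) (ci_local k s) y : Z) @ U --> l.
  apply: cauchy_filter_cvg => e e0; have [A UA Ae] := jets_cauchy k e0.
  by exists A => // s u As Au; exact: Ae.
exact: (@xgetPex _ 0 [set l : Z | (fun s : Cinfty B => iter_derive (ci_dirs k) (ci_local k s) y : Z) @ U --> l] (ex_intro _ l lE)).
Qed.

Lemma limit_jet_uniform (k : Cinfty_index B) (e : R) : 0 < e ->
  exists2 A, U A & forall s, A s -> forall y, ci_set k y ->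
   `|iter_derive (ci_dirs k) (ci_local k s) y -
     limit_jet (ci_chart k) (ci_triv k) (ci_coord k) (ci_dirs k) y| <= e.
Proof.
move=> e0; have [A UA Ae] := jets_cauchy k e0; exists A => // s As y Ky; rewrite distrC.
apply: (cvg_dist_le UF UA _ (limit_jet_cvg Ky)) => u Au; apply: ltW; exact: Ae.
Qed.

Section Local.
Variables (c : chart R X n) (t : trivialization (fiber B) (rank B)) (j : 'I_(rank B)).
Hypotheses (Ac : atlas X c) (Bt : trivs B t).
Let D := chart_image c (triv_dom t).

Lemma limit_jet_ball y : D y -> exists2 r : R, 0 < r &
  (forall z, `|z - y| <= r -> D z) /\
  forall vs (e : R), 0 < e -> exists2 A, U A & forall s : Cinfty B, A s -> forall z, `|z - y| <= r ->
   `|iter_derive vs (local_coord c t j (s : smooth_section B)) z - limit_jet c t j vs z| <= e.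
Proof.
move=> Dy; have [r r0 rD] := open_closed_ball (@chart_image_open _ _ _ c _ (@triv_dom_open _ _ _ _ t)) Dy.
exists r => //; split; first exact: rD.
move=> vs e e0; exact: (limit_jet_uniform (CinftyIndex vs j Ac Bt (@Cn_ball_compact R n y r) rD) e0).
Qed.

(** A locally uniform limit of continuous functions. *)
Lemma limit_jet_continuous vs y : D y -> limit_jet c t j vs @ nbhs y --> limit_jet c t j vs y.
Proof.
move=> Dy; have [r r0 [rD H]] := limit_jet_ball Dy; apply/cvgrPdist_lt => e e0.
have e4 : 0 < e / 4 by rewrite divr_gt0.
have [A UA Ae] := H vs _ e4; have [s As] := filter_ex UA.
have [cs _] := smooth_section_local j s Ac Bt vs Dy.
have [d d0 dH] := cvg_at_ball e4 cs.
apply/nbhs_ballP; exists (Num.min r d) => /=; first by rewrite lt_min r0.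
move=> z; rewrite -ball_normE /= distrC lt_min => /andP[zr zd].
have h1 := Ae s As z (ltW zr); have h2 := dH z zd.
have h3 : `|iter_derive vs (local_coord c t j (s : smooth_section B)) y - limit_jet c t j vs y| <= e / 4.
  by apply: Ae => //; rewrite subrr normr0 ltW.
move: h1 h2 h3; set a := limit_jet c t j vs y; set b := limit_jet c t j vs z.
set a' := iter_derive _ _ y; set b' := iter_derive _ _ z => h1 h2 h3.
have -> : a - b = (a - a') + ((a' - b') + (b' - b)).
  by rewrite (addrA (a' - b')) subrK addrA subrK.
apply: le_lt_trans (ler_normD _ _) _.
have := ler_normD (a' - b') (b' - b); rewrite (distrC a a') (distrC a' b') => h4.
by lra.
Qed.

(** Differentiation commutes with locally uniform limits: apply the mean value
    inequality to a section of the filter whose derivatives along [vs] and along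
    [v :: vs] are both close to their limits. *)
Lemma limit_jet_dlim vs v y : D y -> dlim (limit_jet c t j vs) y v (limit_jet c t j (v :: vs) y).
Proof.
move=> Dy; have [r r0 [rD H]] := limit_jet_ball Dy; apply/cvgrPdist_le => e e0.
have e2 : 0 < e / 2 by rewrite divr_gt0.
have [d d0 dH] := cvg_at_ball e2 (@limit_jet_continuous (v :: vs) y Dy).
pose q := Num.min r d.
have q0 : 0 < q by rewrite lt_min r0.
have near_small : \forall h \near (0 : R)^', `|h| * `|v| < q /\ h != 0.
  exact: small_steps.
apply: filterS near_small => h [hq h0].
set L := limit_jet c t j (v :: vs) y.
have main : `|limit_jet c t j vs (y + h *: v) - limit_jet c t j vs y - h *: L| <= `|h| * e.
  have hball (a : R) : 0 <= a -> a <= 1 -> `|y + (a * h) *: v - y| < q.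
    move=> a0 a1; rewrite addrC addKr normrZ normrM ger0_norm//.
    by apply: le_lt_trans hq; rewrite -mulrA ler_piMl// mulr_ge0.
  apply/ler_addgt0Pr => g g0.
  have g2 : 0 < g / 2 by rewrite divr_gt0.
  have [A1 UA1 A1e] := H vs _ g2; have [A2 UA2 A2e] := H (v :: vs) _ e2.
  have [s [A1s A2s]] := filter_ex (filterI UA1 UA2).
  pose fs := iter_derive vs (local_coord c t j (s : smooth_section B)).
  have fsE : `|fs (y + h *: v) - fs y - h *: L| <= `|h| * e.
    apply: (mean_value_segment (df := fun a => 'D_v fs (y + (a * h) *: v))).
      move=> a a0 a1; apply: derivable_dlim.
      have Dz : D (y + (a * h) *: v).
        by apply: rD; apply: ltW; apply: lt_le_trans (hball a a0 a1) _; rewrite ge_min lexx.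
      by have [_] := smooth_section_local j s Ac Bt vs Dz.
    move=> a a0 a1; have := hball a a0 a1; set z := y + _ => zq.
    have zr : `|z - y| <= r by apply: ltW; apply: lt_le_trans zq _; rewrite ge_min lexx.
    have zd : `|z - y| < d by apply: lt_le_trans zq _; rewrite ge_min lexx orbT.
    have h1 := A2e s A2s z zr; have h2 := dH z zd.
    have -> : 'D_v fs z - L = ('D_v fs z - limit_jet c t j (v :: vs) z) + (limit_jet c t j (v :: vs) z - L).
      by rewrite addrA subrK.
    exact: (halves_le h1 (ltW h2)).
  have yr : `|y - y| <= r by rewrite subrr normr0 ltW.
  have hr : `|y + h *: v - y| <= r.
    have := hball 1 ler01 (lexx 1); rewrite mul1r => hh.
    by apply: ltW; apply: lt_le_trans hh _; rewrite ge_min lexx.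
  have h1 := A1e s A1s y yr; have h2 := A1e s A1s _ hr.
  exact: (close_transfer fsE h1 h2).
exact: (quotient_close h0 main).
Qed.

Lemma limit_jet_iter vs y : D y -> iter_derive vs (limit_jet c t j [::]) y = limit_jet c t j vs y.
Proof.
elim: vs y => [//|v vs IH] y Dy /=; apply: dlim_derive.
apply: (@dlim_near _ _ _ (limit_jet c t j vs) _ y v _ _ (@limit_jet_dlim vs v y Dy)); near=> z.
apply/esym/IH; near: z; apply: open_nbhs_nbhs; split=> //.
exact: (@chart_image_open _ _ _ c _ (@triv_dom_open _ _ _ _ t)).
Unshelve. all: by end_near. Qed.

Lemma limit_jet_smooth : smooth_in D (limit_jet c t j [::]).
Proof.
apply: (@smooth_in_class _ _ _ D [set g | exists vs, g = limit_jet c t j vs]); last by exists [::].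
- exact: (@chart_image_open _ _ _ c _ (@triv_dom_open _ _ _ _ t)).
- by move=> g y [vs ->] Dy; exact: limit_jet_continuous.
- by move=> g v [vs ->]; exists (limit_jet c t j (v :: vs)) => [|y Dy]; [exists (v :: vs)|exact: limit_jet_dlim].
Qed.

Lemma section_coord_cvg x : chart_dom c x -> triv_dom t x ->
  (fun s : Cinfty B => section_coord t j (s : smooth_section B) x : Z) @ U --> limit_jet c t j [::] (chart_map c x).
Proof.
move=> cx tx; have Dx := chart_triv_image cx tx.
have sub : [set chart_map c x] `<=` D by move=> _ ->.
have := @limit_jet_cvg (CinftyIndex [::] j Ac Bt (@compact_set1 _ (chart_map c x)) sub) (chart_map c x) erefl.
rewrite /= /ci_local /local_coord /=.
by under eq_fun do rewrite chart_mapK//.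
Qed.

End Local.

(** The limits of the coordinates in one trivialization determine a point of
    each fibre; the transition matrices show that coordinates in all other
    trivializations converge to those of the same point. *)
Lemma limit_section : exists s0 : section B, forall x t j, trivs B t -> triv_dom t x ->
  (fun s : Cinfty B => section_coord t j (s : smooth_section B) x : Z) @ U --> (section_coord t j s0 x : Z).
Proof.
have [cover bij trans] := Bb.
suff H x : exists e : fiber B x, forall t j, trivs B t -> triv_dom t x ->
  (fun s : Cinfty B => section_coord t j (s : smooth_section B) x : Z) @ U --> (triv_map t x e 0 j : Z).
  by exists (fun x => projT1 (cid (H x))) => x; exact: projT2 (cid (H x)).
have [t0 Bt0 t0x] := cover x; have [c Ac cx] := atlas_cover x.
have [inv _ Kinv] := bij t0 Bt0 x t0x.
pose v := \row_j (limit_jet c t0 j [::] (chart_map c x) : R[i]).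
exists (inv v) => t j Bt tx; have [g [_ gE]] := trans t t0 Bt Bt0.
rewrite (gE x tx t0x) mxE Kinv.
have -> : (fun s : Cinfty B => section_coord t j (s : smooth_section B) x : Z) =
  (fun s : Cinfty B => \sum_l ((g x l j : R[i]) * (section_coord t0 l (s : smooth_section B) x) : Z)).
  by apply/funext => s; rewrite /section_coord gE// mxE; apply: eq_bigr => l _; rewrite mulrC.
rewrite (eq_bigr (fun l => g x l j * (limit_jet c t0 l [::] (chart_map c x) : R[i]))); last first.
  by move=> l _; rewrite mxE mulrC.
apply: (@normed_cvg_sum _ Z) => l.
apply: (@realify_cvgM _ _ U); first exact: cvg_cst.
exact: section_coord_cvg.
Qed.

Lemma Cinfty_cauchy_cvg : exists s : Cinfty B, U --> s.
Proof.
have [cover bij trans] := Bb.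
have [s0 s0E] := limit_section.
have s0L c t j x : atlas X c -> trivs B t -> chart_dom c x -> triv_dom t x ->
   section_coord t j s0 x = limit_jet c t j [::] (chart_map c x).
  move=> Ac Bt cx tx; have l1 := s0E x t j Bt tx; have l2 := @section_coord_cvg c t j Ac Bt x cx tx.
  exact: (cvg_unique (@norm_hausdorff _ Z) l1 l2).
have s0loc c t j y : atlas X c -> trivs B t -> chart_image c (triv_dom t) y ->
   local_coord c t j s0 y = limit_jet c t j [::] y.
  move=> Ac Bt [cy ty]; rewrite /local_coord /= (s0L c)//; last exact: chart_invP.
  by rewrite chart_invK.
have s0s : s0 \in @smooth_pred _ _ _ B.
  apply/asboolP => t Bt j c Ac.
  have oD := @chart_image_open _ _ _ c _ (@triv_dom_open _ _ _ _ t).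
  apply: (smooth_in_eq oD _ (@limit_jet_smooth c t j Ac Bt)) => y Dy.
  by apply/esym/s0loc.
exists (SmoothSection s0s : Cinfty B) => A /Cinfty_nbhsE[ks [e [e0 H]]].
suff [A' UA' A'e] : exists2 A', U A' & forall s, A' s ->
    \sum_(k <- ks) Cinfty_norm k (s - (SmoothSection s0s : Cinfty B)) < e.
  by apply: filterS UA' => s /A'e; exact: H.
elim: ks e e0 {H} => [|k ks IH] e e0.
  by exists setT; [exact: filterT|move=> s _; rewrite big_nil].
have e2 : 0 < e / 2 by rewrite divr_gt0.
have e4 : 0 < e / 4 by rewrite divr_gt0.
have [A1 UA1 A1e] := IH _ e2; have [A2 UA2 A2e] := limit_jet_uniform k e4.
exists (A1 `&` A2); first exact: filterI.
move=> s [/A1e h1 A2s]; rewrite big_cons.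
have h2 : Cinfty_norm k (s - (SmoothSection s0s : Cinfty B)) <= e / 4.
  apply: Cinfty_norm_lub; first exact: ltW.
  move=> y Ky; rewrite -ci_iterB//.
  suff -> : iter_derive (ci_dirs k) (ci_local k (SmoothSection s0s : Cinfty B)) y =
     limit_jet (ci_chart k) (ci_triv k) (ci_coord k) (ci_dirs k) y by exact: A2e.
  rewrite -(@limit_jet_iter _ _ (ci_coord k) (ci_chartP k) (ci_trivP k) _ _ (ci_sub Ky)).
  apply: (iter_derive_eq (@ci_dom_open _ _ _ _ k)); last exact: ci_sub.
  by move=> z Dz; apply: s0loc => //; [exact: ci_chartP|exact: ci_trivP].
lra.
Qed.

End Completeness.

Section Frechet.
Variables (R : realType) (n : nat) (X : complexManifold R n) (X_compact : compact [set: X]).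
Variables (B : bundle_data R X) (Bb : is_bundle (@smooth_on R n X) B).

Lemma Cinfty_norm_eq0 (s : Cinfty B) : (forall k, Cinfty_norm k s = 0) -> s = 0.
Proof.
have [cover bij trans] := Bb; move=> s0; apply: val_inj; apply: functional_extensionality_dep => x.
have [t Bt tx] := cover x; have [c Ac cx] := atlas_cover x.
apply: (bij_inj (bij t Bt x tx)); rewrite linear0; apply/rowP => j; rewrite mxE.
have Dx := chart_triv_image cx tx.
have sub : [set chart_map c x] `<=` chart_image c (triv_dom t) by move=> _ ->.
pose k := CinftyIndex [::] j Ac Bt (@compact_set1 _ (chart_map c x)) sub.
have := @Cinfty_norm_ub _ _ _ _ k s (chart_map c x) erefl; rewrite s0.
rewrite /= /ci_local /local_coord /= chart_mapK// normr_le0 => /eqP; exact.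
Qed.

Lemma Cinfty_hausdorff : hausdorff_space (Cinfty B).
Proof.
move=> s u su; apply/eqP; rewrite -subr_eq0; apply/eqP; apply: Cinfty_norm_eq0 => k.
apply/eqP; rewrite eq_le Cinfty_norm_ge0 andbT; apply/ler_addgt0Pr => e e0; rewrite add0r.
have e2 : 0 < e / 2 by rewrite divr_gt0.
have N (v : Cinfty B) : nbhs v [set w : Cinfty B | Cinfty_norm k (w - v) < e / 2].
  by apply/Cinfty_nbhsE; exists [:: k], (e / 2); split=> // w; rewrite big_seq1.
have [w [/= ws wu]] := su _ _ (N s) (N u).
have -> : s - u = (-1) *: (w - s) + (w - u) by rewrite scaleN1r opprB addrA subrK.
apply: le_trans (Cinfty_normD _ _ _) _; rewrite Cinfty_normZ normrN1 mul1r.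
by rewrite [leRHS]splitr lerD// ltW.
Qed.

Lemma Cinfty_frechet : is_frechet (Cinfty B).
Proof.
have [cover bij trans] := Bb.
have [I [f fP]] := patch_cover cover X_compact.
split; [exact: Cinfty_hausdorff| |].
  have [V V0 VA] := Cinfty_countable_base fP trans.
  by exists V.
by move=> U UF Uc; exact: Cinfty_cauchy_cvg.
Qed.

End Frechet.

(** * The tensor product of a bundle with its conjugate *)

Lemma linfunE (K : fieldType) (V W : vectType K) (f : V -> W) : linear f -> forall v, linfun f v = f v.
Proof.
move=> lf v; pose L : {linear V -> W} := HB.pack f (GRing.isLinear.Build _ _ _ _ f lf).
exact: (lfunE L v).
Qed.

Section TensorCoordinates.
Variables (R : realType) (V W : vectType R[i]) (p q : nat).

Lemma lfun2D (b b' : 'Hom(V, 'Hom(W, R[i]^o))) a v w :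
  (a *: b + b') v w = (a : R[i]) * (b v w : R[i]) + b' v w.
Proof. by rewrite add_lfunE scale_lfunE add_lfunE scale_lfunE. Qed.

Lemma tensE (v : V) (w : W) (b : 'Hom(V, 'Hom(W, R[i]^o))) : tens v w b = b v w.
Proof. by rewrite /tens linfunE// => a b1 b2; exact: lfun2D. Qed.

Lemma coord_formE (f : {linear V -> 'rV[R[i]]_p}) (g : {linear W -> 'rV[R[i]]_q}) i j v w :
  coord_form f g i j v w = (f v 0 i : R[i]) * g w 0 j.
Proof.
have l2 v' : linear (fun w => f v' 0 i * g w 0 j : R[i]^o).
  by move=> a w1 w2; rewrite linearP !mxE mulrDr mulrCA.
have l1 : linear (fun v => linfun (fun w => f v 0 i * g w 0 j : R[i]^o)).
  move=> a v1 v2; apply/lfunP => w'.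
  by rewrite add_lfunE scale_lfunE !(linfunE (l2 _)) linearP !mxE mulrDl -mulrA.
by rewrite /coord_form (linfunE l1) (linfunE (l2 _)).
Qed.

Lemma tensor_coord_tens (f : {linear V -> 'rV[R[i]]_p}) (g : {linear W -> 'rV[R[i]]_q}) v w i j :
  tensor_coord f g (tens v w) 0 (mxvec_index i j) = f v 0 i * g w 0 j.
Proof. by rewrite /tensor_coord mxvecE mxE tensE coord_formE. Qed.

(** The forms [coord_form f g i j] span the bilinear forms, so an element of the
    dual is determined by its coordinates, and any coordinates are those of a
    combination of the [tens (ev i) (ew j)]. *)
Lemma tensor_coord_bij (f : {linear V -> 'rV[R[i]]_p}) (g : {linear W -> 'rV[R[i]]_q}) :
  bijective f -> bijective g -> bijective (tensor_coord f g).
Proof.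
move=> [f' Kf Kf'] [g' Kg Kg'].
pose ev i := f' (delta_mx 0 i); pose ew j := g' (delta_mx 0 j).
have bE (b : 'Hom(V, 'Hom(W, R[i]^o))) :
    b = \sum_i \sum_j (b (ev i) (ew j) : R[i]) *: coord_form f g i j.
  apply/lfunP => v; apply/lfunP => w.
  have vE : v = \sum_i f v 0 i *: ev i.
    apply: (can_inj Kf); rewrite linear_sum [LHS]row_sum_delta; apply: eq_bigr => i _.
    by rewrite linearZ /ev Kf'.
  have wE : w = \sum_j g w 0 j *: ew j.
    apply: (can_inj Kg); rewrite linear_sum [LHS]row_sum_delta; apply: eq_bigr => j _.
    by rewrite linearZ /ew Kg'.
  have bv : b v w = \sum_i (f v 0 i *: b (ev i)) w.
    by rewrite {1}vE linear_sum sum_lfunE; apply: eq_bigr => i _; rewrite linearZ.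
  rewrite bv sum_lfunE sum_lfunE; apply: eq_bigr => i _.
  rewrite scale_lfunE {1}wE linear_sum scaler_sumr sum_lfunE sum_lfunE; apply: eq_bigr => j _.
  rewrite linearZ scale_lfunE scale_lfunE coord_formE.
  by rewrite -[LHS]/(_ * (_ * _) : R[i]) -[RHS]/(_ * _ : R[i]); ring.
pose inv (r : 'rV_(p * q)) : tensor V W := \sum_i \sum_j (vec_mx r i j) *: tens (ev i) (ew j).
exists inv.
  move=> z; apply/lfunP => b; rewrite [in RHS](bE b) /inv sum_lfunE linear_sum; apply: eq_bigr => i _.
  rewrite sum_lfunE linear_sum; apply: eq_bigr => j _.
  by rewrite scale_lfunE linearZ tensE /tensor_coord mxvecK mxE; exact: mulrC.
move=> r; apply/rowP => k; case/mxvec_indexP: k => i j.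
have E i' j' : tensor_coord f g (vec_mx r i' j' *: tens (ev i') (ew j')) 0 (mxvec_index i j) =
    vec_mx r i' j' * ((i' == i)%:R * (j' == j)%:R).
  by rewrite linearZ mxE tensor_coord_tens /ev /ew Kf' Kg' !mxE !eqxx /= !(eq_sym i) !(eq_sym j).
rewrite /inv linear_sum summxE (bigD1 i)//= linear_sum summxE (bigD1 j)//= E !eqxx !mulr1 mxE.
rewrite big1 ?addr0 => [|j' j'j]; last by rewrite E (negPf j'j) !mulr0.
rewrite big1 ?addr0// => i' i'i; rewrite linear_sum summxE big1// => j' _.
by rewrite E (negPf i'i) mul0r mulr0.
Qed.

(** The coordinate forms of [f] and [g] are combinations of those of [f'] and
    [g'], with products of an entry of [a] and an entry of [b] as coefficients. *)
Lemma tensor_coord_trans (f f' : {linear V -> 'rV[R[i]]_p}) (g g' : {linear W -> 'rV[R[i]]_q})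
   (a : 'M[R[i]]_p) (b : 'M[R[i]]_q) :
  (forall v, f v = f' v *m a) -> (forall w, g w = g' w *m b) ->
  forall z, tensor_coord f g z = tensor_coord f' g' z *m lin_mx (fun M => a^T *m M *m b).
Proof.
move=> fE gE z.
have lM : linear (fun M : 'M[R[i]]_(p, q) => a^T *m M *m b).
  by move=> c M M'; rewrite linearP mulmxDl -scalemxAl.
pose L : {linear 'M[R[i]]_(p, q) -> 'M[R[i]]_(p, q)} := HB.pack (fun M : 'M[R[i]]_(p, q) => a^T *m M *m b)
   (GRing.isLinear.Build _ _ _ _ (fun M : 'M[R[i]]_(p, q) => a^T *m M *m b) lM).
rewrite /tensor_coord (mul_vec_lin L) /=; congr mxvec; apply/matrixP => i j; rewrite !mxE.
have -> : coord_form f g i j = \sum_l \sum_k (a k i * b l j) *: coord_form f' g' k l.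
  apply/lfunP => v; apply/lfunP => w; rewrite coord_formE fE gE !mxE mulr_sumr.
  rewrite !sum_lfunE; apply: eq_bigr => l _; rewrite sum_lfunE sum_lfunE mulr_suml; apply: eq_bigr => k _.
  by rewrite scale_lfunE scale_lfunE coord_formE -[RHS]/(_ * _ : R[i]); ring.
rewrite linear_sum; apply: eq_bigr => l _; rewrite linear_sum mxE mulr_suml; apply: eq_bigr => k _.
by rewrite linearZ !mxE -[LHS]/(_ * _ : R[i]); ring.
Qed.

Lemma lin_mx_sandwich (a : 'M[R[i]]_p) (b : 'M[R[i]]_q) k l i j :
  lin_mx (fun M : 'M[R[i]]_(p, q) => a^T *m M *m b) (mxvec_index k l) (mxvec_index i j) = a k i * b l j.
Proof.
rewrite /lin_mx /lin1_mx mxE /= vec_mx_delta mxvecE mxE (bigD1 l)//= [X in _ + X]big1 => [|l' l'l].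
  rewrite addr0 mxE (bigD1 k)//= [X in _ + X]big1 => [|k' k'k]; first by rewrite !mxE !eqxx mulr1 addr0.
  by rewrite !mxE (negPf k'k) mulr0.
rewrite mxE big1 ?mul0r// => k' _; by rewrite !mxE (negPf l'l) andbF mulr0.
Qed.

End TensorCoordinates.

Lemma conj_continuous (R : realType) : continuous (fun z : realify R R[i] => (z : R[i])^* : realify R R[i]).
Proof.
apply: (@lipschitz1_continuous _ (realify R R[i]) (realify R R[i])) => x y.
rewrite -lecR -[`|x - y|]/(realify_norm (x - y : realify R R[i])) realify_normE.
by rewrite realify_normE -rmorphB norm_conjC.
Qed.

Lemma conj_linear (R : realType) (a : R) (u v : realify R R[i]) :
  (((a *: u + v : realify R R[i]) : R[i])^* : realify R R[i]) = a *: ((u : R[i])^* : realify R R[i]) + ((v : R[i])^* : realify R R[i]).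
Proof.
rewrite -[LHS]/((a%:C * (u : R[i]) + (v : R[i]))^* : R[i]) rmorphD rmorphM /=.
by congr (_ * _ + _); apply/CrealP; rewrite complex_real.
Qed.

Section Ebar.
Variables (R : realType) (n : nat) (X : complexManifold R n).
Variable (E : holomorphicBundle X).
Local Notation Z := (realify R R[i]).

(** The transition functions are products of a holomorphic function and the
    conjugate of a holomorphic function: smooth, but no longer holomorphic. *)
Lemma E_Ebar_bundle : is_bundle (@smooth_on R n X) (E_Ebar E).
Proof.
have [cover bij trans] := bundleP E.
have bijc t x : trivs E t -> triv_dom t x -> bijective (conj_coord (triv_map t x)).
  move=> Et tx; have [f' Kf Kf'] := bij t Et x tx.
  exists (fun r => f' (map_mx Num.conj r) : conjugate (fiber E x)) => [v|r].
    by rewrite /conj_coord -[RHS](Kf v); congr f'; apply/rowP => j; rewrite !mxE conjCK.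
  by rewrite /conj_coord Kf'; apply/rowP => j; rewrite !mxE conjCK.
split.
- move=> x; have [t Et tx] := cover x.
  by exists (tensor_triv t (conj_triv t)) => //; exists t => //; exists (conj_triv t) => //; exists t.
- move=> _ [t Et [_ [u Eu <-] <-]] x [/= tx ux].
  by apply: tensor_coord_bij; [exact: bij|exact: bijc].
move=> _ _ [t1 Et1 [_ [u1 Eu1 <-] <-]] [t2 Et2 [_ [u2 Eu2 <-] <-]].
have [a [as_ aE]] := trans t1 t2 Et1 Et2; have [b [bs bE]] := trans u1 u2 Eu1 Eu2.
exists (fun x => lin_mx (fun M : 'M[R[i]]_(rank E, rank E) => (a x)^T *m M *m (map_mx Num.conj (b x)))); split.
  move=> k l; case/mxvec_indexP: k => k1 k2; case/mxvec_indexP: l => l1 l2 c Ac.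
  pose fa : Cn R n -> Z := fun z => a (chart_inv c z) k1 l1.
  pose fb : Cn R n -> Z := fun z => b (chart_inv c z) k2 l2.
  pose D := chart_image c ((triv_dom t1 `&` triv_dom u1) `&` (triv_dom t2 `&` triv_dom u2)).
  have oD : open D by apply: chart_image_open; do !apply: openI; exact: triv_dom_open.
  have sa : smooth_in D fa.
    by have [h _] := as_ k1 l1 c Ac; apply: smooth_in_sub h => z [cz [[? ?] [? ?]]].
  have sb : smooth_in D fb.
    by have [h _] := bs k2 l2 c Ac; apply: smooth_in_sub h => z [cz [[? ?] [? ?]]].
  have sbc := smooth_in_post oD (@conj_continuous R) (@conj_linear R) sb.
  apply: smooth_in_eq (smooth_inM oD sa sbc) => // z _ /=.
  by rewrite lin_mx_sandwich mxE.
move=> x [t1x u1x] [t2x u2x] z /=.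
apply: tensor_coord_trans => [v|w]; first exact: aE.
by rewrite /conj_coord -map_mxM /= -bE.
Qed.

End Ebar.

(** * Finite dimensionality of the space of holomorphic sections *)

Section FiniteDimension.
Variables (R : realType) (n : nat) (X : complexManifold R n) (X_compact : compact [set: X]).
Variable (E : holomorphicBundle X).
Local Notation Z := (realify R R[i]).
Local Notation loc c t j s := (local_coord c t j (holomorphic_section_val s)).

Lemma holomorphic_section_local (c : chart R X n) t j (s : holomorphic_section E) :
  atlas X c -> trivs E t -> holo (chart_image c (triv_dom t)) (loc c t j s).
Proof.
move=> Ac Et; have /asboolP := valP s; move=> /(_ _ Et j _ Ac) h.
exact: (holomorphic_holo h).
Qed.

Lemma holomorphic_section_eq0 (s : holomorphic_section E) :
  (forall x, exists2 t, trivs E t & triv_dom t x /\ forall j, section_coord t j s x = 0) -> s = 0.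
Proof.
have [_ bij _] := bundleP E.
move=> s0; apply: val_inj; apply: functional_extensionality_dep => x.
have [t Et [tx sx]] := s0 x; apply: (bij_inj (bij t Et x tx)); rewrite linear0.
by apply/rowP => j; rewrite mxE; exact: sx.
Qed.

(** The constant depends on the transition matrix at [z] only, not on the
    section. *)
Lemma local_coord_transition (t t' : trivialization (fiber E) (rank E)) (c c' : chart R X n) j z :
  trivs E t -> trivs E t' -> atlas X c -> atlas X c' ->
  chart_image c (triv_dom t) z -> triv_dom t' (chart_inv c z) -> chart_dom c' (chart_inv c z) ->
  exists2 C : R, 0 <= C & \forall y \near z, forall (s : holomorphic_section E) (K : R),
   (forall l, `|loc c' t' l s (chart_map c' (chart_inv c y))| <= K) -> `|loc c t j s y| <= C * K.
Proof.
move=> Et Et' Ac Ac' Dz t'z c'z.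
have [_ _ trans] := bundleP E; have [g [gs gE]] := trans t t' Et Et'.
pose D := chart_image c ((triv_dom t `&` triv_dom t') `&` chart_dom c').
have oD : open D.
  by apply: chart_image_open; apply: openI; [apply: openI; exact: triv_dom_open|exact: chart_dom_open].
have Dz' : D z by case: Dz => ? ?.
have sg l : smooth_in D ((fun y => g (chart_inv c y) l j) : Cn R n -> Z).
  by have [h _] := gs l j c Ac; apply: smooth_in_sub h => y [cy [[? ?] ?]].
pose gg l : Cn R n -> Z := fun y => g (chart_inv c y) l j.
exists (\sum_l (`|gg l z| + 1)); first by apply: sumr_ge0 => l _; rewrite addr_ge0.
have N : \forall y \near z, D y /\ forall l, `|gg l y| <= `|gg l z| + 1.
  apply: filterI; first by exact: open_nbhs_nbhs.
  apply: (@filter_forall _ _ _ (nbhs z) (nbhs_filter z)) => l.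
  have ca : gg l @ nbhs z --> gg l z by exact: smooth_in_cont (sg l) Dz'.
  exact: near_norm_bound ca.
apply: filterS N => y [Dy gy] s K sK.
have -> : loc c t j s y = \sum_l ((gg l y : R[i]) * loc c' t' l s (chart_map c' (chart_inv c y)) : Z).
  have [cy [[ty t'y] c'y]] := Dy.
  rewrite /local_coord /section_coord /= gE// mxE; apply: eq_bigr => l _.
  by rewrite chart_mapK// mulrC.
rewrite mulr_suml; apply: le_trans (ler_norm_sum _ _ _) _; apply: ler_sum => l _.
by rewrite realify_normM; apply: ler_pM => //; exact: sK.
Qed.

Section Net.
Variables (I : finType) (f : I -> patch E).
Hypothesis fP : forall x, exists i, patch_inner (f i) x.

Definition patch_loc i j (s : holomorphic_section E) : Cn R n -> Z :=
  loc (patch_chart (f i)) (patch_triv (f i)) j s.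

(** The sup norm over the inner balls, as a predicate. *)
Definition inner_bound (s : holomorphic_section E) (K : R) :=
  forall i z, `|z - patch_center (f i)| <= patch_radius (f i) -> forall j, `|patch_loc i j s z| <= K.

Lemma patch_loc_holo i j s : holo (chart_image (patch_chart (f i)) (triv_dom (patch_triv (f i)))) (patch_loc i j s).
Proof. by apply: holomorphic_section_local; [exact: patch_chartP|exact: patch_trivP]. Qed.

(** The larger ball is compact and covered by the inner balls of all patches,
    where the section is bounded by [K]; compactness bounds the entries of the
    transition matrices. *)
Lemma outer_bound1 i j : exists2 C : R, 0 <= C & forall s K, inner_bound s K -> 0 <= K ->
  forall z, `|z - patch_center (f i)| <= 2 * patch_radius (f i) -> `|patch_loc i j s z| <= C * K.
Proof.
pose P (A : set (Cn R n)) := exists2 C : R, 0 <= C & forall s K, inner_bound s K -> 0 <= K ->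
  forall z, A z -> `|patch_loc i j s z| <= C * K.
suff [C C0 CP] : P [set z | `|z - patch_center (f i)| <= 2 * patch_radius (f i)].
  by exists C => // s K sK K0 z zr; exact: CP.
apply: compact_local.
- exact: Cn_ball_compact.
- by exists 0.
- by move=> A A' AA [C C0 CP]; exists C => // s K sK K0 z /AA; exact: CP.
- move=> A A' [C C0 CP] [C' C'0 CP']; exists (C + C'); first exact: addr_ge0.
  move=> s K sK K0 z [Az|Az]; rewrite mulrDl.
    by apply: le_trans (CP s K sK K0 z Az) _; rewrite lerDl mulr_ge0.
  by apply: le_trans (CP' s K sK K0 z Az) _; rewrite lerDr mulr_ge0.
- move=> z zr; have Dz := patch_double_sub zr.
  have [i' [c'z zi']] := fP (chart_inv (patch_chart (f i)) z).
  have t'z : triv_dom (patch_triv (f i')) (chart_inv (patch_chart (f i)) z).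
    by have [] := patch_sub (ltW zi'); rewrite chart_mapK.
  have [C C0 CN] := local_coord_transition j (patch_trivP (f i)) (patch_trivP (f i'))
    (patch_chartP (f i)) (patch_chartP (f i')) Dz t'z c'z.
  have N : nbhs z (chart_image (patch_chart (f i)) (patch_inner (f i'))).
    apply: open_nbhs_nbhs; split; first by apply: chart_image_open; exact: patch_inner_open.
    by case: Dz => ? ?; split.
  eexists; first exact: (filterI CN N).
  exists C => // s K sK K0 y [_ [CNy [_ [_ yi]]]]; apply: CNy => l; apply: sK; exact: ltW.
Qed.

Lemma outer_bound : exists2 C : R, 0 < C & forall s K, inner_bound s K -> 0 <= K ->
  forall i j z, `|z - patch_center (f i)| <= 2 * patch_radius (f i) -> `|patch_loc i j s z| <= C * K.
Proof.
have H (ij : I * 'I_(rank E)) : exists C : R, 0 <= C /\ forall s K, inner_bound s K -> 0 <= K ->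
   forall z, `|z - patch_center (f ij.1)| <= 2 * patch_radius (f ij.1) -> `|patch_loc ij.1 ij.2 s z| <= C * K.
  by have [C C0 CP] := outer_bound1 ij.1 ij.2; exists C.
have [C CP] := choice H; exists (1 + \sum_ij C ij).
  by rewrite ltr_pwDl// sumr_ge0// => ij _; have [] := CP ij.
move=> s K sK K0 i j z zr; have [_ h] := CP (i, j); apply: le_trans (h s K sK K0 z zr) _.
rewrite ler_wpM2r//= (bigD1 (i, j))//= addrCA lerDl addr_ge0// sumr_ge0// => ij _.
by have [] := CP ij.
Qed.

Lemma ball_net (p : Cn R n) (r d : R) : 0 < d -> exists (J : finType) (q : J -> Cn R n),
  (forall j, `|q j - p| <= r) /\ forall z, `|z - p| <= r -> exists j, `|z - q j| < d.
Proof.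
move=> d0.
pose P (A : set (Cn R n)) := exists (J : finType) (q : J -> Cn R n),
  (forall j, `|q j - p| <= r) /\ forall z, A z -> exists j, `|z - q j| < d.
suff : P [set z | `|z - p| <= r] by [].
apply: compact_local.
- exact: Cn_ball_compact.
- by exists 'I_0, (fun i : 'I_0 => match i with Ordinal _ h => match notF h with end end); split=> [[]|].
- by move=> A A' AA [J [q [qp qA]]]; exists J, q; split=> // z /AA; exact: qA.
- move=> A A' [J [q [qp qA]]] [J' [q' [qp' qA']]].
  exists (J + J')%type, (fun s => match s with inl i => q i | inr j => q' j end); split; first by case.
  move=> z [Az|Az].
    by have [j h] := qA z Az; exists (inl j).
  by have [j h] := qA' z Az; exists (inr j).
- move=> z zr; exists [set y | `|y - z| < d].
    by apply: open_nbhs_nbhs; split; [exact: open_nball|rewrite /= subrr normr0].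
  by exists unit, (fun=> z); split=> // y [_ yz]; exists tt.
Qed.

Lemma inner_bound_exists s : exists2 K : R, 0 <= K & inner_bound s K.
Proof.
have H (ij : I * 'I_(rank E)) : exists C : R, 0 <= C /\
   forall z, `|z - patch_center (f ij.1)| <= patch_radius (f ij.1) -> `|patch_loc ij.1 ij.2 s z| <= C.
  have [hs _] := patch_loc_holo ij.1 ij.2 s.
  pose K := [set z : Cn R n | `|z - patch_center (f ij.1)| <= patch_radius (f ij.1)].
  have cf : {within K, continuous (patch_loc ij.1 ij.2 s)}.
    apply: continuous_in_subspaceT => y /set_mem Ky.
    by have [] := hs [::] y (patch_sub Ky).
  have /compact_bounded[M [_ Mf]] := continuous_compact cf (@Cn_ball_compact R n _ _).
  exists (Num.max 0 (M + 1)); split; first by rewrite le_max lexx.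
  move=> z Kz; rewrite le_max; apply/orP; right; apply: (Mf (M + 1)); first by rewrite ltrDl.
  by exists z.
have [C CP] := choice H; exists (\sum_ij C ij).
  by rewrite sumr_ge0// => ij _; have [] := CP ij.
move=> i z zr j; have [_ h] := CP (i, j); apply: le_trans (h z zr) _.
by rewrite /= (bigD1 (i, j))//= lerDl sumr_ge0// => ij _; have [] := CP ij.
Qed.

Lemma inner_bound0 s : inner_bound s 0 -> s = 0.
Proof.
move=> s0; apply: holomorphic_section_eq0 => x; have [i [cx xi]] := fP x.
have tx : triv_dom (patch_triv (f i)) x by have [] := patch_sub (ltW xi); rewrite chart_mapK.
exists (patch_triv (f i)); first exact: patch_trivP.
split=> // j; have := s0 i _ (ltW xi) j; rewrite normr_le0 /patch_loc /local_coord /= chart_mapK//.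
by move=> /eqP.
Qed.

(** If [s] vanishes on a net, the Schwarz lemma on the balls around the points
    of the net, which stay inside the outer balls, bounds [s] on the inner balls
    by half of the bound that is already known: [outer_bound] loses a factor
    [C], a net of mesh [eta] gains [sqrt eta]. Iterating gives [s = 0]. *)
Lemma finite_determination : exists (J : finType) (ix : J -> I * 'I_(rank E)) (q : J -> Cn R n),
  forall s, (forall a, patch_loc (ix a).1 (ix a).2 s (q a) = 0) -> s = 0.
Proof.
have [C C0 CP] := outer_bound.
(* Chosen so that C^2 eta <= 1/4. *)
pose eta : R := (4 * C ^+ 2 + 1)^-1.
have e1 : 1 < 4 * C ^+ 2 + 1 by rewrite ltrDr mulr_gt0// exprn_gt0.
have eta0 : 0 < eta by rewrite invr_gt0; apply: lt_trans e1.
have eta1 : eta < 1 by rewrite invf_lt1// (lt_trans ltr01 e1).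
have etaC : C ^+ 2 * eta <= 4^-1.
  rewrite ler_pdivrMr ?(lt_trans ltr01 e1)//; lra.
have /choice[Jq JqP] i : exists Jq : {J : finType & J -> Cn R n},
   (forall j, `|projT2 Jq j - patch_center (f i)| <= patch_radius (f i)) /\
   forall z, `|z - patch_center (f i)| <= patch_radius (f i) ->
     exists j, `|z - projT2 Jq j| < eta * patch_radius (f i).
  have [J [q qP]] := @ball_net (patch_center (f i)) (patch_radius (f i)) (eta * patch_radius (f i))
    (mulr_gt0 eta0 (patch_radius_gt0 (f i))).
  by exists (existT _ J q).
pose J : finType := ({i : I & projT1 (Jq i)} * 'I_(rank E))%type.
exists J, (fun a => (tag a.1, a.2)), (fun a => projT2 (Jq (tag a.1)) (tagged a.1)) => s s0.
have halve K : 0 <= K -> inner_bound s K -> inner_bound s (K / 2).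
  move=> K0 sK i z zr j; have [qc qn] := JqP i; have [a aq] := qn z zr.
  have h2 : `|patch_loc i j s z| ^+ 2 <= (C * K) ^+ 2 * eta.
    set q := projT2 (Jq i) a in aq.
    have inb y : ball q (patch_radius (f i)) y -> `|y - patch_center (f i)| <= 2 * patch_radius (f i).
      rewrite -ball_normE /= distrC => yq.
      have -> : y - patch_center (f i) = (y - q) + (q - patch_center (f i)) by rewrite addrA subrK.
      apply: le_trans (ler_normD _ _) _; rewrite mulr2n mulrDl mul1r lerD//; first exact: ltW.
      exact: qc.
    apply: (holo_equicontinuity _ (patch_loc_holo i j s) _ _ _ _ eta0 eta1 aq).
    - by apply: chart_image_open; exact: triv_dom_open.
    - by move=> y /inb; exact: patch_double_sub.
    - by rewrite mulr_ge0// ltW.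
    - by move=> y /inb; exact: CP.
    - exact: (s0 (Tagged (fun i => projT1 (Jq i)) a, j)).
  rewrite -(@ler_sqr _ _ (K / 2)) ?nnegrE ?divr_ge0//; apply: le_trans h2 _.
  rewrite exprMn mulrAC; apply: le_trans (ler_wpM2r (sqr_ge0 K) etaC) _.
  by rewrite expr_div_n mulrC -natrX.
have [K K0 sK] := inner_bound_exists s.
have iter m : inner_bound s (K / 2 ^+ m) /\ 0 <= K / 2 ^+ m.
  elim: m => [|m [IH IH0]]; first by rewrite expr0 divr1.
  by rewrite exprSr invfM mulrA; split; [exact: halve|rewrite divr_ge0].
apply: inner_bound0 => i z zr j; apply/ler_addgt0Pr => e e0; rewrite add0r.
have [m mK] : exists m : nat, K / 2 ^+ m < e.
  exists (Num.truncn (K / e)).+1; rewrite ltr_pdivrMr ?exprn_gt0// mulrC -ltr_pdivrMr//.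
  by apply: lt_trans (truncnS_gt _) _; rewrite -natrX ltr_nat ltn_expl.
by apply: le_trans (ltW mK); have [h _] := iter m; exact: h.
Qed.

End Net.

Lemma holomorphic_section_finite : exists (N : nat) (ev : 'I_N -> holomorphic_section E -> R[i]),
  (forall a b (u v : holomorphic_section E), ev a (b *: u + v) = b * ev a u + ev a v) /\
  forall s, (forall a, ev a s = 0) -> s = 0.
Proof.
have [cover _ _] := bundleP E.
have [I [f fP]] := patch_cover cover X_compact.
have [J [ix [q H]]] := finite_determination fP.
exists #|J|, (fun a s => patch_loc f (ix (enum_val a)).1 (ix (enum_val a)).2 s (q (enum_val a))); split.
  move=> a b u v; rewrite /patch_loc /local_coord /=.
  have := section_coord_linear (patch_triv (f (ix (enum_val a)).1)) (ix (enum_val a)).2 b u v.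
  by move=> /(congr1 (fun g => g (chart_inv (patch_chart (f (ix (enum_val a)).1)) (q (enum_val a))))).
by move=> s s0; apply: H => a; have := s0 (enum_rank a); rewrite enum_rankK.
Qed.

End FiniteDimension.

(** * Pointwise independence of tensor products of holomorphic sections *)

Section Wirtinger.
Variables (R : realType) (n : nat).
Local Notation Z := (realify R R[i]).
Implicit Types (D : set (Cn R n)).

Lemma iter_derive_lincomb (V : normedModType R) (D : set V) (I : Type) (r : seq I) (c : I -> R[i]) (f : I -> V -> Z) :
  open D -> (forall i, smooth_in D (f i)) -> forall vs x, D x ->
  iter_derive vs (fun y => \sum_(i <- r) (c i * (f i y : R[i]) : Z)) x =
  \sum_(i <- r) (c i * (iter_derive vs (f i) x : R[i]) : Z).
Proof.
move=> oD sf; elim=> [//|v vs IH] x Dx /=; apply: dlim_derive.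
apply: (@dlim_near _ _ _ (fun y => \sum_(i <- r) (c i * (iter_derive vs (f i) y : R[i]) : Z))).
  by near=> y; apply/esym/IH; near: y; exact: open_nbhs_nbhs.
apply: dlim_sum => i.
have d : dlim (iter_derive vs (f i)) x v ('D_v (iter_derive vs (f i)) x).
  by apply: derivable_dlim; have [_] := sf i vs x Dx.
by have := dlimM (dlim_cst (c i : Z) x v) d; rewrite mul0r add0r.
Unshelve. all: by end_near. Qed.

Lemma holo_lincomb D (I : Type) (r : seq I) (c : I -> R[i]) (f : I -> Cn R n -> Z) :
  open D -> (forall i, holo D (f i)) -> holo D (fun y => \sum_(i <- r) (c i * (f i y : R[i]) : Z)).
Proof.
move=> oD hf; split.
  apply: smooth_in_sum => // i; exact: (@smooth_inM R (Cn R n) D (fun=> c i : Z) (f i) oD (@smooth_in_cst R (Cn R n) Z D (c i : Z)) (hf i).1).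
move=> x Dx a v w.
have L (u : Cn R n) : 'D_u (fun y => \sum_(i <- r) (c i * (f i y : R[i]) : Z)) x =
    \sum_(i <- r) (c i * ('D_u (f i) x : R[i]) : Z).
  exact: (@iter_derive_lincomb _ D I r c f oD (fun i => (hf i).1) [:: u] x Dx).
apply: (etrans (L (a *: v + w : 'rV[R[i]]_n))).
apply: etrans (esym (congr2 (fun p q : Z => a * (p : R[i]) + q : Z) (L v) (L w))).
rewrite (@mulr_sumr R[i]) -(@big_split R[i]) /=; apply: eq_bigr => i _.
have -> := (hf i).2 x Dx a v w.
rewrite -[LHS]/(c i * (a * ('D_(v : Cn R n) (f i) x : R[i]) + ('D_(w : Cn R n) (f i) x : R[i])) : R[i]).
by rewrite mulrDr mulrCA.
Qed.

Lemma holo_deriveZ D (f : Cn R n -> Z) (a : R[i]) (v : 'rV[R[i]]_n) x : holo D f -> D x ->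
  'D_(a *: v : Cn R n) f x = (a * ('D_(v : Cn R n) f x : R[i]) : Z).
Proof.
move=> hf Dx; have := hf.2 x Dx a v (0 : 'rV[R[i]]_n).
by rewrite addr0 (holo_derive0 hf Dx) addr0.
Qed.

(** The combination of the derivative along [v] and [- i] times the derivative
    along [i v]: holomorphic factors contribute twice, the two contributions of
    a conjugate factor cancel. *)
Lemma wirtinger_cancel (I : Type) (r : seq I) (p q P Q : I -> R[i]) :
  \sum_(i <- r) (P i * (q i)^* + p i * (Q i)^*) = 0 ->
  \sum_(i <- r) ('i%C * P i * (q i)^* + p i * ('i%C * Q i)^*) = 0 ->
  \sum_(i <- r) P i * (q i)^* = 0.
Proof.
move=> h1.
rewrite (eq_bigr (fun i => 'i%C * (P i * (q i)^* - p i * (Q i)^*))); last first.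
  move=> i _; rewrite rmorphM /= (_ : ('i%C)^* = - 'i%C); last by rewrite -[LHS]/(Complex 0 (-1)) -[RHS]/(Complex (-0) (-1)) oppr0.
  by ring.
rewrite -mulr_sumr => /eqP; rewrite mulf_eq0 => /orP[/eqP i0|/eqP h2].
  by have := @sqr_i R; rewrite i0 expr0n => /eqP; rewrite eq_sym oppr_eq0 oner_eq0.
move: h1; rewrite big_split /=; move: h2; rewrite sumrB => /eqP; rewrite subr_eq0 => /eqP <- /eqP.
by rewrite -mulr2n mulrn_eq0 /= => /eqP.
Qed.

(** The operator [D_v - i D_(i v)] annihilates antiholomorphic functions, so it
    only differentiates the factors [phi i]. *)
Lemma wirtinger_product D (I : Type) (r : seq I) (phi g : I -> Cn R n -> Z) (v : 'rV[R[i]]_n) :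
  open D -> (forall i, holo D (phi i)) -> (forall i, holo D (g i)) ->
  (forall x, D x -> \sum_(i <- r) ((phi i x : R[i]) * (g i x : R[i])^* : Z) = 0) ->
  forall x, D x -> \sum_(i <- r) (('D_(v : Cn R n) (phi i) x : R[i]) * (g i x : R[i])^* : Z) = 0.
Proof.
move=> oD hphi hg H x Dx.
have dd (w : Cn R n) : \sum_(i <- r) ((('D_w (phi i) x : R[i]) * (g i x : R[i])^* +
    (phi i x : R[i]) * ('D_w (g i) x : R[i])^*) : Z) = 0.
  have h : dlim (fun y => \sum_(i <- r) ((phi i y : R[i]) * (g i y : R[i])^* : Z)) x w
     (\sum_(i <- r) ((('D_w (phi i) x : R[i]) * (g i x : R[i])^* +
      (phi i x : R[i]) * ('D_w (g i) x : R[i])^*) : Z)).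
    apply: dlim_sum => i.
    have d1 := @smooth_in_dlim _ _ _ D (phi i) x w (hphi i).1 Dx.
    have d2 := dlim_post (@conj_continuous R) (@conj_linear R) (@smooth_in_dlim _ _ _ D (g i) x w (hg i).1 Dx).
    exact: (dlimM d1 d2).
  apply: (dlim_unique h); apply: (@dlim_near _ _ _ (fun=> 0)); last exact: dlim_cst.
  by near=> y; apply/esym/H; near: y; exact: open_nbhs_nbhs.
have Ei i : 'D_(('i%C *: v : 'rV[R[i]]_n) : Cn R n) (phi i) x = ('i%C * ('D_(v : Cn R n) (phi i) x : R[i]) : Z).
  exact: holo_deriveZ (hphi i) Dx.
have Eg i : 'D_(('i%C *: v : 'rV[R[i]]_n) : Cn R n) (g i) x = ('i%C * ('D_(v : Cn R n) (g i) x : R[i]) : Z).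
  exact: holo_deriveZ (hg i) Dx.
apply: (@wirtinger_cancel I r (fun i => phi i x) (fun i => g i x) (fun i => 'D_(v : Cn R n) (phi i) x)
  (fun i => 'D_(v : Cn R n) (g i) x) (dd v)).
rewrite -[RHS](dd ('i%C *: v : 'rV[R[i]]_n)); apply: eq_bigr => i _.
by rewrite Ei Eg.
Unshelve. all: by end_near. Qed.

Lemma wirtinger_iter D (I : Type) (r : seq I) (phi g : I -> Cn R n -> Z) (v : 'rV[R[i]]_n) :
  open D -> (forall i, holo D (phi i)) -> (forall i, holo D (g i)) ->
  (forall x, D x -> \sum_(i <- r) ((phi i x : R[i]) * (g i x : R[i])^* : Z) = 0) ->
  forall k x, D x -> \sum_(i <- r) ((iter_derive (nseq k (v : Cn R n)) (phi i) x : R[i]) * (g i x : R[i])^* : Z) = 0.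
Proof.
move=> oD hphi hg H; elim=> [//|k IH] x Dx.
apply: (@wirtinger_product D I r (fun i => iter_derive (nseq k (v : Cn R n)) (phi i)) g v oD _ hg IH x Dx) => i.
exact: holo_iter.
Qed.

End Wirtinger.

Lemma holomorphic_coord_sum (R : realType) n (X : complexManifold R n) (E : holomorphicBundle X)
  (I : Type) (r : seq I) (a : I -> R[i]) (e : I -> holomorphic_section E) t b x :
  section_coord t b (\sum_(i <- r) a i *: e i) x = \sum_(i <- r) a i * section_coord t b (e i) x.
Proof.
elim: r => [|i r IH]; first by rewrite !big_nil (section_coord0 t b).
rewrite !big_cons -IH.
by have := section_coord_linear t b (a i) (e i) (\sum_(j <- r) a j *: e j) => /(congr1 (fun g => g x)).
Qed.

Section Independence.
Variables (R : realType) (n : nat) (X : complexManifold R n) (X_connected : connected [set: X]).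
Variable (E : holomorphicBundle X).
Local Notation Z := (realify R R[i]).
Local Notation loc c t j s := (local_coord c t j (holomorphic_section_val s)).

(** Asking that the section vanish near the point, and not just that all its
    derivatives vanish there, makes this set open by definition; that it is
    closed is the identity theorem. *)
Definition germ_zero (s : holomorphic_section E) : set X :=
  [set x | nbhs x [set y | holomorphic_section_val s y = 0]].

Lemma germ_zero_coord (s : holomorphic_section E) c t x : atlas X c -> trivs E t -> chart_dom c x -> triv_dom t x ->
  (\forall z \near chart_map c x, forall j, loc c t j s z = 0) -> germ_zero s x.
Proof.
move=> Ac Et cx tx h; have [_ bij _] := bundleP E.
have Dx := chart_triv_image cx tx.
have : nbhs (chart_map c x) (chart_image c (triv_dom t)).
  by apply: open_nbhs_nbhs; split=> //; apply: chart_image_open; exact: triv_dom_open.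
move=> N.
have /nbhs_ballP[r /= r0 VP] : nbhs (chart_map c x) [set z | (forall j, loc c t j s z = 0) /\
   chart_image c (triv_dom t) z] by exact: filterI.
set V := ball _ _ in VP; have oV : open V by exact: ball_open.
have Vx : V (chart_map c x) by exact: ballxx.
have : nbhs x (chart_preimage c V).
  by apply: open_nbhs_nbhs; split; [exact: chart_preimage_open|].
apply: filterS => y [cy /VP [h0 [_ ty]]].
rewrite chart_mapK// in ty; apply: (bij_inj (bij t Et y ty)); rewrite linear0.
apply/rowP => j; rewrite mxE; have := h0 j; rewrite /local_coord /= chart_mapK//.
Qed.

Lemma germ_zero_ball (s : holomorphic_section E) c t p rho q : atlas X c -> trivs E t ->
  ball p rho `<=` chart_image c (triv_dom t) ->
  (forall j w k, iter_derive (nseq k w) (loc c t j s) p = 0) -> ball p rho q ->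
  germ_zero s (chart_inv c q).
Proof.
move=> Ac Et pD s0 pq; have [cq tq] := pD q pq.
apply: (germ_zero_coord Ac Et) => //; first exact: chart_invP.
rewrite chart_invK//.
have : nbhs q (ball p rho) by apply: open_nbhs_nbhs; split=> //; exact: ball_open.
apply: filterS => z zB j.
apply: (holo_identity_ball _ (holomorphic_section_local j s Ac Et) pD (s0 j) zB).
by apply: chart_image_open; exact: triv_dom_open.
Qed.

Lemma germ_zero_jet (s : holomorphic_section E) c t q : atlas X c -> trivs E t ->
  chart_image c (triv_dom t) q -> germ_zero s (chart_inv c q) ->
  forall j vs, iter_derive vs (loc c t j s) q = 0.
Proof.
move=> Ac Et Dq; rewrite /germ_zero /= nbhsE => -[V [oV Vq] VP] j vs.
pose D := chart_image c V.
have oD : open D by exact: chart_image_open.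
have Dq' : D q by case: Dq.
rewrite (iter_derive_eq (g := fun=> 0 : Z) oD _ vs Dq').
  elim: vs q {Dq Vq Dq'} => [//|v vs IH] q /=.
  by apply: dlim_derive; rewrite (_ : iter_derive vs _ = fun=> 0); [exact: dlim_cst|apply/funext].
move=> z [_ /VP]; rewrite /local_coord /section_coord /= => ->; by rewrite linear0 mxE.
Qed.

(** If [x] is in the closure of the set where the germ of [s] vanishes, a point
    of this set close to [x] is the center of a coordinate ball that contains
    [x], and [holo_identity_ball] applies on this ball. *)
Lemma section_identity (s : holomorphic_section E) x : germ_zero s x -> s = 0.
Proof.
move=> sx; have [cover _ _] := bundleP E.
have og : open (germ_zero s).
  rewrite openE => y; rewrite /germ_zero /= nbhsE => -[V [oV Vy] VP].
  apply: (@filterS _ _ _ V); last exact: open_nbhs_nbhs.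
  by move=> z Vz; apply: (filterS VP); exact: open_nbhs_nbhs.
suff gT : germ_zero s = setT.
  apply: val_inj; apply: functional_extensionality_dep => y.
  have : germ_zero s y by rewrite gT.
  by move=> /nbhs_singleton.
apply: X_connected; first by exists x.
  by exists (germ_zero s) => //; rewrite setTI.
exists (germ_zero s); last by rewrite setTI.
move=> y cy; have [t Et ty] := cover y; have [c Ac cy'] := atlas_cover y.
have oD : open (chart_image c (triv_dom t)) by apply: chart_image_open; exact: triv_dom_open.
have Dy := chart_triv_image cy' ty.
have /nbhs_ballP[r /= r0 rD] : nbhs (chart_map c y) (chart_image c (triv_dom t)) by exact: open_nbhs_nbhs.
have r2 : 0 < r / 2 by rewrite divr_gt0.
have N : nbhs y (chart_preimage c (ball (chart_map c y) (r / 2))).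
  apply: open_nbhs_nbhs; split; first by apply: chart_preimage_open; exact: ball_open.
  by split=> //; exact: ballxx.
have [z [gz [cz zB]]] := cy _ N.
have sub : ball (chart_map c z) (r / 2) `<=` chart_image c (triv_dom t).
  by move=> w wB; apply: rD; rewrite [r]splitr; exact: ball_triangle zB wB.
rewrite -(chart_mapK cy'); apply: (germ_zero_ball Ac Et sub); last exact: ball_sym.
move=> j w k; apply: germ_zero_jet => //; first by apply: sub; exact: ballxx.
by rewrite chart_mapK.
Qed.

(** Fix [x] and a coordinate [b] at [x]. In coordinates, the hypothesis says
    that the sum of the products of the holomorphic [phi i] and the conjugates
    of the holomorphic [g i] vanishes. Differentiate it holomorphically any
    number of times at [x]: the section [sum_i (sum_j A_ij conj e_j(x)_b) e_i]
    vanishes there to infinite order, hence everywhere. Independence of the [e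
    i] makes its coefficients vanish for all [x] and [b], and after conjugation
    independence of the [e j] gives [A = 0]. *)
Lemma tensor_independence (d : nat) (e : 'I_d -> holomorphic_section E) (A : 'M[R[i]]_d) :
  (forall a : 'I_d -> R[i], \sum_i a i *: e i = 0 -> forall i, a i = 0) ->
  (forall x t, trivs E t -> triv_dom t x -> forall a b, \sum_i \sum_j A i j *
     (section_coord t a (e i) x * (section_coord t b (e j) x)^*) = 0) -> A = 0.
Proof.
move=> fe HA; have [cover bij _] := bundleP E.
have coordS a t b x := @holomorphic_coord_sum _ _ _ E _ (index_enum 'I_d) a e t b x.
have key x t b i : trivs E t -> triv_dom t x -> \sum_j A i j * (section_coord t b (e j) x)^* = 0.
  move=> Et tx; apply: (fe (fun i => \sum_j A i j * (section_coord t b (e j) x)^*)).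
  set s := \sum_i _.
  have [c Ac cx] := atlas_cover x.
  have oD : open (chart_image c (triv_dom t)) by apply: chart_image_open; exact: triv_dom_open.
  have Dx := chart_triv_image cx tx.
  have /nbhs_ballP[r /= r0 rD] : nbhs (chart_map c x) (chart_image c (triv_dom t)) by exact: open_nbhs_nbhs.
  apply: (@section_identity s x).
  rewrite -(chart_mapK cx); apply: (germ_zero_ball Ac Et rD); last exact: ballxx.
  move=> a w k.
  pose phi i : Cn R n -> Z := loc c t a (e i).
  pose g i : Cn R n -> Z := fun z => \sum_j ((A i j)^* * (loc c t b (e j) z : R[i]) : Z).
  have hphi l : holo (chart_image c (triv_dom t)) (phi l) by exact: holomorphic_section_local.
  have hg l : holo (chart_image c (triv_dom t)) (g l).
    exact: (@holo_lincomb R n _ _ _ (fun j => (A l j)^*) (fun j => loc c t b (e j)) oD (fun m => holomorphic_section_local b (e m) Ac Et)).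
  have H z : chart_image c (triv_dom t) z -> \sum_i ((phi i z : R[i]) * (g i z : R[i])^* : Z) = 0.
    move=> [cz tz]; rewrite -[RHS](HA _ t Et tz a b); apply: eq_bigr => l _.
    rewrite /g (@raddf_sum R[i]) /= mulr_sumr; apply: eq_bigr => m _.
    rewrite rmorphM /= conjCK; rewrite /phi /local_coord /=; ring.
  have W := wirtinger_iter (w : 'rV[R[i]]_n) oD hphi hg H k Dx.
  have -> : loc c t a s = fun z => \sum_i ((\sum_j A i j * (section_coord t b (e j) x)^*) * (phi i z : R[i]) : Z).
    by apply/funext => z; rewrite /local_coord /= coordS.
  rewrite (iter_derive_lincomb _ _ oD (fun i => (hphi i).1) _ Dx) -[RHS]W; apply: eq_bigr => l _.
  rewrite mulrC; congr (_ * _ : R[i]); rewrite /g (@raddf_sum R[i]) /=; apply: eq_bigr => m _.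
  by rewrite rmorphM /= conjCK /local_coord /= chart_mapK.
apply/matrixP => i j; rewrite mxE; apply: (can_inj conjCK); rewrite rmorph0.
apply: (fe (fun j => (A i j)^*)); apply: holomorphic_section_eq0 => x; have [t Et tx] := cover x.
exists t => //; split=> // b; rewrite coordS; apply: (can_inj conjCK); rewrite rmorph0 raddf_sum /=.
by rewrite -[RHS](key x t b i Et tx); apply: eq_bigr => m _; rewrite rmorphM /= conjCK.
Qed.

End Independence.

(** * Inner products and their Gram matrices *)

Section ConjugateTranspose.
Variable R : realType.
Local Notation C := R[i].

Definition ctr m n (A : 'M[C]_(m, n)) : 'M[C]_(n, m) := map_mx Num.conj A^T.

Lemma ctrE m n (A : 'M[C]_(m, n)) i j : ctr A i j = (A j i)^*.
Proof. by rewrite !mxE. Qed.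

Lemma ctrM m n p (A : 'M[C]_(m, n)) (B : 'M[C]_(n, p)) : ctr (A *m B) = ctr B *m ctr A.
Proof. by rewrite /ctr trmx_mul map_mxM. Qed.

Lemma ctr_inv n (A : 'M[C]_n) : ctr (invmx A) = invmx (ctr A).
Proof. by rewrite /ctr trmx_inv map_invmx. Qed.

(** The Hermitian part: a real linear projection onto Hermitian matrices, which
    extends to all matrices the constructions that only make sense for these. *)
Definition herm n (A : 'M[C]_n) : 'M[C]_n := 2^-1 *: (A + ctr A).

Lemma ctr_herm n (A : 'M[C]_n) : ctr (herm A) = herm A.
Proof.
apply/matrixP => i j; rewrite !mxE rmorphM rmorphD /= conjCK addrC; congr (_ * _).
by apply/CrealP/ger0_real; rewrite invr_ge0 ler0n.
Qed.

Lemma herm_id n (A : 'M[C]_n) : ctr A = A -> herm A = A.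
Proof.
move=> AA; rewrite /herm AA; apply/matrixP => i j; rewrite !mxE.
by rewrite -[A i j + A i j]mulr2n -[A i j *+ 2]mulr_natl mulKf// pnatr_eq0.
Qed.

End ConjugateTranspose.

Section InnerProductAlgebra.
Variables (R : realType) (V : lmodType R[i]).
Local Notation C := R[i].
Local Notation IP := (inner_product V).
Implicit Types h : IP.

Lemma ip_linear h (a : C) u v w : inner_product_val h (a *: u + v) w = a * inner_product_val h u w + inner_product_val h v w.
Proof. by have /asboolP[hl _] := valP h; exact: hl. Qed.

Lemma ip_sym h u v : inner_product_val h v u = (inner_product_val h u v)^*.
Proof. by have /asboolP[_ hs] := valP h; exact: hs. Qed.

Lemma ip0l h w : inner_product_val h 0 w = 0.
Proof. by have := ip_linear h (-1) 0 0 w; rewrite scaler0 addr0 mulN1r addNr. Qed.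

Lemma ip_suml h (I : Type) (r : seq I) (a : I -> C) (u : I -> V) w :
  inner_product_val h (\sum_(i <- r) a i *: u i) w = \sum_(i <- r) a i * inner_product_val h (u i) w.
Proof.
elim: r => [|i r IH]; first by rewrite !big_nil ip0l.
by rewrite !big_cons ip_linear IH.
Qed.

Lemma ip_sumr h (I : Type) (r : seq I) (a : I -> C) (u : I -> V) w :
  inner_product_val h w (\sum_(i <- r) a i *: u i) = \sum_(i <- r) (a i)^* * inner_product_val h w (u i).
Proof.
rewrite ip_sym ip_suml rmorph_sum; apply: eq_bigr => i _.
by rewrite rmorphM /= -ip_sym.
Qed.

Lemma ip_sum2 h (I : finType) (a b : I -> C) (u : I -> V) :
  inner_product_val h (\sum_i a i *: u i) (\sum_j b j *: u j) =
  \sum_i \sum_j a i * (b j)^* * inner_product_val h (u i) (u j).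
Proof.
rewrite ip_suml; apply: eq_bigr => i _; rewrite ip_sumr mulr_sumr; apply: eq_bigr => j _.
by rewrite mulrA.
Qed.

Definition linearly_independent d (e : 'I_d -> V) :=
  forall a : 'I_d -> C, \sum_i a i *: e i = 0 -> forall i, a i = 0.

Lemma orthonormal_coef h d (s : 'I_d -> V) (a : 'I_d -> C) :
  (forall i j, inner_product_val h (s i) (s j) = (i == j)%:R) ->
  forall j, inner_product_val h (\sum_i a i *: s i) (s j) = a j.
Proof.
move=> hs j; rewrite ip_suml (bigD1 j)//= hs eqxx mulr1 big1 ?addr0// => i ij.
by rewrite hs (negPf ij) mulr0.
Qed.

Lemma orthonormal_free h d (s : 'I_d -> V) :
  (forall i j, inner_product_val h (s i) (s j) = (i == j)%:R) -> linearly_independent s.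
Proof. by move=> hs a a0 i; rewrite -(orthonormal_coef a hs) a0 ip0l. Qed.

Section FiniteDimensional.
Variables (N : nat) (ev : 'I_N -> V -> C).
Hypothesis ev_linear : forall a b u v, ev a (b *: u + v) = b * ev a u + ev a v.
Hypothesis ev_inj : forall v, (forall a, ev a v = 0) -> v = 0.

Lemma ev0 a : ev a 0 = 0.
Proof. by have := ev_linear a (-1) 0 0; rewrite scaler0 addr0 mulN1r addNr. Qed.

Lemma ev_sum a (I : Type) (r : seq I) (c : I -> C) (u : I -> V) :
  ev a (\sum_(i <- r) c i *: u i) = \sum_(i <- r) c i * ev a (u i).
Proof.
elim: r => [|i r IH]; first by rewrite !big_nil ev0.
by rewrite !big_cons ev_linear IH.
Qed.

(** The functionals [ev] embed the space into a space of row vectors of length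
    [N]. *)
Lemma free_size d (e : 'I_d -> V) : linearly_independent e -> (d <= N)%N.
Proof.
move=> fe; pose M : 'M[C]_(d, N) := \matrix_(i, a) ev a (e i).
suff /eqP <- : row_free M by exact: rank_leq_col.
rewrite -kermx_eq0; apply/rowV0P => u /sub_kermxP uM; apply/rowP => i; rewrite mxE.
apply: (fe (fun i => u 0 i)); apply: ev_inj => a; rewrite ev_sum.
have := congr1 (fun w : 'rV_N => w 0 a) uM; rewrite mxE [RHS]mxE => uMa.
by rewrite -[RHS]uMa; apply: eq_bigr => j _; rewrite mxE.
Qed.

(** Orthonormal families are independent, so their length is bounded by
    [free_size]. One of maximal length spans: the component of a vector
    orthogonal to it could be normalized and added to it. *)
Lemma orthonormal_basis_exists h : @positive_definite R V h ->
  exists d (s : 'I_d -> V), orthonormal_basis h s.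
Proof.
move=> hp.
pose Q d := `[< exists s : 'I_d -> V, forall i j, inner_product_val h (s i) (s j) = (i == j)%:R >].
have Q0 : exists d, Q d.
  exists 0%N; apply/asboolP.
  by exists (fun i : 'I_0 => match i with Ordinal _ h => match notF h with end end) => -[].
have QN d : Q d -> (d <= N)%N.
  by move=> /asboolP[s hs]; apply: (@free_size d s); exact: (@orthonormal_free h).
have [d /asboolP[s hs] dmax] := ex_maxnP Q0 QN.
exists d, s; split=> // v; exists (fun i => inner_product_val h v (s i)).
apply/eqP; rewrite -subr_eq0; set w := _ - _.
apply/negPn/negP => w0.
have ws j : inner_product_val h w (s j) = 0.
  rewrite /w -scaleN1r addrC ip_linear (orthonormal_coef _ hs).
  by rewrite mulN1r addNr.
have wp := hp w w0.
pose c := inner_product_val h w w; have cR : c \is Num.real by rewrite realE (ltW wp).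
have [r r0 rc] : exists2 r : C, 0 < r & r * r^* * c = 1.
  exists (sqrtC c)^-1; first by rewrite invr_gt0 sqrtC_gt0.
  have cs : (sqrtC c)^* = sqrtC c by apply/CrealP/ger0_real; rewrite sqrtC_ge0 ltW.
  by rewrite fmorphV /= cs -invfM -expr2 sqrtCK mulVf// gt_eqF.
pose s' (i : 'I_d.+1) : V := if unlift ord0 i is Some j then s j else r *: w.
have : Q d.+1.
  apply/asboolP; exists s' => i j; rewrite /s'.
  have rw u : inner_product_val h (r *: w) u = r * inner_product_val h w u.
    by rewrite -[r *: w]addr0 ip_linear ip0l addr0.
  case: (unliftP ord0 i) => [i'|] ->; case: (unliftP ord0 j) => [j'|] ->.
  - by rewrite hs (inj_eq lift_inj).
  - by rewrite ip_sym rw ws mulr0 rmorph0.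
  - by rewrite rw ws mulr0.
  - by rewrite rw ip_sym rw rmorphM /= -ip_sym mulrA rc.
by move=> /dmax; rewrite ltnn.
Qed.

Lemma standard_ip_subproof :
  (fun u v => \sum_a ev a u * (ev a v)^* : C) \in @inner_product_pred R V.
Proof.
apply/asboolP; split=> [v b u1 u2|u v].
  by rewrite mulr_sumr -big_split; apply: eq_bigr => a _; rewrite ev_linear mulrDl mulrA.
by rewrite rmorph_sum; apply: eq_bigr => a _; rewrite rmorphM /= conjCK mulrC.
Qed.

Lemma positive_definite_exists : exists h : IP, positive_definite h.
Proof.
exists (InnerProduct standard_ip_subproof) => v v0 /=.
have : exists a, ev a v != 0.
  apply: contrapT => H; move/eqP: v0; apply; apply: ev_inj => a.
  by apply/eqP/negPn/negP => a0; apply: H; exists a.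
move=> [a a0]; rewrite (bigD1 a)//= ltr_pwDl//; first by rewrite mul_conjC_gt0.
by apply: sumr_ge0 => b _; exact: mul_conjC_ge0.
Qed.

End FiniteDimensional.

Section Coordinates.
Variables (d : nat) (e : 'I_d -> V) (coord : 'I_d -> V -> C).
Hypothesis e_free : linearly_independent e.
Hypothesis coordP : forall v, v = \sum_i coord i v *: e i.

Lemma coord_uniq (a : 'I_d -> C) i : coord i (\sum_j a j *: e j) = a i.
Proof.
apply/eqP; rewrite -subr_eq0; apply/eqP.
apply: (e_free (a := fun i => coord i (\sum_j a j *: e j) - a i)).
under eq_bigr do rewrite scalerBl.
by rewrite sumrB -coordP subrr.
Qed.

Lemma coord_linear i a u v : coord i (a *: u + v) = a * coord i u + coord i v.
Proof.
rewrite {1}(coordP u) {1}(coordP v) scaler_sumr -big_split /=.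
under eq_bigr do rewrite scalerA -scalerDl.
exact: coord_uniq.
Qed.

Lemma coord_basis i j : coord i (e j) = (i == j)%:R.
Proof.
rewrite -(coord_uniq (fun k => (k == j)%:R) i); congr (coord i _).
rewrite (bigD1 j)//= eqxx scale1r big1 ?addr0// => k kj.
by rewrite (negPf kj) scale0r.
Qed.

Definition gram h : 'M[C]_d := \matrix_(i, j) inner_product_val h (e i) (e j).

Lemma ip_gram h u v : inner_product_val h u v = \sum_i \sum_j coord i u * (coord j v)^* * gram h i j.
Proof.
rewrite {1}(coordP u) {1}(coordP v) ip_sum2; apply: eq_bigr => i _; apply: eq_bigr => j _.
by rewrite mxE.
Qed.

Lemma ctr_gram h : ctr (gram h) = gram h.
Proof. by apply/matrixP => i j; rewrite ctrE !mxE -ip_sym. Qed.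

Lemma form_of_subproof (M : 'M[C]_d) :
  (fun u v => \sum_i \sum_j coord i u * (coord j v)^* * herm M i j : C) \in @inner_product_pred R V.
Proof.
apply/asboolP; split=> [v b u1 u2|u v].
  rewrite mulr_sumr -big_split; apply: eq_bigr => i _; rewrite mulr_sumr -big_split; apply: eq_bigr => j _.
  by rewrite /= coord_linear; ring.
rewrite rmorph_sum exchange_big; apply: eq_bigr => i _; rewrite rmorph_sum; apply: eq_bigr => j _.
by rewrite /= !rmorphM /= conjCK -{1}(ctr_herm M) ctrE; congr (_ * _); rewrite mulrC.
Qed.

(** Defined for every matrix through its Hermitian part, so that it is real
    linear. *)
Definition form_of (M : 'M[C]_d) : IP := InnerProduct (form_of_subproof M).

Lemma form_ofE M u v : inner_product_val (form_of M) u v = \sum_i \sum_j coord i u * (coord j v)^* * herm M i j.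
Proof. by []. Qed.

Lemma gram_form_of M : gram (form_of M) = herm M.
Proof.
have D (F : 'I_d -> C) k0 : \sum_k (k == k0)%:R * F k = F k0.
  by rewrite (bigD1 k0)//= eqxx mul1r big1 ?addr0// => k /negPf ->; rewrite mul0r.
apply/matrixP => i j; rewrite mxE form_ofE.
transitivity (\sum_k (k == i)%:R * (\sum_l (l == j)%:R * herm M k l)); last first.
  rewrite (D (fun k => \sum_l (l == j)%:R * herm M k l)); exact: (D (herm M i)).
apply: eq_bigr => k _; rewrite mulr_sumr; apply: eq_bigr => l _.
by rewrite !coord_basis rmorph_nat mulrA.
Qed.

Lemma gram_inj h h' : gram h = gram h' -> h = h'.
Proof.
move=> hh; apply: val_inj; apply/funext => u; apply/funext => v.
by rewrite -[LHS]/(inner_product_val h u v) -[RHS]/(inner_product_val h' u v) !ip_gram hh.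
Qed.

Lemma form_of_gram h : form_of (gram h) = h.
Proof. by apply: gram_inj; rewrite gram_form_of herm_id// ctr_gram. Qed.

(** A row vector killed by the Gram matrix gives an isotropic vector. *)
Lemma gram_unit h : positive_definite h -> gram h \in unitmx.
Proof.
move=> hp; rewrite -row_free_unit -kermx_eq0; apply/rowV0P => u /sub_kermxP uM.
have uE : inner_product_val h (\sum_i u 0 i *: e i) (\sum_i u 0 i *: e i) = 0.
  rewrite ip_sum2 exchange_big big1// => j _.
  under eq_bigr do rewrite mulrAC.
  rewrite -mulr_suml; have := congr1 (fun w : 'rV_d => w 0 j) uM; rewrite !mxE.
  under eq_bigr do rewrite mxE.
  by move=> ->; rewrite mul0r.
have v0 : \sum_i u 0 i *: e i = 0.
  by apply/eqP/negPn/negP => /hp; rewrite uE ltxx.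
by apply/rowP => i; rewrite mxE; exact: (e_free v0).
Qed.

(** For a row vector [c] put [b = c G^-1], where [G] is the Gram matrix of [h]:
    the value at [c] of the form with matrix [G^-1] is the value at [b] of the
    form with matrix [G]. *)
Lemma positive_definite_inv h : positive_definite h -> positive_definite (form_of (invmx (gram h))).
Proof.
move=> hp v v0; have gu := gram_unit hp.
have hK : ctr (invmx (gram h)) = invmx (gram h) by rewrite ctr_inv ctr_gram.
rewrite ip_gram gram_form_of (herm_id hK).
pose c : 'rV[C]_d := \row_i coord i v.
have E (M : 'M[C]_d) (b : 'rV[C]_d) : (b *m M *m ctr b) 0 0 = \sum_i \sum_j b 0 i * (b 0 j)^* * M i j.
  rewrite mxE exchange_big; apply: eq_bigr => j _; rewrite mxE ctrE mulr_suml; apply: eq_bigr => i _.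
  by rewrite mulrAC.
have -> : \sum_i \sum_j coord i v * (coord j v)^* * invmx (gram h) i j = (c *m invmx (gram h) *m ctr c) 0 0.
  by rewrite E; apply: eq_bigr => i _; apply: eq_bigr => j _; rewrite !mxE.
pose b := c *m invmx (gram h).
have -> : c *m invmx (gram h) *m ctr c = b *m gram h *m ctr b.
  by rewrite /b ctrM hK !mulmxA mulmxKV.
have bv : \sum_i \sum_j b 0 i * (b 0 j)^* * gram h i j = inner_product_val h (\sum_i b 0 i *: e i) (\sum_i b 0 i *: e i).
  by rewrite ip_sum2; apply: eq_bigr => i _; apply: eq_bigr => j _; rewrite [gram h i j]mxE.
rewrite E bv; apply: hp; apply: contra_neq v0 => /e_free b0.
have : b = 0 by apply/rowP => i; rewrite b0 [RHS]mxE.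
move=> /(congr1 (mulmx^~ (gram h))); rewrite /b mulmxKV// mul0mx => c0.
rewrite (coordP v) big1// => i _; have := congr1 (fun w : 'rV_d => w 0 i) c0.
by rewrite !mxE => ->; rewrite scale0r.
Qed.

(** Let [T] express [s] through [e], and let [T'] express [e] through [s]; these
    are inverse to each other. Orthonormality of [s] says that [T G ctr T] is
    the identity, where [G] is the Gram matrix of [h], so that [ctr T T] inverts
    [G]. *)
Lemma gram_orthonormal h m (s : 'I_m -> V) : orthonormal_basis h s ->
  forall i l, \sum_j coord i (s j) * (coord l (s j))^* = invmx (gram h) l i.
Proof.
move=> [hs sp] i l.
pose T : 'M[C]_(m, d) := \matrix_(j, i) coord i (s j).
pose T' : 'M[C]_(d, m) := \matrix_(i, j) inner_product_val h (e i) (s j).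
have sE v : v = \sum_j inner_product_val h v (s j) *: s j.
  have [a av] := sp v; rewrite {1}av; apply: eq_bigr => j _.
  by rewrite av (orthonormal_coef _ hs).
have TT' : T' *m T = 1%:M.
  apply/matrixP => a b; rewrite !mxE eq_sym -(coord_basis b a) (sE (e a)).
  have cs (r : seq 'I_m) : coord b (\sum_(j <- r) inner_product_val h (e a) (s j) *: s j) =
     \sum_(j <- r) inner_product_val h (e a) (s j) * coord b (s j).
    elim: r => [|j r IH]; last by rewrite !big_cons coord_linear IH.
    by rewrite !big_nil; have := coord_linear b (-1) 0 0; rewrite scaler0 addr0 mulN1r addNr.
  by rewrite cs; apply: eq_bigr => j _; rewrite !mxE.
have T'T : T *m T' = 1%:M.
  apply/matrixP => a b; rewrite !mxE -hs {1}(coordP (s a)) ip_suml.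
  by apply: eq_bigr => j _; rewrite !mxE.
have TH : T *m gram h *m ctr T = 1%:M.
  apply/matrixP => a b; rewrite [RHS]mxE -hs ip_gram mxE exchange_big; apply: eq_bigr => k _.
  by rewrite mxE ctrE mulr_suml; apply: eq_bigr => j _; rewrite !mxE mulrAC.
have H1 : gram h *m (ctr T *m T) = 1%:M.
  rewrite -[gram h]mul1mx -TT' -!mulmxA [X in _ *m X](_ : _ = T) //.
  by rewrite !mulmxA TH mul1mx.
have -> : invmx (gram h) = ctr T *m T.
  have gu : gram h \in unitmx by have [] := mulmx1_unit H1.
  by rewrite -[RHS](mulKmx gu) H1 mulmx1.
by rewrite mxE; apply: eq_bigr => j _; rewrite ctrE !mxE mulrC.
Qed.

End Coordinates.

End InnerProductAlgebra.

(** * Bergman sections as functions of a matrix *)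

Section LeftInverse.
Variables (K : fieldType) (W : lmodType K) (D : nat) (L : 'rV[K]_D -> W).
Variable (Phi : set (W -> K)).
Hypothesis L_linear : forall a u v, L (a *: u + v) = a *: L u + L v.
Hypothesis Phi_linear : forall phi, Phi phi -> forall a u v, phi (a *: u + v) = a * phi u + phi v.
Hypothesis Phi_separates : forall u, (forall phi, Phi phi -> phi (L u) = 0) -> u = 0.

Definition evaluation_matrix m (phi : 'I_m -> W -> K) : 'M[K]_(D, m) :=
  \matrix_(i, j) phi j (L (delta_mx 0 i)).

Lemma evaluation_matrixE m (phi : 'I_m -> W -> K) u : (forall i, Phi (phi i)) ->
  u *m evaluation_matrix phi = \row_j phi j (L u).
Proof.
move=> Pphi; apply/rowP => j; rewrite !mxE.
have S (r : seq 'I_D) : phi j (L (\sum_(i <- r) u 0 i *: delta_mx 0 i)) =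
    \sum_(i <- r) u 0 i * phi j (L (delta_mx 0 i)).
  elim: r => [|i r IH]; last by rewrite !big_cons L_linear Phi_linear// IH.
  have L0 : L 0 = 0 by have := L_linear (-1) 0 0; rewrite scaler0 addr0 scaleN1r addNr.
  have := Phi_linear (Pphi j) (-1) 0 0.
  by rewrite !big_nil L0 scaler0 addr0 mulN1r addNr.
by rewrite [in RHS](row_sum_delta u) S; apply: eq_bigr => i _; rewrite mxE.
Qed.

(** As long as the common kernel of finitely many functionals is nonzero, some
    functional of [Phi] does not vanish on it, and adding this functional makes
    the kernel smaller. *)
Lemma finite_separation : exists m (phi : 'I_m -> W -> K),
  (forall i, Phi (phi i)) /\ row_free (evaluation_matrix phi).
Proof.
suff H r : forall m (phi : 'I_m -> W -> K), (forall i, Phi (phi i)) ->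
    (\rank (kermx (evaluation_matrix phi)) <= r)%N ->
    exists m' (phi' : 'I_m' -> W -> K), (forall i, Phi (phi' i)) /\ row_free (evaluation_matrix phi').
  pose phi0 (i : 'I_0) : W -> K := match i with Ordinal _ h => match notF h with end end.
  by apply: (H _ 0%N phi0 _ (leqnn _)) => -[].
elim: r => [|r IH] m phi Pphi rk.
  exists m, phi; split=> //; rewrite -kermx_eq0 -mxrank_eq0; by rewrite leqn0 in rk.
have [k0|k0] := eqVneq (kermx (evaluation_matrix phi)) 0.
  by exists m, phi; split=> //; rewrite -kermx_eq0 k0.
have /rowV0Pn[u uk u0] := k0.
have [psi Ppsi psiu] : exists2 psi, Phi psi & psi (L u) != 0.
  apply: contrapT => N; move/eqP: u0; apply; apply: Phi_separates => psi Ppsi.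
  by apply/eqP/negPn/negP => h; apply: N; exists psi.
pose phi' (i : 'I_m.+1) := if unlift ord0 i is Some j then phi j else psi.
have Pphi' i : Phi (phi' i) by rewrite /phi'; case: unlift.
apply: (IH _ phi' Pphi'); rewrite -ltnS; apply: leq_trans rk; apply: rank_ltmx.
rewrite ltmxE; apply/andP; split.
  apply/row_subP => i; have : (row i (kermx (evaluation_matrix phi')) <= kermx (evaluation_matrix phi'))%MS by exact: row_sub.
  move=> /sub_kermxP; rewrite evaluation_matrixE// => v0; apply/sub_kermxP; rewrite evaluation_matrixE//.
  apply/rowP => j; have := congr1 (fun w : 'rV_m.+1 => w 0 (lift ord0 j)) v0.
  by rewrite !mxE /phi' liftK.
apply/negP => sub; have := submx_trans uk sub => /sub_kermxP; rewrite evaluation_matrixE// => v0.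
have := congr1 (fun w : 'rV_m.+1 => w 0 ord0) v0; rewrite !mxE /phi' unlift_none => /eqP.
by rewrite (negPf psiu).
Qed.

Lemma linear_left_inverse : exists m (phi : 'I_m -> W -> K) (G : 'M[K]_(m, D)),
  (forall i, Phi (phi i)) /\ forall u, (\row_j phi j (L u)) *m G = u.
Proof.
have [m [phi [Pphi rf]]] := finite_separation.
exists m, phi, (pinvmx (evaluation_matrix phi)); split=> // u.
by rewrite -evaluation_matrixE// -mulmxA mulmxVp// mulmx1.
Qed.

End LeftInverse.

Section Kernels.
Variables (R : realType) (n : nat) (X : complexManifold R n).
Variable (E : holomorphicBundle X).
Local Notation Z := (realify R R[i]).
Local Notation C := R[i].

Definition tensor_section (u v : holomorphic_section E) : section (E_Ebar E) :=
  fun x => tens (holomorphic_section_val u x) (holomorphic_section_val v x : conjugate (fiber E x)).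

Lemma tensor_section_coord (t1 t2 : trivialization (fiber E) (rank E)) (u v : holomorphic_section E) a b x :
  section_coord (B := E_Ebar E) (tensor_triv t1 (conj_triv t2)) (mxvec_index a b) (tensor_section u v) x =
  section_coord t1 a u x * (section_coord t2 b v x)^*.
Proof.
transitivity (tensor_coord (triv_map t1 x) (conj_coord (triv_map t2 x)) (tensor_section u v x) 0 (mxvec_index a b)) => //.
by rewrite tensor_coord_tens /conj_coord [in LHS]mxE.
Qed.

Lemma tensor_section_smooth u v : tensor_section u v \in @smooth_pred _ _ _ (E_Ebar E).
Proof.
apply/asboolP => _ [t1 Et1 [_ [t2 Et2 <-] <-]] m; case/mxvec_indexP: m => a b c Ac.
pose D := chart_image c (triv_dom t1 `&` triv_dom t2).
have oD : open D by apply: chart_image_open; apply: openI; exact: triv_dom_open.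
have hu : smooth_in D (local_coord c t1 a u).
  by apply: smooth_in_sub (holomorphic_section_local a u Ac Et1).1 => z [cz []].
have hv : smooth_in D (local_coord c t2 b v).
  by apply: smooth_in_sub (holomorphic_section_local b v Ac Et2).1 => z [cz []].
apply: smooth_in_eq (smooth_inM oD hu (smooth_in_post oD (@conj_continuous R) (@conj_linear R) hv)) => // z Dz.
by rewrite /= tensor_section_coord.
Qed.

Definition tensor_smooth_section u v : smooth_section (E_Ebar E) := SmoothSection (tensor_section_smooth u v).

Lemma smooth_coord_sum (B : bundle_data R X) (I : Type) (r : seq I) (a : I -> C) (s : I -> smooth_section B) t j x :
  section_coord t j (\sum_(i <- r) a i *: s i) x = \sum_(i <- r) a i * section_coord t j (s i) x.
Proof.
elim: r => [|i r IH]; first by rewrite !big_nil (section_coord0 t j).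
rewrite !big_cons -IH.
by have := section_coord_linear t j (a i) (s i) (\sum_(k <- r) a k *: s k) => /(congr1 (fun g => g x)).
Qed.

Lemma E_Ebar_section_eq (s s' : section (E_Ebar E)) :
  (forall x (t1 t2 : trivialization (fiber E) (rank E)), trivs E t1 -> trivs E t2 -> triv_dom t1 x -> triv_dom t2 x -> forall a b,
    section_coord (B := E_Ebar E) (tensor_triv t1 (conj_triv t2)) (mxvec_index a b) s x =
    section_coord (B := E_Ebar E) (tensor_triv t1 (conj_triv t2)) (mxvec_index a b) s' x) -> s = s'.
Proof.
move=> ss; apply: functional_extensionality_dep => x.
have [cover bij _] := E_Ebar_bundle E; have [cE _ _] := bundleP E.
have [t Et tx] := cE x.
have T : trivs (E_Ebar E) (tensor_triv t (conj_triv t)).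
  by exists t => //; exists (conj_triv t) => //; exists t.
apply: (bij_inj (bij _ T x (conj tx tx))); apply/rowP => m; case/mxvec_indexP: m => a b.
exact: ss.
Qed.

Variables (d : nat) (e : 'I_d -> holomorphic_section E).

(** The indices of [M] are swapped so that the Bergman section of an inner
    product belongs to the inverse of its Gram matrix, and not to the transpose
    of this inverse. *)
Definition kernel_of (M : 'M[C]_d) : smooth_section (E_Ebar E) :=
  \sum_(p : 'I_d * 'I_d) M p.2 p.1 *: tensor_smooth_section (e p.1) (e p.2).

Lemma kernel_of_coord M (t1 t2 : trivialization (fiber E) (rank E)) a b x :
  section_coord (B := E_Ebar E) (tensor_triv t1 (conj_triv t2)) (mxvec_index a b) (kernel_of M) x =
  \sum_i \sum_l M l i * (section_coord t1 a (e i) x * (section_coord t2 b (e l) x)^*).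
Proof.
rewrite /kernel_of smooth_coord_sum pair_bigA /=; apply: eq_bigr => p _.
by rewrite tensor_section_coord.
Qed.

Lemma kernel_of_linear a M M' : kernel_of (a *: M + M') = a *: kernel_of M + kernel_of M'.
Proof.
rewrite /kernel_of scaler_sumr -big_split; apply: eq_bigr => p _.
by rewrite !mxE scalerDl scalerA.
Qed.

Lemma kernel_of_inj (X_connected : connected [set: X]) : linearly_independent e ->
  forall M, (forall T m x, trivs (E_Ebar E) T -> triv_dom T x -> section_coord T m (kernel_of M) x = 0) -> M = 0.
Proof.
move=> fe M M0; have -> : M = (M^T)^T by rewrite trmxK.
rewrite (@tensor_independence _ _ _ X_connected E d e M^T fe) ?trmx0// => x t Et tx a b.
have T : trivs (E_Ebar E) (tensor_triv t (conj_triv t)).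
  by exists t => //; exists (conj_triv t) => //; exists t.
rewrite -[RHS](M0 _ (mxvec_index a b) x T (conj tx tx)) kernel_of_coord.
by apply: eq_bigr => i _; apply: eq_bigr => l _; rewrite mxE.
Qed.

(** Expand the orthonormal basis in terms of [e]; the coefficients that appear
    are the entries of the inverse of the Gram matrix by [gram_orthonormal]. *)
Lemma bergman_sum_kernel (coord : 'I_d -> holomorphic_section E -> C) :
  linearly_independent e -> (forall v, v = \sum_i coord i v *: e i) ->
  forall (h : inner_product (holomorphic_section E)) m (s : 'I_m -> holomorphic_section E), orthonormal_basis h s ->
  bergman_sum s = smooth_section_val (kernel_of (invmx (gram e h))).
Proof.
move=> fe coordP h m s hs; apply: E_Ebar_section_eq => x t1 t2 Et1 Et2 t1x t2x a b.
rewrite kernel_of_coord.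
have -> : section_coord (B := E_Ebar E) (tensor_triv t1 (conj_triv t2)) (mxvec_index a b) (bergman_sum s) x =
   \sum_j section_coord t1 a (s j) x * (section_coord t2 b (s j) x)^*.
  rewrite /section_coord /bergman_sum linear_sum summxE; apply: eq_bigr => j _.
  exact: tensor_section_coord.
have sE j t a' : section_coord t a' (s j) x = \sum_i coord i (s j) * section_coord t a' (e i) x.
  by rewrite {1}(coordP (s j)) holomorphic_coord_sum.
under eq_bigr do rewrite !sE rmorph_sum mulr_suml.
rewrite exchange_big; apply: eq_bigr => i _.
under eq_bigr do rewrite mulr_sumr.
rewrite exchange_big; apply: eq_bigr => l _.
rewrite -(gram_orthonormal fe coordP hs) mulr_suml; apply: eq_bigr => j _.
by rewrite rmorphM /=; ring.
Qed.

End Kernels.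

(** * Continuity of evaluations and openness of positivity *)

Lemma continuous_at_dist (R : realType) (F : topologicalType) (W : normedModType R) (f : F -> W) x :
  (forall e : R, 0 < e -> nbhs x [set y | `|f y - f x| < e]) -> f @ nbhs x --> f x.
Proof.
move=> H; apply/cvgrPdist_lt => e e0; apply: filterS (H e e0) => y /=.
by rewrite distrC.
Qed.

Lemma scale_continuous_at (R : realType) (T : topologicalType) (G : tvsType R) (r : T -> R) (w : G) x :
  r @ nbhs x --> r x -> (fun z => r z *: w) @ nbhs x --> r x *: w.
Proof. by move=> rx; apply: tvs_cvgZ; [exact: rx|exact: cvg_cst]. Qed.

Section MatrixLinear.
Variables (R : realType) (d : nat) (G : tvsType R) (L : 'M[R[i]]_d -> G).
Local Notation Z := (realify R R[i]).
Hypothesis L_linear : forall (a : R) M M', L (a%:C *: M + M') = a *: L M + L M'.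

Lemma real_linear_expansion M : L M = \sum_(p : 'I_d * 'I_d)
  (complex.Re (M p.1 p.2) *: L (delta_mx p.1 p.2) + complex.Im (M p.1 p.2) *: L ('i%C *: delta_mx p.1 p.2)).
Proof.
have L0 : L 0 = 0 by have := L_linear (-1) 0 0; rewrite scaler0 addr0 scaleN1r addNr.
have LZ a M' : L (a%:C *: M') = a *: L M' by rewrite -[_ *: _]addr0 L_linear L0 addr0.
have LD M1 M2 : L (M1 + M2) = L M1 + L M2 by have := L_linear 1 M1 M2; rewrite !scale1r.
rewrite {1}[M]matrix_sum_delta pair_bigA /=.
elim: (index_enum _) => [|p r IH]; first by rewrite !big_nil.
rewrite !big_cons LD IH; congr (_ + _); rewrite -!LZ -LD; congr L.
by rewrite scalerA -scalerDl mulrC -complexE.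
Qed.

Lemma Ck_scale_Re k (F : tvsType R) (S A : set F) (f : F -> Z) (w : G) :
  Ck k S A f -> Ck k S A (fun x => complex.Re (f x) *: w).
Proof.
apply: (@Ck_postcomp _ k F Z G S A (fun z : Z => complex.Re z *: w) f) => [z|a u v].
  exact: (@scale_continuous_at R Z G (@complex.Re R : Z -> R) w z (@Re_continuous R z)).
by rewrite (Re_linear a u v) scalerDl scalerA.
Qed.

Lemma Ck_scale_Im k (F : tvsType R) (S A : set F) (f : F -> Z) (w : G) :
  Ck k S A f -> Ck k S A (fun x => complex.Im (f x) *: w).
Proof.
apply: (@Ck_postcomp _ k F Z G S A (fun z : Z => complex.Im z *: w) f) => [z|a u v].
  exact: (@scale_continuous_at R Z G (@complex.Im R : Z -> R) w z (@Im_continuous R z)).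
by rewrite (Im_linear a u v) scalerDl scalerA.
Qed.

(** A real linear map on matrices is a combination of the real and imaginary
    parts of the entries with constant coefficients, so it is enough to control
    the entries. *)
Lemma Ck_real_linear k (F : tvsType R) (S A : set F) (M : F -> 'M[R[i]]_d) :
  (forall i j, Ck k S A ((fun x => M x i j) : F -> Z)) -> Ck k S A (fun x => L (M x)).
Proof.
move=> CM; rewrite (_ : (fun x => L (M x)) = fun x => \sum_(p : 'I_d * 'I_d)
  (complex.Re (M x p.1 p.2) *: L (delta_mx p.1 p.2) + complex.Im (M x p.1 p.2) *: L ('i%C *: delta_mx p.1 p.2))).
  by apply: Ck_sum => p; apply: Ck_add; [apply: Ck_scale_Re|apply: Ck_scale_Im]; exact: CM.
by apply/funext => x; exact: real_linear_expansion.
Qed.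

End MatrixLinear.

Section InnerProductTopology.
Variables (R : realType) (V : lmodType R[i]).
Local Notation Z := (realify R R[i]).
Local Notation IP := (inner_product V).

Lemma ip_nbhsE (h0 : IP) (A : set IP) : nbhs h0 A <->
  exists (ks : seq (V * V)) (e : R), 0 < e /\
    forall h, \sum_(k <- ks) `|(inner_product_val (h - h0) k.1 k.2 : Z)| < e -> A h.
Proof.
split; first by move=> [[ks e] /= e0 h]; exists ks, e.
by move=> [ks [e [e0 h]]]; exists (ks, e).
Qed.

Lemma ip_val_continuous u v : continuous ((fun h : IP => inner_product_val h u v : Z) : IP -> Z).
Proof.
move=> h0; apply: (@continuous_at_dist _ _ Z) => e e0; apply/ip_nbhsE; exists [:: (u, v)], e; split=> // h.
by rewrite big_seq1.
Qed.

Lemma ip_val_linear u v (a : R) (h h' : IP) :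
  inner_product_val (a *: h + h') u v = a%:C * inner_product_val h u v + inner_product_val h' u v.
Proof. by []. Qed.

(** If the values of [h'] and [h] on pairs from an [h]-orthonormal basis differ
    by less than [1] in total, then [h' v v] differs from the sum [S] of the
    squared moduli of the coordinates of [v], which is [h v v], by less than
    [S]. *)
Lemma positive_definite_open : (forall h : IP, positive_definite h -> exists d (s : 'I_d -> V), orthonormal_basis h s) ->
  open (@positive_definite R V).
Proof.
move=> onb; rewrite openE => h hp; have [d [s [hs sp]]] := onb h hp.
apply/ip_nbhsE; exists [seq (s p.1, s p.2) | p <- enum {: 'I_d * 'I_d}], 1; split=> // h' hh v v0.
have [a va] := sp v.
pose S : R := \sum_i `|(a i : Z)| ^+ 2.
have aS i : `|(a i : Z)| ^+ 2 <= S by rewrite /S (bigD1 i)//= lerDl sumr_ge0// => j _; rewrite sqr_ge0.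
have S0 : 0 < S.
  have [i ai] : exists i, a i != 0.
    apply: contrapT => H; move/eqP: v0; apply; rewrite va big1// => i _.
    have -> : a i = 0 by apply/eqP/negPn/negP => h0; apply: H; exists i.
    by rewrite scale0r.
  apply: lt_le_trans (aS i); rewrite exprn_gt0// normr_gt0.
  exact: ai.
pose Q := inner_product_val (h' - h) v v.
have hE : inner_product_val h v v = S%:C.
  rewrite va ip_sum2 /S rmorph_sum; apply: eq_bigr => i _; rewrite (bigD1 i)//= hs eqxx mulr1.
  rewrite big1 ?addr0 => [|j ji]; last by rewrite hs eq_sym (negPf ji) mulr0.
  by rewrite rmorphXn /= -normCK -[`|(a i : Z)|]/(realify_norm (a i : Z)) realify_normE.
have QS : `|(Q : Z)| < S.
  have Q1 : `|(Q : Z)| <= S * \sum_(p : 'I_d * 'I_d) `|(inner_product_val (h' - h) (s p.1) (s p.2) : Z)|.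
    rewrite /Q va ip_sum2 pair_bigA /= mulr_sumr; apply: le_trans (@ler_norm_sum _ Z _ _ _ _) _.
    apply: ler_sum => p _; rewrite realify_normM ler_wpM2r// realify_normM.
    have -> : `|((a p.2)^* : Z)| = `|(a p.2 : Z)|.
      apply: complexI; rewrite -[`|((a p.2)^* : Z)|]/(realify_norm ((a p.2)^* : Z)) realify_normE norm_conjC.
      by rewrite -[`|(a p.2 : Z)|]/(realify_norm (a p.2 : Z)) realify_normE.
    have := aS p.1; have := aS p.2; set x := `|_|; set y := `|_| => xS yS.
    have : 0 <= (y - x) ^+ 2 by exact: sqr_ge0.
    rewrite sqrrB => xy; lra.
  apply: le_lt_trans Q1 _; move: hh; rewrite big_map big_enum /= => hh.
  by rewrite -[ltRHS]mulr1 ltr_pM2l.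
have E : inner_product_val h' v v = S%:C + Q.
  by rewrite -hE -[Q]/(inner_product_val h' v v - inner_product_val h v v) addrC subrK.
have Im0 : complex.Im (inner_product_val h' v v) = 0.
  have := ip_sym h' v v; case: (inner_product_val h' v v) => x y [/eqP].
  by rewrite -subr_eq0 opprK -mulr2n mulrn_eq0 /= => /eqP.
rewrite ltcE Im0 eqxx E raddfD /=.
have := realify_ge_Re Q; rewrite ler_norml => /andP[q1 _].
by move: q1 QS; lra.
Qed.

End InnerProductTopology.

Section Evaluation.
Variables (R : realType) (n : nat) (X : complexManifold R n) (B : bundle_data R X).
Local Notation Z := (realify R R[i]).

Lemma section_coord_continuous t j x : trivs B t -> triv_dom t x ->
  continuous ((fun k : Cinfty B => section_coord t j (k : smooth_section B) x : Z) : Cinfty B -> Z).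
Proof.
move=> Bt tx k0; have [c Ac cx] := atlas_cover x.
have Dx := chart_triv_image cx tx.
have sub : [set chart_map c x] `<=` chart_image c (triv_dom t) by move=> _ ->.
pose kk := CinftyIndex [::] j Ac Bt (@compact_set1 _ (chart_map c x)) sub.
apply: (@continuous_at_dist _ _ Z) => e e0; apply/Cinfty_nbhsE; exists [:: kk], e; split=> // k.
rewrite big_seq1; apply: le_lt_trans.
apply: le_trans (@Cinfty_norm_ub _ _ _ _ kk (k - k0) (chart_map c x) erefl).
rewrite -ci_iterB//.
by rewrite /= /ci_local /local_coord /= chart_mapK.
Qed.

End Evaluation.

(** * The Bergman map *)

Lemma Ck0_continuous (R : realType) (F G : tvsType R) (f : F -> G) : Ck 0 setT setT f -> continuous f.
Proof.
by move=> /within_continuousP h x B fB; have := h x Logic.I B fB; apply: filterS => y; apply.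
Qed.

Section BergmanMap.
Variables (R : realType) (n : nat) (X : complexManifold R n).
Hypotheses (X_compact : compact [set: X]) (X_connected : connected [set: X]).
Variable (E : holomorphicBundle X).
Local Notation Z := (realify R R[i]).
Local Notation C := R[i].
Local Notation V := (holomorphic_section E).
Local Notation IP := (inner_product V).
Local Notation M := (Cinfty (E_Ebar E)).
Local Notation H_E := (@positive_definite R V).

(** The coordinates of sections at points are continuous functionals, and by
    [kernel_of_inj] they separate the kernels; [linear_left_inverse] selects
    finitely many of them. *)
Lemma kernel_left_inverse d (e : 'I_d -> V) : linearly_independent e ->
  exists P : M -> 'M[C]_d, [/\ forall A, P (kernel_of e A) = A,
    forall (a : R) (k k' : M), P (a *: k + k') = a%:C *: P k + P k' &
    forall i j, continuous ((fun k => P k i j : Z) : M -> Z)].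
Proof.
move=> fe.
pose Phi : set (smooth_section (E_Ebar E) -> C) := [set f : smooth_section (E_Ebar E) -> C |
  exists (T : trivialization (fiber (E_Ebar E)) (rank (E_Ebar E))) j x,
  [/\ trivs (E_Ebar E) T, triv_dom T x & f = (fun k : smooth_section (E_Ebar E) => section_coord T j k x)]].
have Phil phi : Phi phi -> forall a u v, phi (a *: u + v) = a * phi u + phi v.
  move=> [T [j [x [BT Tx ->]]]] a u v.
  by have := section_coord_linear T j a u v => /(congr1 (fun g => g x)).
have Phic phi : Phi phi -> continuous ((fun k : M => phi (k : smooth_section (E_Ebar E)) : Z) : M -> Z).
  by move=> [T [j [x [BT Tx ->]]]]; exact: section_coord_continuous.
have Ll a (u v : 'rV[C]_(d * d)) : kernel_of e (vec_mx (a *: u + v)) = a *: kernel_of e (vec_mx u) + kernel_of e (vec_mx v).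
  by rewrite linearP kernel_of_linear.
have Psep (u : 'rV[C]_(d * d)) : (forall phi, Phi phi -> phi (kernel_of e (vec_mx u)) = 0) -> u = 0.
  move=> H; rewrite -[u]vec_mxK (_ : vec_mx u = 0) ?linear0//.
  apply: (kernel_of_inj X_connected fe) => T j x BT Tx.
  by apply: (H (fun k : smooth_section (E_Ebar E) => section_coord T j k x)); exists T, j, x.
have [m [phi [G [Pphi PG]]]] := linear_left_inverse Ll Phil Psep.
exists (fun k => vec_mx ((\row_j phi j (k : smooth_section (E_Ebar E))) *m G)); split.
- by move=> A; have := PG (mxvec A); rewrite mxvecK => ->; rewrite mxvecK.
- move=> a k k'.
  have -> : \row_j phi j (a *: k + k') = a%:C *: (\row_j phi j k) + \row_j phi j k'.
    by apply/rowP => j; rewrite !mxE; exact: (Phil _ (Pphi j) a%:C k k').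
  by rewrite mulmxDl -scalemxAl linearP.
- move=> i j k0.
  have PE (k : M) : vec_mx ((\row_j phi j (k : smooth_section (E_Ebar E))) *m G) i j =
    \sum_l (G l (mxvec_index i j) * phi l (k : smooth_section (E_Ebar E)) : Z).
    by rewrite mxE mxE; apply: eq_bigr => l _; rewrite mxE mulrC.
  rewrite /continuous_at PE (_ : (fun k : M => _) = fun k : M => \sum_l (G l (mxvec_index i j) * phi l (k : smooth_section (E_Ebar E)) : Z)).
    apply: (@normed_cvg_sum R Z _ (nbhs k0) (nbhs_filter k0)) => l.
    exact: (@cvg_comp _ _ _ (fun k : M => phi l (k : smooth_section (E_Ebar E)) : Z)
      (fun z : Z => G l (mxvec_index i j) * (z : C) : Z) _ _ _ (Phic _ (Pphi l) k0) (@mulC_continuous R _ _)).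
  by apply/funext => k; exact: PE.
Qed.

Section Basis.
Variables (d : nat) (e : 'I_d -> V) (coord : 'I_d -> V -> C).
Hypothesis e_free : linearly_independent e.
Hypothesis coordP : forall v, v = \sum_i coord i v *: e i.
Hypothesis onb : forall h, H_E h -> exists m (s : 'I_m -> V), orthonormal_basis h s.
Local Notation J := (form_of e_free coordP).
Local Notation gm h := (gram e h).

(** The same section, viewed as a point of the locally convex space of smooth
    sections. *)
Definition kernel (A : 'M[C]_d) : M := kernel_of e A.

Lemma kernel_real_linear (a : R) A A' : kernel (a%:C *: A + A') = a *: kernel A + kernel A'.
Proof. exact: kernel_of_linear. Qed.

Lemma bergman_unique (h : IP) m (s : 'I_m -> V) : H_E h -> orthonormal_basis h s ->
  smooth_section_val (bergman h : smooth_section (E_Ebar E)) = bergman_sum s.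
Proof.
move=> hp hs; have S := bergman_sum_kernel e_free coordP.
have ex : exists k : M, [set k : M | exists m (s : 'I_m -> V),
    orthonormal_basis h s /\ smooth_section_val (k : smooth_section (E_Ebar E)) = bergman_sum s] k.
  by exists (kernel (invmx (gm h))), m, s; split=> //; rewrite (S h m s hs).
have [m' [s' [hs' ->]]] := xgetPex 0 ex.
by rewrite (S h m s hs) (S h m' s' hs').
Qed.

Lemma bergmanE h : H_E h -> bergman h = kernel (invmx (gm h)).
Proof.
move=> hp; have [m [s hs]] := onb hp; apply: val_inj.
rewrite -[LHS]/(smooth_section_val (bergman h : smooth_section (E_Ebar E))) (bergman_unique hp hs).
exact: (bergman_sum_kernel e_free coordP hs).
Qed.

Lemma gram_real_linear (a : R) h h' : gm (a *: h + h') = a%:C *: gm h + gm h'.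
Proof. by apply/matrixP => i j; rewrite !mxE ip_val_linear. Qed.

Lemma herm_real_linear (a : R) (A A' : 'M[C]_d) : herm (a%:C *: A + A') = a%:C *: herm A + herm A'.
Proof.
apply/matrixP => i j; rewrite !mxE rmorphD rmorphM /= (_ : (a%:C)^* = a%:C); last by apply/CrealP; rewrite complex_real.
by ring.
Qed.

Lemma form_of_real_linear (a : R) A A' : J (a%:C *: A + A') = a *: J A + J A'.
Proof. by apply: (gram_inj coordP); rewrite gram_real_linear !gram_form_of herm_real_linear. Qed.

Lemma H_E_open : open H_E.
Proof. exact: positive_definite_open. Qed.

Lemma bergman_Ck k : Ck k setT H_E (bergman (E := E)).
Proof.
have oH := rel_openT H_E_open; have sT := @subspace_likeT R IP.
apply: (Ck_eq (f := fun h => kernel (invmx (gm h))) sT oH); first by move=> h /bergmanE.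
apply: (Ck_real_linear kernel_real_linear) => i j.
apply: (Ck_invmx i j sT oH); first by move=> h hp; exact: gram_unit.
move=> i' j'; apply: (Ck_sub (S := setT) (A := setT)) => //.
have -> : ((fun h : IP => gm h i' j') : IP -> Z) = fun h : IP => inner_product_val h (e i') (e j').
  by apply/funext => h; rewrite mxE.
apply: Ck_linear; first exact: ip_val_continuous.
by move=> a h h'; exact: ip_val_linear.
Qed.

Section Retraction.
Variable P : M -> 'M[C]_d.
Hypothesis kernelK : forall A, P (kernel A) = A.
Hypothesis P_linear : forall (a : R) (k k' : M), P (a *: k + k') = a%:C *: P k + P k'.
Hypothesis P_continuous : forall i j, continuous ((fun k => P k i j : Z) : M -> Z).

(** The [k] for which the Hermitian part of [P k] is positive definite. *)
Definition slice_dom : set M := [set k | H_E (J (P k))].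
Definition bergman_inv (k : M) : IP := J (invmx (herm (P k))).
(** The kernels of Hermitian matrices, written as the fixed points of a
    continuous linear map: this shows that they form a closed subspace. *)
Definition hermitian_kernels : set M := [set k | kernel (herm (P k)) = k].

Lemma P_Ck m i j : Ck m setT setT ((fun k => P k i j : Z) : M -> Z).
Proof.
by apply: Ck_linear => [|a k k']; [exact: P_continuous|rewrite P_linear !mxE].
Qed.

Lemma slice_dom_open : open slice_dom.
Proof.
have c : continuous (fun k => J (P k)).
  by apply: Ck0_continuous; apply: (Ck_real_linear form_of_real_linear) => i j; exact: P_Ck.
by have /continuousP := c; apply; exact: H_E_open.
Qed.

Lemma hermP_Ck m i j : Ck m setT setT ((fun k => herm (P k) i j : Z) : M -> Z).
Proof.
have -> : ((fun k => herm (P k) i j : Z) : M -> Z) =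
   (fun k => 2^-1 * ((P k i j + (P k j i)^* : Z) : R[i]) : Z) by apply/funext => k; rewrite !mxE.
apply: Ck_mul => //; [exact: rel_openT openT|exact: Ck_cst|apply: (@Ck_add _ _ _ Z); first exact: P_Ck].
apply: (@Ck_postcomp _ m M Z Z setT setT (fun z : Z => (z : C)^* : Z) (fun k => P k j i : Z)); last exact: P_Ck.
  exact: conj_continuous.
by move=> a u v; exact: conj_linear.
Qed.

Lemma bergman_inv_Ck m : Ck m setT slice_dom bergman_inv.
Proof.
have oU := rel_openT slice_dom_open; have sT := @subspace_likeT R M.
apply: (Ck_real_linear form_of_real_linear) => i j.
apply: (Ck_invmx i j sT oU); first by move=> k Uk; rewrite -(gram_form_of e_free coordP); exact: gram_unit.
by move=> i' j'; apply: (Ck_sub (S := setT) (A := setT)) => //; exact: hermP_Ck.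
Qed.

Lemma ctr_inv_gram h : ctr (invmx (gm h)) = invmx (gm h).
Proof. by rewrite ctr_inv ctr_gram. Qed.

Lemma bergmanK h : H_E h -> bergman_inv (bergman h) = h.
Proof.
move=> hp; rewrite /bergman_inv bergmanE// kernelK herm_id ?ctr_inv_gram// invmxK.
exact: form_of_gram.
Qed.

(** A kernel of a Hermitian matrix [A] is the Bergman section of the form whose
    Gram matrix is the inverse of [A], provided that [A] is positive definite;
    and [P] recovers [A] from the kernel. *)
Lemma bergman_imageE k : (bergman (E := E) @` H_E) k <-> slice_dom k /\ hermitian_kernels k.
Proof.
split.
  move=> [h hp <-]; rewrite /slice_dom /hermitian_kernels /= bergmanE// kernelK herm_id ?ctr_inv_gram//.
  by split=> //; exact: positive_definite_inv.
move=> [Uk kk]; pose h' := J (P k).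
have gh' : gm h' = herm (P k) by exact: gram_form_of.
have hp : H_E (J (invmx (gm h'))) by exact: positive_definite_inv.
exists (J (invmx (gm h'))) => //.
by rewrite bergmanE// gram_form_of herm_id ?ctr_inv_gram// invmxK gh'.
Qed.

Lemma hermitian_kernels_closed : closed_subspace hermitian_kernels.
Proof.
pose Q (k : M) := kernel (herm (P k)).
have Ql (a : R) k k' : Q (a *: k + k') = a *: Q k + Q k'.
  by rewrite /Q P_linear herm_real_linear kernel_real_linear.
have cQ : continuous (fun k : M => Q k - k).
  apply: Ck0_continuous; apply: Ck_add.
    by apply: (Ck_real_linear kernel_real_linear) => i j; exact: hermP_Ck.
  by apply: Ck_opp; apply: Ck_linear => // k; exact: cvg_id.
split.
- have -> : hermitian_kernels = (fun k : M => Q k - k) @^-1` [set 0].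
    apply/seteqP; split=> k kk.
      have Qk : Q k = k by exact: kk.
      by rewrite /preimage /= Qk subrr.
    have Qk : Q k - k = 0 by exact: kk.
    by apply/eqP; rewrite -subr_eq0 -/(Q k) Qk.
  apply: closed_comp; first by move=> k _; exact: cQ.
  apply: accessible_closed_set1; apply: hausdorff_accessible.
  exact: (Cinfty_hausdorff (E_Ebar_bundle E)).
- by have := Ql (-1) 0 0; rewrite scaler0 addr0 scaleN1r addNr.
- move=> a k k'; rewrite /hermitian_kernels /= => kk kk'.
  by rewrite -[LHS]/(Q _) Ql /Q kk kk'.
Qed.

Lemma translation_smooth (A : set M) (b : M) : open A -> smooth_map setT A (fun k => k + b).
Proof.
move=> oA; split; first by exists A => //; rewrite setIT.
move=> m; apply: (Ck_sub (S := setT) (A := setT)) => //.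
by apply: Ck_add; [apply: Ck_linear => // k; exact: cvg_id|exact: Ck_cst].
Qed.

(** The image is an open part of the closed subspace of Hermitian kernels;
    translate the given point to the origin. *)
Lemma bergman_submanifold : submanifold (bergman (E := E) @` H_E).
Proof.
move=> k0 Nk0; have [Uk0 Sk0] := (bergman_imageE k0).1 Nk0.
have [clS S0 Sl] := hermitian_kernels_closed.
have SD u v : hermitian_kernels u -> hermitian_kernels v -> hermitian_kernels (u + v).
  by move=> su sv; rewrite -[u]scale1r; exact: Sl.
have SN u : hermitian_kernels u -> hermitian_kernels (- u).
  by move=> su; rewrite -[- u]addr0 -scaleN1r; exact: Sl.
pose target : set M := [set y | slice_dom (y + k0)].
have oT : open target.
  have /continuousP c : continuous (fun k : M => k + k0).
    by apply: Ck0_continuous; have [_] := translation_smooth k0 (@openT M); exact.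
  by apply: c; exact: slice_dom_open.
have t0 : target 0 by rewrite /target /= add0r.
have tP k : slice_dom k -> target (k + - k0) by rewrite /target /= subrK.
have tI y : target y -> slice_dom (y + k0) by [].
have mK k : slice_dom k -> (k + - k0) + k0 = k by rewrite subrK.
have iK y : target y -> (y + k0) + - k0 = y by rewrite addrK.
have sl : (fun k => k + - k0) @` (slice_dom `&` (bergman (E := E) @` H_E)) = target `&` hermitian_kernels.
  apply/seteqP; split=> [_ [k [Uk Nk] <-]|y [Ty Sy]].
    have [_ Sk] := (bergman_imageE k).1 Nk.
    by split; [exact: tP|apply: SD => //; exact: SN].
  exists (y + k0); last by rewrite addrK.
  by split=> //; apply/bergman_imageE; split=> //; exact: SD.
pose c := @SliceChart R M (bergman (E := E) @` H_E) M hermitian_kernels slice_dom target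
  (fun k => k + - k0) (fun y => y + k0) (Cinfty_frechet X_compact (E_Ebar_bundle E))
  hermitian_kernels_closed t0 tP tI mK iK (translation_smooth (- k0) slice_dom_open)
  (translation_smooth k0 oT) sl.
by exists c; exact: Uk0.
Qed.

(** Both maps are restrictions of smooth maps defined on open sets, and so are
    their composites with charts: [bergman_inv] is smooth near each point of the
    image, not only along the image. *)
Lemma bergman_diffeomorphism : diffeomorphism_onto H_E (bergman (E := E) @` H_E) (bergman (E := E)).
Proof.
split=> //; exists bergman_inv; split.
- exact: bergmanK.
- move=> c; have [[W oW domE] sm] := sc_map_smooth c.
  have odom : open (sc_dom c) by rewrite domE setIT.
  have oA : open (H_E `&` bergman (E := E) @^-1` sc_dom c).
    have /within_continuousP cb := bergman_Ck 0.
    rewrite openE => h [hp hc].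
    have := @filterI _ (nbhs h) (nbhs_filter h) _ _ (open_nbhs_nbhs (conj H_E_open hp))
      (cb h hp _ (open_nbhs_nbhs (conj odom hc))).
    by apply: (@filterS _ (nbhs h) (nbhs_filter h)) => h' [hp' hc']; split=> //; exact: hc'.
  have roA := rel_openT oA.
  split; first exact: roA.
  move=> m; apply: (Ck_comp (@subspace_likeT R IP) roA odom _ _ (sm m)); first by move=> h [].
  by apply: Ck_sub (bergman_Ck m) => // h [].
- move=> c; have [[W oW tarE] sm] := sc_inv_smooth c.
  have otar : open (sc_target (s := c)) by rewrite tarE setIT.
  have [clS S0 Sl] := sc_sub_closed c.
  have ro : rel_open (sc_sub (s := c)) (sc_target (s := c) `&` sc_sub (s := c)) by exists (sc_target (s := c)).
  split; first exact: ro.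
  move=> m; apply: (Ck_comp (conj S0 Sl) ro slice_dom_open _ _ (bergman_inv_Ck m)).
    move=> y yt; have : (sc_map c @` (sc_dom c `&` (bergman (E := E) @` H_E))) y by rewrite sc_slice.
    by move=> [k [ck Nk] <-]; rewrite /= sc_mapK//; have [] := (bergman_imageE k).1 Nk.
  by apply: Ck_sub (sm m) => // y [].
Qed.

End Retraction.
End Basis.
End BergmanMap.

Theorem theorem1p2 (R : realType) (n : nat) (X : complexManifold R n)
    (X_compact : compact [set: X]) (X_connected : connected [set: X])
    (E : holomorphicBundle X) :
  let H_E : set (inner_product (holomorphic_section E)) :=
    @positive_definite R (holomorphic_section E) in
  [/\ forall h, H_E h ->
        (exists d (s : 'I_d -> holomorphic_section E), orthonormal_basis h s) /\
        forall d (s : 'I_d -> holomorphic_section E), orthonormal_basis h s ->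
          smooth_section_val (bergman h : smooth_section (E_Ebar E)) =
          bergman_sum s,
      submanifold (bergman (E := E) @` H_E) &
      diffeomorphism_onto H_E (bergman (E := E) @` H_E) (bergman (E := E))].
Proof.
have [N [ev [evl evi]]] := holomorphic_section_finite X_compact E.
have onb h := orthonormal_basis_exists evl evi (h := h).
have [h0 h0p] := positive_definite_exists evl evi.
have [d [e [he ep]]] := onb h0 h0p.
have fe := orthonormal_free he.
pose coord i v := inner_product_val h0 v (e i).
have coordP v : v = \sum_i coord i v *: e i.
  have [a av] := ep v; rewrite {1}av; apply: eq_bigr => i _.
  by rewrite /coord av (orthonormal_coef a he).
have [P [PK Pl Pc]] := kernel_left_inverse X_connected fe.
move=> H_E; split.
- move=> h hp; split; first exact: onb.
  by move=> m s; exact: (bergman_unique fe coordP).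
- exact: (bergman_submanifold X_compact fe coordP onb PK Pl Pc).
- exact: (bergman_diffeomorphism fe coordP onb PK Pl Pc).
Qed.
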